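(* Assume that $n > r$. Over $\mathbb{Q}(v)$, the affine $v$-Schur algebra $\widehat{\mathbf{S}}_v(n,r)$ is isomorphic with the associative algebra (with 1) given by the generators $\mathtt{i}_\lambda$ ($\lambda \in \Lambda(n,r)$), $\mathsf{E}_i, \mathsf{F}_i$ ($1 \le i \le n$) and relations \begin{align*} \mathtt{i}_\lambda \, \mathtt{i}_{\mu} &= \delta_{\lambda,\mu} \, \mathtt{i}_\lambda; \qquad \sum_{\lambda \in \Lambda(n,r)} \mathtt{i}_\lambda = 1; \tag{R1}\\ \mathsf{E}_i\, \mathtt{i}_\lambda &= \begin{cases} \mathtt{i}_{\lambda + \alpha_i} \mathsf{E}_i & \text{ if } \lambda_{i+1} > 0,\\ 0 & \text{ otherwise;}\end{cases} \tag{R2}\\ \mathsf{F}_i \,\mathtt{i}_\lambda &= \begin{cases} \mathtt{i}_{\lambda - \alpha_i} \mathsf{F}_i & \text{ if } \lambda_{i} > 0, \\ 0 & \text{ otherwise;}\end{cases} \tag{R3}\\ \mathsf{E}_i \mathsf{F}_j - \mathsf{F}_j \mathsf{E}_i &= \delta_{i,j} \sum_{\lambda \in \Lambda(n,r)} [\lambda_j - \lambda_{j+1}]\,\mathtt{i}_\lambda \tag{R4} \end{align*} along with the relations \begin{align*} \mathsf{E}_i \mathsf{E}_j &= \mathsf{E}_j \mathsf{E}_i \quad \text{ if $i$ and $j$ are not adjacent,}\\ \mathsf{F}_i \mathsf{F}_j &= \mathsf{F}_j \mathsf{F}_i \quad \text{ if $i$ and $j$ are not adjacent,}\\ \mathsf{E}_i^2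 \mathsf{E}_j - (v + v^{-1}) \mathsf{E}_i \mathsf{E}_j \mathsf{E}_i + \mathsf{E}_j \mathsf{E}_i^2 &= 0 \quad \text{ if $i$ and $j$ are adjacent,}\\ \mathsf{F}_j^2 \mathsf{F}_i - (v + v^{-1}) \mathsf{F}_j \mathsf{F}_i \mathsf{F}_j + \mathsf{F}_i \mathsf{F}_j^2 &= 0 \quad \text{ if $i$ and $j$ are adjacent.} \end{align*} Here weights are regarded as infinite periodic sequences of integers indexed by $\mathbb{Z}$: for $\lambda=(\lambda_1,\dots,\lambda_n)$ and any $j\in\mathbb{Z}$, $\lambda_j$ is set equal to $\lambda_i$ where $1\le i\le n$ and $j\equiv i \pmod n$ (so indices of $\mathsf{E}_i,\mathsf{F}_i$ are also read modulo $n$).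
   Context: $v$ is an indeterminate, $q=v^2$, and $\mathcal{A}=\mathbb{Z}[q,q^{-1}]$. $\Lambda(n,r)$ is the set of compositions $\lambda=(\lambda_1,\dots,\lambda_n)$ of $r$ into $n$ nonnegative parts (no monotonicity assumed). $\widehat{\mathbf{S}}_v(n,r)=\mathbb{Q}(v)\otimes_{\mathcal{A}}\widehat{\mathbf{S}}_q(n,r)$, where $\widehat{\mathbf{S}}_q(n,r)=\operatorname{End}_{\mathcal{H}}\big(\bigoplus_{\lambda\in\Lambda(n,r)} x_\lambda\mathcal{H}\big)$ is the affine $q$-Schur algebra, $\mathcal{H}$ being the extended affine Hecke algebra of type $\widehat{A}_{r-1}$ over $\mathcal{A}$ and $x_\lambda=\sum_{w\in \widehat W_\lambda}T_w$ the sum over the corresponding Young (parabolic) subgroup; equivalently, it is the quotient of the quantized enveloping algebra $\mathbf{U}(\widehat{\mathfrak{gl}_n})$ by the kernel of its action on tensor space $V^{\otimes r}$. For $1\le i\le n$, $\alpha_i\in\mathbb{Z}^n$ has $j$-th entry $1$ if $j\equiv i \pmod n$, $-1$ if $j\equiv i+1\pmod n$, and $0$ otherwise. $[m]=(v^m-v^{-m})/(v-v^{-1})$ is the quantum integer. Two indices $i,j$ are ''adjacent'' if they index adjacent nodes of the Dynkin diagram of type $\widehat{A}_{n-1}$, i.e. iff $i-j\equiv\pm1\pmod n$.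
   Formalization: The assumption n ≥ 3 is added: for n = 2, r = 1 the stated relations for adjacent i, j force 1 = 0 in the presented algebra, while the affine v-Schur algebra is nonzero. Otherwise only the degenerate cases r = 0 with n = 1, 2 are left out. *)

(* Defs.v *)
From HB Require Import structures.
From mathcomp Require Import all_boot all_order all_algebra.
From mathcomp Require Import fraction.
Set Implicit Arguments. Unset Strict Implicit. Unset Printing Implicit Defensive.
Import Order.TTheory GRing.Theory Num.Theory.
Local Open Scope ring_scope.

Definition Qv : fieldType := {fraction {poly rat}}.
Definition v : Qv := @FracField.tofrac {poly rat} 'X.
Definition qint (m : int) : Qv := (v ^ m - v ^ (- m)) / (v - v^-1).

(** * Compositions Lambda(n,r): (lambda_j)_{j in 'I_n}, entries >= 0, sum r.
    Index j : 'I_n is the residue class j mod n (paper's index n <-> 0). *)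
Definition Lam (n r : nat) := {f : {ffun 'I_n -> 'I_r.+1} | (\sum_i (f i : nat) == r)%N}.
Definition lam_at n r (l : Lam n r) (j : 'I_n) : nat := sval l j.
Definition alpha n (i j : 'I_n) : int := (j == i : nat)%:Z - (j == ordS i : nat)%:Z.
Definition adjacent n (i j : 'I_n) : bool := (j == ordS i) || (i == ordS j).

(** * Tensor space V^{(x) r}, V with basis e_t (t in Z).
    A basis vector e_{w_0} (x) ... (x) e_{w_{r-1}} is indexed by w : Wd r.
    Vectors are coefficient functions Wd r -> Qv (formal combinations; the
    operators below are given by row- and column-finite matrices, so this
    is a faithful model of the action on V^{(x) r}).  *)
Definition Wd (r : nat) := {ffun 'I_r -> int}.
Definition Vec (r : nat) := Wd r -> Qv.
Definition Op (r : nat) := Vec r -> Vec r.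

Definition bumpw r (w : Wd r) (k : 'I_r) (d : int) : Wd r :=
  [ffun l => if l == k then w l + d else w l].
Definition resid n (t : int) (i : 'I_n) : bool := ((t %% n)%Z == (i : nat)%:Z).

(** Action on V (Green): E_i e_{t+1} = e_t if t = i mod n (else 0),
    F_i e_t = e_{t+1} if t = i mod n (else 0), K_i e_t = v^{[t = i mod n]} e_t.
    Ktilde_i := K_i K_{i+1}^{-1} acts on e_t by kappa i t. *)
Definition kappa n (i : 'I_n) (t : int) : Qv :=
  (if resid t i then v else 1) / (if resid t (ordS i) then v else 1).

(** Action on V^{(x) r} via the coproduct
    Delta(E_i) = E_i (x) 1 + Ktilde_i (x) E_i,
    Delta(F_i) = F_i (x) Ktilde_i^{-1} + 1 (x) F_i,  Delta(K_i) = K_i (x) K_i.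
    Written in coordinates: (T f)(w) = sum_{w'} [coeff of e_w in T e_{w'}] f(w'). *)
Definition E_op n r (i : 'I_n) : Op r := fun f w =>
  \sum_(k < r) (if resid (w k) i
                then (\prod_(l < r | (l < k)%N) kappa i (w l)) * f (bumpw w k 1)
                else 0).
Definition F_op n r (i : 'I_n) : Op r := fun f w =>
  \sum_(k < r) (if resid (w k - 1) i
                then (\prod_(l < r | (k < l)%N) (kappa i (w l))^-1) * f (bumpw w k (-1))
                else 0).
Definition K_op n r (i : 'I_n) : Op r := fun f w =>
  v ^+ #|[pred k : 'I_r | resid (w k) i]| * f w.
Definition Kinv_op n r (i : 'I_n) : Op r := fun f w =>
  v ^- #|[pred k : 'I_r | resid (w k) i]| * f w.

Definition op_add r (x y : Op r) : Op r := fun f w => x f w + y f w.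
Definition op_mul r (x y : Op r) : Op r := fun f => x (y f).
Definition op_scale r (a : Qv) (x : Op r) : Op r := fun f w => a * x f w.
Definition op_one r : Op r := fun f => f.
Definition op_zero r : Op r := fun f w => 0.

Inductive gen_alg r (G : Op r -> Prop) : Op r -> Prop :=
| ga_gen x : G x -> gen_alg G x
| ga_one : gen_alg G (@op_one r)
| ga_add x y : gen_alg G x -> gen_alg G y -> gen_alg G (op_add x y)
| ga_mul x y : gen_alg G x -> gen_alg G y -> gen_alg G (op_mul x y)
| ga_scale a x : gen_alg G x -> gen_alg G (op_scale a x).

(** The affine v-Schur algebra S_v(n,r): image of U(gl_n^) (generators
    E_i, F_i, K_i^{+-1}, i in Z/nZ) in End(V^{(x) r}). *)
Definition AffSchur n r : Op r -> Prop :=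
  gen_alg (fun x => exists i : 'I_n,
     x = @E_op n r i \/ x = @F_op n r i \/ x = @K_op n r i \/ x = @Kinv_op n r i).

Record ops (A : Type) := Ops {
  oadd : A -> A -> A; omul : A -> A -> A; oscale : Qv -> A -> A;
  oone : A; ozero : A }.

Definition op_ops r : ops (Op r) :=
  Ops (@op_add r) (@op_mul r) (@op_scale r) (@op_one r) (@op_zero r).
Definition alg_ops (B : algType Qv) : ops B :=
  Ops (fun x y : B => x + y) (fun x y : B => x * y) (fun a (x : B) => a *: x) 1 0.

Definition relations n r A (o : ops A) (ii : Lam n r -> A) (E F : 'I_n -> A) : Prop :=
  let add := oadd o in let mul := omul o in let sc := oscale o in
  let sub x y := add x (sc (-1) y) in
      (forall l m : Lam n r, mul (ii l) (ii m) = if l == m then ii l else ozero o)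
   /\ (\big[add/ozero o]_(l : Lam n r) ii l = oone o)
   /\
      (forall (i : 'I_n) (l : Lam n r),
         ((0 < lam_at l (ordS i))%N ->
            forall m : Lam n r,
              (forall j, (lam_at m j)%:Z = (lam_at l j)%:Z + alpha i j) ->
              mul (E i) (ii l) = mul (ii m) (E i))
         /\ (lam_at l (ordS i) = 0%N -> mul (E i) (ii l) = ozero o))
   /\
      (forall (i : 'I_n) (l : Lam n r),
         ((0 < lam_at l i)%N ->
            forall m : Lam n r,
              (forall j, (lam_at m j)%:Z = (lam_at l j)%:Z - alpha i j) ->
              mul (F i) (ii l) = mul (ii m) (F i))
         /\ (lam_at l i = 0%N -> mul (F i) (ii l) = ozero o))
   /\
      (forall i j : 'I_n,
         sub (mul (E i) (F j)) (mul (F j) (E i)) =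
         if i == j then
           \big[add/ozero o]_(l : Lam n r)
              sc (qint ((lam_at l j)%:Z - (lam_at l (ordS j))%:Z)) (ii l)
         else ozero o)
   /\
      (forall i j : 'I_n, ~~ adjacent i j ->
         mul (E i) (E j) = mul (E j) (E i) /\ mul (F i) (F j) = mul (F j) (F i))
   /\
      (forall i j : 'I_n, adjacent i j ->
         add (add (mul (mul (E i) (E i)) (E j))
                  (sc (- (v + v^-1)) (mul (mul (E i) (E j)) (E i))))
             (mul (E j) (mul (E i) (E i))) = ozero o
         /\
         add (add (mul (mul (F j) (F j)) (F i))
                  (sc (- (v + v^-1)) (mul (mul (F j) (F i)) (F j))))
             (mul (F i) (mul (F j) (F j))) = ozero o).

(** [presents S ii E F]: the subalgebra S of operators is generated by the
    elements ii, E, F, these satisfy the relations, and S has the universal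
    property of the algebra given by these generators and relations (any
    family satisfying the relations in any Qv-algebra B is the image of
    ii, E, F under a unital algebra homomorphism S -> B).  Equivalently,
    S is isomorphic to the presented algebra via ii, E, F. *)
Definition presents n r (S : Op r -> Prop) (ii : Lam n r -> Op r) (E F : 'I_n -> Op r) : Prop :=
  [/\ (forall x, S x <->
         gen_alg (fun y => (exists l, y = ii l) \/ (exists i, y = E i \/ y = F i)) x),
      relations (op_ops r) ii E F
    & forall (B : algType Qv) (bi : Lam n r -> B) (bE bF : 'I_n -> B),
        relations (alg_ops B) bi bE bF ->
        exists phi : Op r -> B,
          [/\ (forall x y, S x -> S y ->
                 phi (op_add x y) = phi x + phi y /\ phi (op_mul x y) = phi x * phi y),
              (forall a x, S x -> phi (op_scale a x) = a *: phi x),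
              phi (@op_one r) = 1,
              (forall l, phi (ii l) = bi l)
            & (forall i, phi (E i) = bE i /\ phi (F i) = bF i)]].

(* Main.v *)
Require Import Defs.
From HB Require Import structures.
From mathcomp Require Import all_boot all_order all_algebra.
From mathcomp Require Import all_fingroup fraction boolp functions zify ring.
Import Order.TTheory GRing.Theory Num.Theory.
Set Implicit Arguments.
Unset Strict Implicit.
Unset Printing Implicit Defensive.
Local Open Scope ring_scope.

(** Let [B] be an algebra with elements satisfying the relations.  The operators on tensor space
    and the elements of [B] act together on [V^{(x) r} * B].  The universal property says that a
    pair [(0, b)] in the algebra generated by the pairs of generators has [b = 0].
    Since [r < n], every weight [lam] has an empty site.  If [lam (i + 1) = 0] then [E_i F_i] acts on
    the weight space of [lam] by [[lam i] != 0], so that weights can be changed by invertible hole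
    moves; hence every idempotent factors through that of [omega = (1^r, 0^(n - r))], and it
    suffices to show that the submodule generated by [u = (e_0 (x) ... (x) e_(r-1), i_omega)] meets
    [0 * B] trivially.
    On the weight space of [omega], moving all particles one place around the circle and the
    operators [F_j E_j] satisfy the relations of the extended affine Hecke algebra; the braid
    relation comes from the Serre relations.  Therefore they send [u] into the span of vectors
    indexed by affine words, whose first components are distinct basis vectors of tensor space: this
    span meets [0 * B] trivially.  A straightening argument shows that hole moves bring every vector
    generated by [u] into this span. *)

(** No basis of the presented algebra is available in advance, so independence has to be read off in
    tensor space; in the joint action the first component of a vector then controls the second. The
    obstacle is that [E_i] and [F_i] leave the weights with at most one particle per site, on which
    Hecke operators suffice. Hence a vector of arbitrary weight is called good when a chain of moves
    into holes, each invertible up to a nonzero quantum integer, takes it into the Hecke span. Moves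
    into different holes commute, so goodness is a linear condition that can be tested after any
    such move. Stability under [E_i] and [F_i] is then an induction on the number of surplus
    particles. The Serre relations act in two places only: when two neighbouring particles slide
    together past [F_i E_i], and in the braid relation. Throughout, [lam p] particles sit at site
    [p] of a circle with [n] sites; [E_i] moves a particle from [i + 1] to [i], and [F_i] moves one
    from [i] to [i + 1]. *)

Section LinearReflection.
Variables (K : pzRingType) (M : lmodType K).

Inductive lexp :=
  LAtom of nat | LAdd of lexp & lexp | LOpp of lexp | LScale of K & lexp | LZero.

Fixpoint leval (env : seq M) e : M := match e with
  | LAtom k => env`_k | LAdd a b => leval env a + leval env b
  | LOpp a => - leval env a | LScale c a => c *: leval env a | LZero => 0 end.

Fixpoint lcoef e (k : nat) : K := match e with
  | LAtom j => if eqn j k then 1 else 0 | LAdd a b => lcoef a k + lcoef b k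
  | LOpp a => - lcoef a k | LScale c a => c * lcoef a k | LZero => 0 end.

(** Unfolds to one conjunct per atom, so that [repeat split] leaves one scalar equation each.
    Equality of coefficients is a sufficient condition; the atoms may be dependent. *)
Fixpoint lin_goal (m : nat) (e1 e2 : lexp) : Prop :=
  if m is m'.+1 then lcoef e1 m' = lcoef e2 m' /\ lin_goal m' e1 e2 else True.

Lemma leval_coef env e :
  leval env e = \sum_(k < size env) lcoef e k *: env`_k.
Proof.
elim: e => [j|a IHa b IHb|a IHa|c a IHa|] /=.
- case: (ltnP j (size env)) => jn.
    rewrite (bigD1 (Ordinal jn)) //= big1 ?addr0 => [|k].
      by rewrite [eqn _ _]eqxx scale1r.
    by rewrite -val_eqE eq_sym /= /eq_op /= => /negPf->; rewrite scale0r.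
  rewrite nth_default // big1 // => k _; case: ifP; last by rewrite scale0r.
  by move/eqP=> E; have := ltn_ord k; rewrite -E ltnNge jn.
- by rewrite IHa IHb -big_split; apply: eq_bigr => k _; rewrite scalerDl.
- by rewrite IHa -sumrN; apply: eq_bigr => k _; rewrite scaleNr.
- by rewrite IHa scaler_sumr; apply: eq_bigr => k _; rewrite scalerA.
- by rewrite big1 // => k _; rewrite scale0r.
Qed.

Lemma lin_eq env e1 e2 :
  lin_goal (size env) e1 e2 -> leval env e1 = leval env e2.
Proof.
rewrite !leval_coef => H; apply: eq_bigr => k _; congr (_ *: _).
elim: (size env) (k : nat) (ltn_ord k) H => [//|m IH] j /=.
rewrite ltnS leq_eqVlt => jm [H1 H2].
by case/orP: jm => [/eqP->|jm] //; apply: IH H2.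
Qed.
End LinearReflection.

Ltac lin_find x env :=
  lazymatch env with
  | nil => constr:(0%N)
  | cons x _ => constr:(0%N)
  | cons _ ?e => let k := lin_find x e in constr:(S k)
  end.
Ltac lin_mem x env :=
  lazymatch env with
  | nil => constr:(false)
  | cons x _ => constr:(true)
  | cons _ ?e => lin_mem x e
  end.
Ltac lin_atoms env t :=
  lazymatch t with
  | (?a + ?b)%R => let e := lin_atoms env a in lin_atoms e b
  | (- ?a)%R => lin_atoms env a
  | (?c *: ?a)%R => lin_atoms env a
  | 0%R => env
  | _ => let b := lin_mem t env in
         lazymatch b with true => env | false => constr:(cons t env) end
  end.
Ltac lin_reify K env t :=
  lazymatch t with
  | (?a + ?b)%R => let e1 := lin_reify K env a in
                   let e2 := lin_reify K env b in constr:(LAdd e1 e2)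
  | (- ?a)%R => let e1 := lin_reify K env a in constr:(LOpp e1)
  | (?c *: ?a)%R => let e1 := lin_reify K env a in constr:(LScale c e1)
  | 0%R => constr:(LZero K)
  | _ => let k := lin_find t env in constr:(LAtom K k)
  end.
(** Reduces an equation between linear combinations in [M] to the equality of the coefficients
    of each atom, which is left to [ring] or [field]. *)
Ltac lin_norm K M :=
  lazymatch goal with |- ?l = ?r =>
    let env := lin_atoms (@nil M) l in
    let env := lin_atoms env r in
    let e1 := lin_reify K env l in
    let e2 := lin_reify K env r in
    change (leval env e1 = leval env e2);
    apply: lin_eq; rewrite /=; repeat split
  end.

(** * Weights and affine words *)

Section Weights.
Variable n : nat.
Implicit Types (i j p : 'I_n) (lam : 'I_n -> nat).

Lemma ordSE i : ordS i = (if i.+1 == n then 0 else i.+1) :> nat.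
Proof.
rewrite /=; case: eqP => [->|H]; first by rewrite modnn.
by rewrite modn_small //; have := ltn_ord i; lia.
Qed.

Lemma ordS_neq i : (1 < n)%N -> ordS i != i.
Proof. move=> n1; apply/eqP => /(congr1 (@nat_of_ord n)); rewrite ordSE.
by case: eqP; lia. Qed.

Lemma ordSS_neq i : (2 < n)%N -> ordS (ordS i) != i.
Proof.
move=> n2; apply/eqP => /(congr1 (@nat_of_ord n)); rewrite ordSE ordSE.
by have := ltn_ord i; case: eqP; case: eqP; lia.
Qed.

(** Addition of [alpha i]. The predecessor truncates at 0, so this is faithful only for positive
    [lam (ordS i)]. *)
Definition eup i lam : 'I_n -> nat :=
  fun p => if p == i then (lam p).+1 else if p == ordS i then (lam p).-1 else lam p.
Definition fdn i lam : 'I_n -> nat :=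
  fun p => if p == i then (lam p).-1 else if p == ordS i then (lam p).+1 else lam p.

Lemma eup_i i lam : eup i lam i = (lam i).+1.
Proof. by rewrite /eup eqxx. Qed.
Lemma eup_S i lam : (1 < n)%N -> eup i lam (ordS i) = (lam (ordS i)).-1.
Proof. by move=> n1; rewrite /eup (negPf (ordS_neq i n1)) eqxx. Qed.
Lemma eup_p i lam p : p != i -> p != ordS i -> eup i lam p = lam p.
Proof. by rewrite /eup => /negPf-> /negPf->. Qed.
Lemma fdn_i i lam : fdn i lam i = (lam i).-1.
Proof. by rewrite /fdn eqxx. Qed.
Lemma fdn_S i lam : (1 < n)%N -> fdn i lam (ordS i) = (lam (ordS i)).+1.
Proof. by move=> n1; rewrite /fdn (negPf (ordS_neq i n1)) eqxx. Qed.
Lemma fdn_p i lam p : p != i -> p != ordS i -> fdn i lam p = lam p.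
Proof. by rewrite /fdn => /negPf-> /negPf->. Qed.

Lemma eup_fdn i lam : (1 < n)%N -> (0 < lam i)%N -> eup i (fdn i lam) = lam.
Proof.
move=> n1 H; apply/funext => p; rewrite /eup /fdn.
by case: (eqVneq p i) => [->|_]; [lia|case: eqVneq => [->|//]; lia].
Qed.
Lemma fdn_eup i lam : (1 < n)%N -> (0 < lam (ordS i))%N -> fdn i (eup i lam) = lam.
Proof.
move=> n1 H; apply/funext => p; rewrite /eup /fdn.
by case: (eqVneq p i) => [->|_]; [lia|case: eqVneq => [->|//]; lia].
Qed.

Lemma fdn_fdn i j lam : (0 < lam i)%N -> (0 < lam j)%N ->
  fdn i (fdn j lam) = fdn j (fdn i lam).
Proof.
move=> Hi Hj; apply/funext => p; rewrite /fdn.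
by case: (eqVneq p i) => [e|_]; case: (eqVneq p j) => [e'|_];
  do ?case: eqVneq => ?; subst; lia.
Qed.
Lemma eup_eup i j lam : (0 < lam (ordS i))%N -> (0 < lam (ordS j))%N ->
  eup i (eup j lam) = eup j (eup i lam).
Proof.
move=> Hi Hj; apply/funext => p; rewrite /eup.
by case: (eqVneq p i) => [e|_]; case: (eqVneq p j) => [e'|_];
  do ?case: eqVneq => ?; subst; lia.
Qed.
Lemma eup_fdnC i j lam : i != j -> eup i (fdn j lam) = fdn j (eup i lam).
Proof.
move=> ij; apply/funext => p; rewrite /eup /fdn.
case: (eqVneq p i) => [e|_]; case: (eqVneq p j) => [e'|_] //.
- by rewrite -e -e' eqxx in ij.
- by case: eqVneq => ?; subst; lia.
- by case: eqVneq => ?; subst; lia.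
case: (eqVneq p (ordS i)) => [e1|_]; case: (eqVneq p (ordS j)) => [e2|_] //.
by move: e2; rewrite e1 => /ordS_inj e; rewrite e eqxx in ij.
Qed.

(** The old terms are added on both sides to avoid truncated subtraction. With [h] the identity this
    gives the size, with [h] the predecessor the excess. *)
Lemma sum_eup (h : nat -> nat) i lam : (1 < n)%N ->
  (\sum_p h (eup i lam p) + h (lam i) + h (lam (ordS i)) =
   \sum_p h (lam p) + h (lam i).+1 + h (lam (ordS i)).-1)%N.
Proof.
move=> n1; have Si := ordS_neq i n1.
rewrite (bigD1 i) // (bigD1 (ordS i)) //= eup_i eup_S //.
rewrite [in RHS](bigD1 i) // [in RHS](bigD1 (ordS i)) //=.
rewrite [X in (_ + (_ + X) + _ + _)%N](eq_bigr (fun p => h (lam p))); first by lia.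
by move=> p /andP[H1 H2]; rewrite eup_p.
Qed.
Lemma sum_fdn (h : nat -> nat) i lam : (1 < n)%N ->
  (\sum_p h (fdn i lam p) + h (lam i) + h (lam (ordS i)) =
   \sum_p h (lam p) + h (lam i).-1 + h (lam (ordS i)).+1)%N.
Proof.
move=> n1; have Si := ordS_neq i n1.
rewrite (bigD1 i) // (bigD1 (ordS i)) //= fdn_i fdn_S //.
rewrite [in RHS](bigD1 i) // [in RHS](bigD1 (ordS i)) //=.
rewrite [X in (_ + (_ + X) + _ + _)%N](eq_bigr (fun p => h (lam p))); first by lia.
by move=> p /andP[H1 H2]; rewrite fdn_p.
Qed.

Lemma weighted_sum_eup (g : 'I_n -> nat) i lam : (1 < n)%N -> lam (ordS i) = 1%N ->
  (\sum_p g p * eup i lam p + g (ordS i) = \sum_p g p * lam p + g i)%N.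
Proof.
move=> n1 e; have Si := ordS_neq i n1.
rewrite (bigD1 i) // (bigD1 (ordS i)) //= eup_i eup_S // e.
rewrite [in RHS](bigD1 i) // [in RHS](bigD1 (ordS i)) //= e.
rewrite [X in (_ + (_ + X) + _)%N](eq_bigr (fun p => g p * lam p)%N); first by lia.
by move=> p /andP[H1 H2]; rewrite eup_p.
Qed.

Definition size_wt lam := (\sum_p lam p)%N.
(** Number of particles beyond one per occupied site; it measures the distance from simple weights
    and drives the inductions on stacks. *)
Definition excess lam := (\sum_p (lam p).-1)%N.

Lemma size_eup i lam : (1 < n)%N -> (0 < lam (ordS i))%N ->
  size_wt (eup i lam) = size_wt lam.
Proof. by move=> n1 H; have := sum_eup id i lam n1; rewrite /size_wt /=; lia. Qed.
Lemma size_fdn i lam : (1 < n)%N -> (0 < lam i)%N ->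
  size_wt (fdn i lam) = size_wt lam.
Proof. by move=> n1 H; have := sum_fdn id i lam n1; rewrite /size_wt /=; lia. Qed.

Definition simple_wt lam := forall p, (lam p <= 1)%N.

Lemma simple_eup i lam : simple_wt lam -> lam i = 0%N -> simple_wt (eup i lam).
Proof.
move=> S e p; rewrite /eup; case: eqP => [->|_]; first by rewrite e.
by case: eqP => // _; have := S p; lia.
Qed.
Lemma simple_fdn i lam : simple_wt lam -> lam (ordS i) = 0%N -> simple_wt (fdn i lam).
Proof.
move=> S e p; rewrite /fdn; case: eqP => [->|_]; first by have := S i; lia.
by case: eqP => [->|_]; [rewrite e|exact: S].
Qed.

Lemma hole_exists lam : (size_wt lam < n)%N -> exists i, lam i = 0%N.
Proof.
move=> H; apply: contrapT => no.
suff: (n <= size_wt lam)%N by rewrite leqNgt H.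
rewrite -[X in (X <= _)%N]card_ord -sum1_card /size_wt leq_sum // => p _.
by rewrite lt0n; apply/eqP => E; apply: no; exists p.
Qed.
End Weights.

Lemma modz_witness (a b d : int) : (a = b %[mod d])%Z -> exists m, a = b + m * d.
Proof.
move=> e; exists ((a %/ d)%Z - (b %/ d)%Z).
by rewrite {1}(divz_eq a d) {1}(divz_eq b d) e; ring.
Qed.

(** * Windows of extended affine permutations *)

Section AffineWords.
Variable r : nat.
Hypothesis r0 : (0 < r)%N.
Implicit Types (x : {ffun 'I_r -> int}) (k l p : 'I_r) (t c : int).

(** Such a word is the window of an extended affine permutation: adding [r] to a position adds [r]
    to the value. *)
Definition distinct x := forall k l, (x k = x l %[mod r])%Z -> k = l.
Definition next_to x k l := (x l = x k + 1 %[mod r])%Z.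
(** For [next_to x k l] this is left multiplication by the affine simple reflection that exchanges
    the residues of [x k] and [x k + 1]. *)
Definition swapw x k l : {ffun 'I_r -> int} :=
  [ffun p => if p == k then x p + 1 else if p == l then x p - 1 else x p].
(** If [x l = x k + 1 + m * r], the value [x k + 1] sits at position [l - m * r] of the periodic
    extension. The condition says that this position precedes [k], so that the reflection shortens
    the permutation. *)
Definition descent x k l := x k + ((k < l)%N : nat)%:Z < x l.
Definition shiftw x c : {ffun 'I_r -> int} := [ffun k => x k + c].
Definition base_word : {ffun 'I_r -> int} := [ffun k : 'I_r => (k : nat)%:Z].
(** A computable substitute for the Coxeter length: it also drops with every descent. *)
Definition energy x := \sum_(k < r) (x k - k%:Z) ^+ 2.

Lemma swapw_k x k l : swapw x k l k = x k + 1.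
Proof. by rewrite ffunE eqxx. Qed.
Lemma swapw_l x k l : l != k -> swapw x k l l = x l - 1.
Proof. by rewrite ffunE => /negPf->; rewrite eqxx. Qed.
Lemma swapw_p x k l p : p != k -> p != l -> swapw x k l p = x p.
Proof. by rewrite ffunE => /negPf-> /negPf->. Qed.
Lemma swapwK x k l : k != l -> swapw (swapw x k l) l k = x.
Proof.
move=> kl; have lk : l != k by rewrite eq_sym.
apply/ffunP => p; rewrite !ffunE.
case: (eqVneq p l) => [->|_]; first by rewrite (negPf lk) /=; ring.
by case: eqVneq => [_|//] /=; ring.
Qed.

Lemma modzDr_eq t t' c : (t = t' %[mod r])%Z -> (t + c = t' + c %[mod r])%Z.
Proof. by move=> e; rewrite -modzDml e modzDml. Qed.
Lemma modzDr_inj t t' c : (t + c = t' + c %[mod r])%Z -> (t = t' %[mod r])%Z.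
Proof. by move=> /(modzDr_eq (- c)); rewrite !addrK. Qed.

Lemma swapw_mod x k l p : next_to x k l -> k != l ->
  (swapw x k l p = x (tperm k l p) %[mod r])%Z.
Proof.
move=> a kl; case: tpermP => [->|->|/eqP H1 /eqP H2].
- by rewrite swapw_k.
- by rewrite swapw_l 1?eq_sym // (modzDr_eq (-1) a) addrK.
by rewrite swapw_p.
Qed.

Lemma distinct_swapw x k l : distinct x -> next_to x k l -> k != l ->
  distinct (swapw x k l).
Proof.
move=> D a kl p p'; rewrite !swapw_mod // => /D; exact: perm_inj.
Qed.

Lemma next_to_swapw x k l : next_to x k l -> k != l -> next_to (swapw x k l) l k.
Proof.
by move=> a kl; rewrite /next_to swapw_k swapw_l 1?eq_sym // subrK a.
Qed.

Lemma next_to_l x k l l' : distinct x -> next_to x k l -> next_to x k l' -> l = l'.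
Proof. by move=> D a a'; apply: D; rewrite a. Qed.
Lemma next_to_k x k k' l : distinct x -> next_to x k l -> next_to x k' l -> k = k'.
Proof. by move=> D a a'; apply: D; apply: (@modzDr_inj _ _ 1); rewrite -a. Qed.

Lemma descent_neq x k l : descent x k l -> k != l.
Proof. by rewrite /descent; case: eqVneq => // ->; rewrite ltnn addr0 ltxx. Qed.

Lemma energy_swapw x k l : next_to x k l -> descent x k l ->
  energy (swapw x k l) < energy x.
Proof.
move=> a d; have kl := descent_neq d; have lk : l != k by rewrite eq_sym.
have [m Em] := modz_witness a.
rewrite /energy (bigD1 k) // (bigD1 l) //= [ltRHS](bigD1 k) // [in ltRHS](bigD1 l) //=.
rewrite (eq_bigr (fun p => (x p - p%:Z) ^+ 2)) => [|p /andP[H1 H2]]; last first.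
  by rewrite swapw_p.
rewrite swapw_k swapw_l // !addrA ltrD2r -subr_gt0 /=.
(* The energy drops by twice [x l - x k - (l - k + 1)]. For [l < k] positivity is immediate; for
   [k < l] a descent forces [x l - x k] to be at least [r + 1]. *)
have H : l%:Z - k%:Z + 1 < x l - x k.
  move: d; rewrite /descent; have := ltn_ord l; have := ltn_ord k.
  case: (ltnP k l) => H Hk Hl; last first.
    move: lk; rewrite -(inj_eq (@ord_inj r)); lia.
  rewrite Em => Hm; have m0 : 0 < m by nia.
  by nia.
rewrite (_ : _ - _ = (x l - x k - (l%:Z - k%:Z + 1)) * 2); first by lia.
by ring.
Qed.

Lemma energy_ge0 x : 0 <= energy x.
Proof. by apply: sumr_ge0 => k _; apply: sqr_ge0. Qed.

Lemma residue_surj x t : distinct x -> exists k, (x k = t %[mod r])%Z.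
Proof.
move=> D; have Hlt u : (`|(u %% r)%Z|%N < r)%N by have := @ltz_pmod u r; have := @modz_ge0 u r; lia.
pose f k : 'I_r := Ordinal (Hlt (x k)).
have fI : injective f.
  move=> k l /(congr1 val) /= E; apply: D.
  by have := @modz_ge0 (x k) r; have := @modz_ge0 (x l) r; lia.
have /codomP[k Ek] := injF_onto fI (Ordinal (Hlt t)).
exists k; move/(congr1 val): Ek => /= E.
by have := @modz_ge0 (x k) r; have := @modz_ge0 t r; lia.
Qed.

Lemma next_ex x k : distinct x -> exists l, next_to x k l.
Proof. exact: residue_surj. Qed.

Lemma shift_no_descent c k l :
  next_to (shiftw base_word c) k l -> ~ descent (shiftw base_word c) k l.
Proof.
rewrite /next_to /descent !ffunE => /modz_witness[m].
have := ltn_ord k; have := ltn_ord l; case: (ltnP k l) => /= H1 H2 H3 Em; last by lia.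
have [H4|H4] : m <= 0 \/ 1 <= m by lia.
  by nia.
by nia. 
Qed.

(** Follow the residues upwards from position 0. Without descents a step either raises the value by
    one and the position strictly, or lowers the value by at least [r - 1]. After [r] steps the
    cycle closes, which leaves room for one fall only. *)
Lemma no_descent_shift x : distinct x ->
  (forall k l, next_to x k l -> ~ descent x k l) -> exists c, x = shiftw base_word c.
Proof.
move=> D nd; pose k0 : 'I_r := Ordinal r0.
have [f Hf] : exists f : 'I_r -> 'I_r, forall k, next_to x k (f k).
  by exists (fun k => projT1 (cid (next_ex k D))) => k; case: cid.
pose p j := iter j f k0.
have step j : x (p j.+1) = x (p j) + 1 /\ (p j < p j.+1)%N \/
              x (p j.+1) <= x (p j) + 1 - r%:Z.
  rewrite /p /= -/(p j); have [m Em] := modz_witness (Hf (p j)).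
  move: (nd _ _ (Hf (p j))); rewrite /descent Em; case: ltnP => H /negP; rewrite -leNgt => Hm.
    have : m <= 0 by nia.
    rewrite le_eqVlt => /orP[/eqP->|m0]; first by left; rewrite mul0r addr0.
    by right; nia.
  right; have m0 : m < 0 by nia.
  by nia.
have pmod j : (x (p j) = x k0 + j%:Z %[mod r])%Z.
  elim: j => [|j IH]; first by rewrite addr0.
  rewrite (Hf (p j)) (modzDr_eq 1 IH); congr (_ %% _)%Z; lia.
have pr : p r = k0 by apply: D; rewrite pmod modzDr.
have mono i d : x (p (i + d)%N) <= x (p i) + d%:Z.
  elim: d => [|d IH]; first by rewrite addn0 addr0.
  by rewrite addnS; case: (step (i + d)%N) => [[-> _]|]; lia.
(* The cycle ends at position 0, which no step that raises the position can reach; so the fall is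
   the last step. *)
have last_step : x k0 <= x (p r.-1) + 1 - r%:Z.
  have := step r.-1; rewrite prednK // pr => -[[_ H]|//].
  by move: H; rewrite /= ltn0.
have exact j : (j < r.-1)%N -> x (p j.+1) = x (p j) + 1 /\ (p j < p j.+1)%N.
  move=> jr; case: (step j) => // H.
  have := mono j.+1 (r.-1 - j.+1)%N; rewrite subnKC // => H1.
  by have := mono 0%N j; rewrite add0n {2}/p /=; lia.
have val_p j : (j < r)%N -> (p j : nat) = j /\ x (p j) = x k0 + j%:Z.
  move=> jr.
  have up d : (d < r)%N -> (d <= p d)%N /\ x (p d) = x k0 + d%:Z.
    elim: d => [|d IH] dr; first by rewrite addr0.
    have [H1 H2] := IH ltac:(lia); have [-> H3] := exact d ltac:(lia).
    by split; [lia|rewrite H2; lia].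
  have [H1 H2] := up j jr; split => //.
  have : forall d, (j + d < r)%N -> (p j + d <= p (j + d)%N)%N.
    elim=> [|d IH] H; first by rewrite !addn0.
    have := IH ltac:(lia); have [_] := exact (j + d)%N ltac:(lia).
    by rewrite !addnS; lia.
  move=> /(_ (r.-1 - j)%N); have := ltn_ord (p (j + (r.-1 - j)))%N; lia.
exists (x k0); apply/ffunP => k; rewrite !ffunE.
have [E1 E2] := val_p k (ltn_ord k).
by rewrite addrC -E2; congr (x _); apply: ord_inj.
Qed.

End AffineWords.

(** * Quantum integers and modules with weight vectors *)

Definition qnum (K : fieldType) (q : K) (m : int) : K := (q ^ m - q ^ (- m)) / (q - q^-1).

(** Common interface of tensor space, the left regular module of an algebra with the relations, and
    their product. The predicate [wt] replaces the idempotents, so the commutator of [E i] and [F i]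
    is prescribed on weight vectors only. *)
Record weight_module (K : fieldType) (q : K) (n : nat) (M : lmodType K)
    (E F : 'I_n -> M -> M) (wt : ('I_n -> nat) -> M -> Prop) : Prop := WeightModule {
  wm_EL : forall i a x y, E i (a *: x + y) = a *: E i x + E i y;
  wm_FL : forall i a x y, F i (a *: x + y) = a *: F i x + F i y;
  wm_wtL : forall lam a x y, wt lam x -> wt lam y -> wt lam (a *: x + y);
  wm_E0 : forall i lam y, wt lam y -> lam (ordS i) = 0%N -> E i y = 0;
  wm_EU : forall i lam y, wt lam y -> (0 < lam (ordS i))%N -> wt (eup i lam) (E i y);
  wm_F0 : forall i lam y, wt lam y -> lam i = 0%N -> F i y = 0;
  wm_FD : forall i lam y, wt lam y -> (0 < lam i)%N -> wt (fdn i lam) (F i y);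
  wm_EF : forall i lam y, wt lam y ->
    E i (F i y) = F i (E i y) + qnum q ((lam i)%:Z - (lam (ordS i))%:Z) *: y;
  wm_EFn : forall i j y, i != j -> E i (F j y) = F j (E i y);
  wm_EE : forall i j y, ~~ adjacent i j -> E i (E j y) = E j (E i y);
  wm_FF : forall i j y, ~~ adjacent i j -> F i (F j y) = F j (F i y);
  wm_SE : forall i j y, adjacent i j ->
    E i (E i (E j y)) + (- (q + q^-1)) *: E i (E j (E i y)) + E j (E i (E i y)) = 0;
  wm_SF : forall i j y, adjacent i j ->
    F i (F i (F j y)) + (- (q + q^-1)) *: F i (F j (F i y)) + F j (F i (F i y)) = 0 }.

Section Qnum.
Variables (K : fieldType) (q : K).
Hypotheses (q0 : q != 0) (qN : forall m : int, m != 0 -> qnum q m != 0).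

Lemma q_sub_neq0 : q - q^-1 != 0.
Proof.
by apply/eqP => E; have /eqP := @qN 1 isT; rewrite /qnum E invr0 mulr0; case.
Qed.
Lemma qnum0 : qnum q 0 = 0.
Proof. by rewrite /qnum oppr0 subrr mul0r. Qed.
Lemma qnumN m : qnum q (- m) = - qnum q m.
Proof. by rewrite /qnum opprK -mulNr opprB. Qed.
Lemma qnum1 : qnum q 1 = 1.
Proof. by rewrite /qnum expr1z exprN1 divff ?q_sub_neq0. Qed.
Lemma qnum2 : qnum q 2 = q + q^-1.
Proof.
have H := q_sub_neq0.
rewrite /qnum -invr_expz -exprnP -exprVn subr_sqr.
by rewrite mulrAC divff // mul1r.
Qed.
Lemma qnum3 : qnum q 3 + 1 = (q + q^-1) * (q + q^-1).
Proof.
have H := q_sub_neq0; rewrite /qnum -invr_expz -exprnP -exprVn.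
apply: (mulIf H); rewrite mulrDl divfK // mul1r.
have : q * q^-1 = 1 by rewrite divff.
move: (q^-1) => p qp.
rewrite !exprS expr0 !mulr1.
have -> : (q + p) * (q + p) * (q - p) = q * (q * q) - p * (p * p) + q * p * q - q * p * p by ring.
by rewrite qp; ring.
Qed.
End Qnum.

(** * Tensor space *)

(** [a] and [b] stand for the two summands of the coproduct. *)
Section SerreSum.
Variables (K : fieldType) (M : lmodType K) (c : K).
Variables (a1 a2 b1 b2 : M -> M).
Hypothesis c0 : c != 0.
Hypotheses (a1D : forall x y, a1 (x + y) = a1 x + a1 y) (a1Z : forall k x, a1 (k *: x) = k *: a1 x).
Hypotheses (a2D : forall x y, a2 (x + y) = a2 x + a2 y) (a2Z : forall k x, a2 (k *: x) = k *: a2 x).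
Hypotheses (b1D : forall x y, b1 (x + y) = b1 x + b1 y) (b1Z : forall k x, b1 (k *: x) = k *: b1 x).
Hypotheses (b2D : forall x y, b2 (x + y) = b2 x + b2 y) (b2Z : forall k x, b2 (k *: x) = k *: b2 x).
Hypothesis b1a1 : forall x, b1 (a1 x) = (c * c) *: a1 (b1 x).
Hypothesis b1a2 : forall x, b1 (a2 x) = c^-1 *: a2 (b1 x).
Hypothesis b2a1 : forall x, b2 (a1 x) = c^-1 *: a1 (b2 x).

Definition serre_expr (f g : M -> M) x :=
  f (f (g x)) + (- (c + c^-1)) *: f (g (f x)) + g (f (f x)).

(** When every [b] is moved to the right of every [a], each mixed monomial cancels by itself; for
    [a1 a1 b2] the coefficient is [1 - (c + c^-1) c^-1 + c^-2]. *)
Lemma serre_sum x : serre_expr a1 a2 x = 0 -> serre_expr b1 b2 x = 0 ->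
  serre_expr (fun y => a1 y + b1 y) (fun y => a2 y + b2 y) x = 0.
Proof.
move=> Ha Hb; rewrite -[RHS]addr0 -{1}Ha -Hb /serre_expr.
rewrite !(a1D, a1Z, a2D, a2Z, b1D, b1Z, b2D, b2Z, b1a1, b1a2, b2a1).
by lin_norm K M; field.
Qed.
End SerreSum.

Lemma v_neq0 : v != 0.
Proof. by rewrite /v tofrac_eq0 polyX_eq0. Qed.

Lemma v_exp_inj (m : nat) : (0 < m)%N -> v ^+ m != 1.
Proof.
move=> m0; rewrite /v -tofracXn -tofrac1 tofrac_eq.
by apply/eqP => /(congr1 (fun p : {poly rat} => size p)); rewrite size_polyXn size_poly1; lia.
Qed.

Lemma v_expz_neq1 (m : int) : m != 0 -> v ^ m != 1.
Proof.
case: m => m m0; first by rewrite -exprnP v_exp_inj // lt0n; move: m0.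
by rewrite NegzE -exprnN invr_eq1 v_exp_inj.
Qed.

Lemma qnum_neq0 (K : fieldType) (q : K) (m : int) : q != 0 ->
  (forall m : int, m != 0 -> q ^ m != 1) -> m != 0 -> qnum q m != 0.
Proof.
move=> q0 qX m0; have expE a : q ^ a != q ^ (- a) \/ a = 0.
  have [->|a0] := eqVneq a 0; [by right|left].
  have /qX : a + a != 0 by lia.
  by apply: contra => /eqP e; rewrite expfzDr // {2}e -expfzDr // subrr.
rewrite /qnum mulf_neq0 ?invr_eq0 // subr_eq0.
  by case: (expE m) => // e; rewrite e in m0.
by have [|//] := expE 1; rewrite expr1z exprN1.
Qed.

(** Otherwise [done] and [ring] unfold [v] and compute with fractions of polynomials. *)
Local Opaque v.

Lemma qnum_v_neq0 (m : int) : m != 0 -> qnum v m != 0.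
Proof. apply: qnum_neq0; [exact: v_neq0|exact: v_expz_neq1]. Qed.

Lemma v_sub_neq0 : v - v^-1 != 0.
Proof. exact: (q_sub_neq0 qnum_v_neq0). Qed.

Lemma mulrCA_aux (K : fieldType) (a b c : K) : a * b * c = c * a * b.
Proof. by rewrite mulrC mulrA. Qed.

Lemma diag_aux (K : fieldType) (c a b x : K) (s t : bool) : c != 0 ->
  (if s then a * (if s then b * x else 0) else 0) -
  (if t then b * (if t then a * x else 0) else 0) =
  c^-1 * x * (a * b * (c * (s%:R - t%:R))).
Proof.
move=> c0; have -> : c^-1 * x * (a * b * (c * (s%:R - t%:R))) = a * b * (s%:R - t%:R) * x.
  by field.
by case: s; case: t; rewrite /=; ring.
Qed.

Section TensorSpace.
Variables (n r : nat).
Hypothesis n2 : (2 < n)%N.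
Let n1 : (1 < n)%N := ltnW n2.
Implicit Types (i j : 'I_n) (k l : 'I_r) (w : Wd r) (t : int).

Definition VecM : lmodType Qv := Wd r -> Qv^o.
Implicit Types f g : VecM.

Lemma resid_inj t i j : resid t i -> resid t j -> i = j.
Proof. by rewrite /resid => /eqP-> /eqP[] /ord_inj. Qed.
Lemma residS t i : resid (t + 1) (ordS i) = resid t i.
Proof.
have Ht := @modz_ge0 t n; have Ht' := @ltz_pmod t n.
rewrite /resid -modzDml ordSE; move: (t %% n)%Z Ht Ht' => s Ht Ht'.
have s0 : 0 <= s by apply: Ht; lia.
have sn : s < n by apply: Ht'; lia.
have := ltn_ord i => Hi; case: (eqVneq i.+1 n) => [e|ne].
  case: (eqVneq (s + 1) n) => [es|nes].
    by rewrite es modzz; apply/eqP/eqP; lia.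
  by rewrite modz_small; [apply/eqP/eqP; lia|lia].
case: (eqVneq (s + 1) n) => [es|nes].
  by rewrite es modzz; apply/eqP/eqP; lia.
by rewrite modz_small; [apply/eqP/eqP; lia|lia].
Qed.
Lemma residP t i j : resid t i -> resid t j = (j == i).
Proof.
move=> Hi; apply/idP/eqP => [Hj|->//]; exact: resid_inj Hj Hi.
Qed.
Lemma residSP t i j : resid t i -> resid (t + 1) j = (j == ordS i).
Proof. by rewrite -residS => /residP ->. Qed.

Lemma bumpC w k l (d d' : int) : k != l ->
  bumpw (bumpw w k d) l d' = bumpw (bumpw w l d') k d.
Proof.
move=> kl; apply/ffunP => p; rewrite !ffunE.
by case: (eqVneq p l) => [->|//]; rewrite eq_sym (negPf kl).
Qed.
Lemma bumpD w k (d d' : int) : bumpw (bumpw w k d) k d' = bumpw w k (d + d').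
Proof. by apply/ffunP => p; rewrite !ffunE; case: eqP => _ //; rewrite addrA. Qed.
Lemma bump0 w k : bumpw w k 0 = w.
Proof. by apply/ffunP => p; rewrite !ffunE addr0; case: ifP. Qed.
Lemma bump_k w k (d : int) : bumpw w k d k = w k + d.
Proof. by rewrite ffunE eqxx. Qed.
Lemma bump_l w k l (d : int) : l != k -> bumpw w k d l = w l.
Proof. by rewrite ffunE => /negPf->. Qed.

(** This is [v] to the power of minus the Cartan integer, the factor by which [kappa j] changes when
    a letter of residue [i] is raised by one. *)
Definition cartan i j : Qv :=
  if i == j then v^-1 * v^-1 else if adjacent i j then v else 1.

Lemma cartanC i j : cartan i j = cartan j i.
Proof. by rewrite /cartan eq_sym /adjacent orbC. Qed.
Lemma cartan_neq0 i j : cartan i j != 0.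
Proof.
rewrite /cartan; case: ifP => _; first by rewrite mulf_neq0 ?invr_eq0 ?v_neq0.
by case: ifP; rewrite ?oner_eq0 ?v_neq0.
Qed.

Lemma kappaS i j t : resid t i -> kappa j (t + 1) = cartan i j * kappa j t.
Proof.
move=> Ht; rewrite /kappa !(residP _ Ht) !(residSP _ Ht) /cartan /adjacent.
rewrite (inj_eq (@ordS_inj n)) (eq_sym j i) (eq_sym (ordS j) i).
case: (eqVneq i j) => [<-|ij].
  have a := negPf (ordS_neq i n1); have b : (i == ordS i) = false by rewrite eq_sym.
  by rewrite ?a ?b mul1r invr1 mulr1 mulfVK // v_neq0.
case: (eqVneq j (ordS i)) => [->|ji] /=.
  by rewrite eq_sym (negPf (ordSS_neq i n2)) !invr1 !mulr1.
case: (eqVneq i (ordS j)) => [e|_] /=; last by rewrite !mul1r.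
by rewrite !mul1r invr1 mulfV // v_neq0.
Qed.

Definition left_weight i w k : Qv := \prod_(l < r | (l < k)%N) kappa i (w l).
Definition right_weight i w k : Qv := \prod_(l < r | (k < l)%N) (kappa i (w l))^-1.

Lemma left_weight_out i w k l (d : int) : ~~ (l < k)%N ->
  left_weight i (bumpw w l d) k = left_weight i w k.
Proof.
move=> lk; apply: eq_bigr => p pk; rewrite bump_l //.
by apply: contra lk => /eqP<-.
Qed.
Lemma right_weight_out i w k l (d : int) : ~~ (k < l)%N ->
  right_weight i (bumpw w l d) k = right_weight i w k.
Proof.
move=> lk; apply: eq_bigr => p pk; rewrite bump_l //.
by apply: contra lk => /eqP<-.
Qed.
Lemma left_weight_in i j w k l : (l < k)%N -> resid (w l) i ->
  left_weight j (bumpw w l 1) k = cartan i j * left_weight j w k.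
Proof.
move=> lk Hl; rewrite /left_weight (bigD1 l) //= [in RHS](bigD1 l) //= bump_k (kappaS _ Hl).
rewrite -mulrA; congr (_ * (_ * _)); apply: eq_bigr => p /andP[_ pl].
by rewrite bump_l.
Qed.
Lemma left_weight_in' i j w k l : (l < k)%N -> resid (w l - 1) i ->
  left_weight j (bumpw w l (-1)) k = (cartan i j)^-1 * left_weight j w k.
Proof.
move=> lk Hl; rewrite -[w in RHS](bump0 _ l) -(addNr 1) -bumpD.
by rewrite (@left_weight_in i) ?bump_k // mulKf // cartan_neq0.
Qed.
Lemma right_weight_in i j w k l : (k < l)%N -> resid (w l) i ->
  right_weight j (bumpw w l 1) k = (cartan i j)^-1 * right_weight j w k.
Proof.
move=> lk Hl; rewrite /right_weight (bigD1 l) //= [in RHS](bigD1 l) //= bump_k (kappaS _ Hl).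
rewrite invfM -mulrA; congr (_ * (_ * _)); apply: eq_bigr => p /andP[_ pl].
by rewrite bump_l.
Qed.
Lemma right_weight_in' i j w k l : (k < l)%N -> resid (w l - 1) i ->
  right_weight j (bumpw w l (-1)) k = cartan i j * right_weight j w k.
Proof.
move=> lk Hl; rewrite -[w in RHS](bump0 _ l) -(addNr 1) -bumpD.
by rewrite (@right_weight_in i) ?bump_k // mulVKf // cartan_neq0.
Qed.

Definition E_at i k f : VecM :=
  fun w => if resid (w k) i then left_weight i w k * f (bumpw w k 1) else 0.
Definition F_at i k f : VecM :=
  fun w => if resid (w k - 1) i then right_weight i w k * f (bumpw w k (-1)) else 0.

Lemma E_opE i f : @E_op n r i f = \sum_k E_at i k f :> VecM.
Proof. by apply/funext => w; rewrite fct_sumE. Qed.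
Lemma F_opE i f : @F_op n r i f = \sum_k F_at i k f :> VecM.
Proof. by apply/funext => w; rewrite fct_sumE. Qed.

Lemma E_atD i k f g : E_at i k (f + g) = E_at i k f + E_at i k g.
Proof.
apply/funext => w; rewrite /E_at !addrfctE; case: ifP => _; last by rewrite addr0.
by rewrite mulrDr.
Qed.
Lemma F_atD i k f g : F_at i k (f + g) = F_at i k f + F_at i k g.
Proof.
apply/funext => w; rewrite /F_at !addrfctE; case: ifP => _; last by rewrite addr0.
by rewrite mulrDr.
Qed.
Lemma E_atZ i k a f : E_at i k (a *: f) = a *: E_at i k f.
Proof.
apply/funext => w; rewrite /E_at !scalrfctE; case: ifP => _; last by rewrite scaler0.
by rewrite /GRing.scale /= mulrCA.
Qed.
Lemma F_atZ i k a f : F_at i k (a *: f) = a *: F_at i k f.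
Proof.
apply/funext => w; rewrite /F_at !scalrfctE; case: ifP => _; last by rewrite scaler0.
by rewrite /GRing.scale /= mulrCA.
Qed.

Lemma E_E_at i j k l f : (k < l)%N ->
  E_at i k (E_at j l f) = cartan i j *: E_at j l (E_at i k f).
Proof.
move=> kl; have nkl : k != l by rewrite -(inj_eq (@ord_inj r)); lia.
apply/funext => w; rewrite scalrfctE /E_at /GRing.scale /=.
rewrite !bump_l // 1?eq_sym //.
case: ifP => Hi; case: ifP => Hj; rewrite ?mulr0 //.
rewrite (left_weight_in _ kl Hi) left_weight_out; last by lia.
by rewrite bumpC // mulrCA -!mulrA; congr (_ * _); rewrite mulrCA.
Qed.
Lemma F_F_at i j k l f : (k < l)%N ->
  F_at j l (F_at i k f) = cartan i j *: F_at i k (F_at j l f).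
Proof.
move=> kl; have nkl : k != l by rewrite -(inj_eq (@ord_inj r)); lia.
apply/funext => w; rewrite scalrfctE /F_at /GRing.scale /=.
rewrite !bump_l // 1?eq_sym //.
case: ifP => Hj; case: ifP => Hi; rewrite ?mulr0 //.
rewrite (right_weight_in' _ kl Hj) right_weight_out; last by lia.
by rewrite bumpC 1?eq_sym // cartanC mulrCA -!mulrA; congr (_ * _); rewrite mulrCA.
Qed.
Lemma E_E_at_same i j k f : j != ordS i -> E_at i k (E_at j k f) = 0.
Proof.
move=> ji; apply/funext => w; rewrite /E_at bump_k; case: ifP => // Hi.
by rewrite (residSP _ Hi) (negPf ji) mulr0.
Qed.
Lemma F_F_at_same i j k f : i != ordS j -> F_at i k (F_at j k f) = 0.
Proof.
move=> ij; apply/funext => w; rewrite /F_at bump_k; case: ifP => // Hi.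
case: ifP => Hj; last by rewrite mulr0.
by have := residSP i Hj; rewrite subrK Hi (negPf ij).
Qed.
Lemma E_F_at i j k l f : k != l -> E_at i k (F_at j l f) = F_at j l (E_at i k f).
Proof.
move=> nkl; have lk : l != k by rewrite eq_sym.
apply/funext => w; rewrite /E_at /F_at !bump_l //.
case: ifP => Hi; case: ifP => Hj; rewrite ?mulr0 //.
rewrite bumpC //; case: (ltnP k l) => kl.
  rewrite right_weight_out ?left_weight_out; try lia.
  by rewrite mulrCA.
have {kl} lk' : (l < k)%N by rewrite ltn_neqAle kl andbT -(inj_eq (@ord_inj r)) in lk *.
rewrite (right_weight_in _ lk' Hi) (left_weight_in' _ lk' Hj) cartanC.
by rewrite -!mulrA [LHS]mulrCA [RHS]mulrCA; congr (_ * _); rewrite mulrCA.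
Qed.
Lemma E_F_at_same i j k f : i != j -> E_at i k (F_at j k f) = 0 /\ F_at j k (E_at i k f) = 0.
Proof.
move=> ij; split; apply/funext => w; rewrite /E_at /F_at bump_k.
  by case: ifP => // Hi; rewrite addrK (residP _ Hi) eq_sym (negPf ij) mulr0.
by case: ifP => // Hj; rewrite (residP _ Hj) (negPf ij) mulr0.
Qed.

Lemma map_sum (phi : VecM -> VecM) (I : finType) (P : pred I) (g : I -> VecM) :
  (forall f g, phi (f + g) = phi f + phi g) -> phi (\sum_(k | P k) g k) = \sum_(k | P k) phi (g k).
Proof.
move=> D; apply: (big_morph phi D).
by apply: (@addrI _ (phi 0)); rewrite -D !addr0.
Qed.

Lemma E_op_lin i a f g :
  @E_op n r i (a *: f + g : VecM) = a *: (@E_op n r i f : VecM) + (@E_op n r i g : VecM) :> VecM.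
Proof.
rewrite !E_opE scaler_sumr -big_split; apply: eq_bigr => k _.
by rewrite E_atD E_atZ.
Qed.
Lemma F_op_lin i a f g :
  @F_op n r i (a *: f + g : VecM) = a *: (@F_op n r i f : VecM) + (@F_op n r i g : VecM) :> VecM.
Proof.
rewrite !F_opE scaler_sumr -big_split; apply: eq_bigr => k _.
by rewrite F_atD F_atZ.
Qed.

Definition Eo i (f : VecM) : VecM := @E_op n r i f.
Definition Fo i (f : VecM) : VecM := @F_op n r i f.
Lemma EoE i f : Eo i f = \sum_k E_at i k f. Proof. exact: E_opE. Qed.
Lemma FoE i f : Fo i f = \sum_k F_at i k f. Proof. exact: F_opE. Qed.

Lemma Eo_sum i j f : Eo i (Eo j f) = \sum_k \sum_l E_at i k (E_at j l f).
Proof. by rewrite EoE; apply: eq_bigr => k _; rewrite EoE map_sum //; apply: E_atD. Qed.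
Lemma Fo_sum i j f : Fo i (Fo j f) = \sum_k \sum_l F_at i k (F_at j l f).
Proof. by rewrite FoE; apply: eq_bigr => k _; rewrite FoE map_sum //; apply: F_atD. Qed.
Lemma EF_sum i j f : Eo i (Fo j f) = \sum_k \sum_l E_at i k (F_at j l f).
Proof. by rewrite EoE; apply: eq_bigr => k _; rewrite FoE map_sum //; apply: E_atD. Qed.
Lemma FE_sum i j f : Fo j (Eo i f) = \sum_k \sum_l F_at j l (E_at i k f).
Proof.
rewrite exchange_big FoE; apply: eq_bigr => k _; rewrite EoE map_sum //; exact: F_atD.
Qed.

Lemma Eo_Fo i j f : i != j -> Eo i (Fo j f) = Fo j (Eo i f).
Proof.
move=> ij; rewrite EF_sum FE_sum; apply: eq_bigr => k _; apply: eq_bigr => l _.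
case: (eqVneq k l) => [<-|kl]; last exact: E_F_at.
by have [-> ->] := E_F_at_same k f ij.
Qed.

Lemma cartan_far i j : i != j -> ~~ adjacent i j -> cartan i j = 1.
Proof. by rewrite /cartan => /negPf-> /negPf->. Qed.

Lemma Eo_Eo i j f : ~~ adjacent i j -> Eo i (Eo j f) = Eo j (Eo i f).
Proof.
case: (eqVneq i j) => [->//|ij] na.
have [ji ij'] : j != ordS i /\ i != ordS j by move: na; rewrite /adjacent negb_or => /andP.
rewrite !Eo_sum [RHS]exchange_big; apply: eq_bigr => k _; apply: eq_bigr => l _.
case: (ltngtP k l) => kl.
- by rewrite E_E_at // cartan_far // scale1r.
- by rewrite (E_E_at j i f kl) cartanC cartan_far // scale1r.
by rewrite (ord_inj kl) !E_E_at_same.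
Qed.
Lemma Fo_Fo i j f : ~~ adjacent i j -> Fo i (Fo j f) = Fo j (Fo i f).
Proof.
case: (eqVneq i j) => [->//|ij] na.
have [ji ij'] : j != ordS i /\ i != ordS j by move: na; rewrite /adjacent negb_or => /andP.
rewrite !Fo_sum [RHS]exchange_big; apply: eq_bigr => k _; apply: eq_bigr => l _.
case: (ltngtP k l) => kl.
- by rewrite (F_F_at i j f kl) cartan_far // scale1r.
- by rewrite (F_F_at j i f kl) cartanC cartan_far // scale1r.
by rewrite (ord_inj kl) !F_F_at_same.
Qed.

(** Partial sums of the iterated coproduct over the first [m] tensor factors; adding one factor at a
    time makes the Serre relation an induction. *)
Definition E_upto (m : nat) i f : VecM := \sum_(k < r | (k < m)%N) E_at i k f.
Definition F_upto (m : nat) i f : VecM := \sum_(k < r | (k < m)%N) F_at i k f.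

Lemma E_upto0 i f : E_upto 0 i f = 0.
Proof. by rewrite /E_upto big_pred0. Qed.
Lemma F_upto0 i f : F_upto 0 i f = 0.
Proof. by rewrite /F_upto big_pred0. Qed.
Lemma E_uptoS k i f : E_upto k.+1 i f = E_upto k i f + E_at i k f.
Proof.
rewrite /E_upto (bigD1 k) //= addrC; congr (_ + _); apply: eq_bigl => p.
by rewrite ltnS ltn_neqAle andbC -(inj_eq (@ord_inj r)).
Qed.
Lemma F_uptoS k i f : F_upto k.+1 i f = F_upto k i f + F_at i k f.
Proof.
rewrite /F_upto (bigD1 k) //= addrC; congr (_ + _); apply: eq_bigl => p.
by rewrite ltnS ltn_neqAle andbC -(inj_eq (@ord_inj r)).
Qed.
Lemma E_uptoD m i f g : E_upto m i (f + g) = E_upto m i f + E_upto m i g.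
Proof. by rewrite -big_split; apply: eq_bigr => k _; apply: E_atD. Qed.
Lemma E_uptoZ m i a f : E_upto m i (a *: f) = a *: E_upto m i f.
Proof. by rewrite scaler_sumr; apply: eq_bigr => k _; apply: E_atZ. Qed.
Lemma F_uptoD m i f g : F_upto m i (f + g) = F_upto m i f + F_upto m i g.
Proof. by rewrite -big_split; apply: eq_bigr => k _; apply: F_atD. Qed.
Lemma F_uptoZ m i a f : F_upto m i (a *: f) = a *: F_upto m i f.
Proof. by rewrite scaler_sumr; apply: eq_bigr => k _; apply: F_atZ. Qed.

Lemma E_at_upto i j k f : E_at j k (E_upto k i f) = (cartan i j)^-1 *: E_upto k i (E_at j k f).
Proof.
rewrite map_sum; last exact: E_atD.
rewrite scaler_sumr; apply: eq_bigr => l lk.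
by rewrite (E_E_at i j f lk) scalerA mulVf ?scale1r // cartan_neq0.
Qed.
Lemma F_at_upto i j k f : F_at j k (F_upto k i f) = cartan i j *: F_upto k i (F_at j k f).
Proof.
rewrite map_sum; last exact: F_atD.
by rewrite scaler_sumr; apply: eq_bigr => l lk; rewrite (F_F_at i j f lk).
Qed.

Lemma cartan_adj i j : adjacent i j -> cartan i j = v.
Proof.
rewrite /cartan => a; case: eqP => [e|_]; last by rewrite a.
by move: a; rewrite e /adjacent orbb eq_sym (negPf (ordS_neq j n1)).
Qed.
Lemma cartan_same i : cartan i i = v^-1 * v^-1.
Proof. by rewrite /cartan eqxx. Qed.

Lemma E_upto_serre i j m f : adjacent i j -> (m <= r)%N ->
  serre_expr v (E_upto m i) (E_upto m j) f = 0.
Proof.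
move=> a; have aC : adjacent j i by rewrite /adjacent orbC.
have Si := ordS_neq i n1.
elim: m => [|m IH] mr; first by rewrite /serre_expr !E_upto0 scaler0 !addr0.
pose k := Ordinal mr.
transitivity (serre_expr v (fun g => E_upto m i g + E_at i k g)
                           (fun g => E_upto m j g + E_at j k g) f).
  by rewrite /serre_expr !(E_uptoS k).
apply: serre_sum => //; try exact: E_uptoD; try exact: E_uptoZ; try exact: E_atD;
  try exact: E_atZ.
- exact: v_neq0.
- by move=> g; rewrite (E_at_upto i i k) cartan_same invfM invrK.
- by move=> g; rewrite (E_at_upto j i k) cartan_adj.
- by move=> g; rewrite (E_at_upto i j k) cartan_adj.
- by apply: IH; apply: ltnW.
(* On a single tensor factor every triple product of the Serre relation vanishes, because no letter
   passes through [i] twice in three steps when [n > 2]. *)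
have iSi : i != ordS i by rewrite eq_sym.
rewrite /serre_expr !(E_E_at_same (i := i) (j := i)) //.
have E_at0 p : E_at p k (0 : VecM) = 0.
  by have := E_atZ p k 0 0; rewrite !scale0r.
rewrite E_at0 addr0 add0r.
case/orP: (a) => /eqP e.
  rewrite (E_E_at_same (i := j) (j := i)) ?E_at0 ?scaler0 //.
  by rewrite e eq_sym ordSS_neq.
rewrite (E_E_at_same (i := i) (j := j)) ?scaler0 //.
by rewrite e eq_sym ordSS_neq.
Qed.

Lemma F_upto_serre i j m f : adjacent i j -> (m <= r)%N ->
  serre_expr v (F_upto m i) (F_upto m j) f = 0.
Proof.
move=> a; have aC : adjacent j i by rewrite /adjacent orbC.
have Si := ordS_neq i n1.
elim: m => [|m IH] mr; first by rewrite /serre_expr !F_upto0 scaler0 !addr0.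
pose k := Ordinal mr.
(* In the coproduct of [F] the weights stand on the other side, which inverts the commutation
   factors; the Serre expression is symmetric in [c] and [c^-1]. *)
transitivity (serre_expr v^-1 (fun g => F_upto m i g + F_at i k g)
                           (fun g => F_upto m j g + F_at j k g) f).
  by rewrite /serre_expr !(F_uptoS k) invrK [v^-1 + v]addrC.
apply: serre_sum => //; try exact: F_uptoD; try exact: F_uptoZ; try exact: F_atD;
  try exact: F_atZ.
- by rewrite invr_eq0 v_neq0.
- by move=> g; rewrite (F_at_upto i i k) cartan_same.
- by move=> g; rewrite (F_at_upto j i k) cartan_adj // invrK.
- by move=> g; rewrite (F_at_upto i j k) cartan_adj // invrK.
- by have := IH (ltnW mr); rewrite /serre_expr invrK [v^-1 + v]addrC.
have iSi : i != ordS i by rewrite eq_sym.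
rewrite /serre_expr !(F_F_at_same (i := i) (j := i)) //.
have F_at0 p : F_at p k (0 : VecM) = 0.
  by have := F_atZ p k 0 0; rewrite !scale0r.
rewrite F_at0 addr0 add0r.
case/orP: (a) => /eqP e.
  rewrite (F_F_at_same (i := i) (j := j)) ?scaler0 //.
  by rewrite e eq_sym ordSS_neq.
rewrite (F_F_at_same (i := j) (j := i)) ?F_at0 ?scaler0 //.
by rewrite e eq_sym ordSS_neq.
Qed.

Lemma E_upto_r i f : E_upto r i f = Eo i f.
Proof. by rewrite EoE; apply: eq_bigl => k; rewrite ltn_ord. Qed.
Lemma F_upto_r i f : F_upto r i f = Fo i f.
Proof. by rewrite FoE; apply: eq_bigl => k; rewrite ltn_ord. Qed.

Lemma Eo_serre i j f : adjacent i j -> serre_expr v (Eo i) (Eo j) f = 0.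
Proof.
by move=> a; have := E_upto_serre f a (leqnn r); rewrite /serre_expr !E_upto_r.
Qed.
Lemma Fo_serre i j f : adjacent i j -> serre_expr v (Fo i) (Fo j) f = 0.
Proof.
by move=> a; have := F_upto_serre f a (leqnn r); rewrite /serre_expr !F_upto_r.
Qed.

Definition word_wt (w : Wd r) : 'I_n -> nat := fun j => (\sum_(k < r) resid (w k) j)%N.
Definition wt_vec (lam : 'I_n -> nat) f := forall w, f w != 0 -> word_wt w = lam.

Lemma word_wt_bump w k i : resid (w k) i -> word_wt (bumpw w k 1) = fdn i (word_wt w).
Proof.
move=> Hi; apply/funext => j; rewrite /word_wt /fdn.
rewrite (bigD1 k) //= [in RHS](bigD1 k) //= bump_k (residP _ Hi) (residSP _ Hi).
rewrite (eq_bigr (fun p => nat_of_bool (resid (w p) j))) => [|p pk]; last by rewrite bump_l.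
case: (eqVneq j i) => [->|ji]; first by rewrite eq_sym (negPf (ordS_neq i n1)) add0n add1n.
by case: eqP => _; rewrite ?add0n ?add1n.
Qed.
Lemma word_wt_bump' w k i : resid (w k - 1) i ->
  word_wt (bumpw w k (-1)) = eup i (word_wt w).
Proof.
move=> Hi; have H1 : resid (bumpw w k (-1) k) i by rewrite bump_k.
have := word_wt_bump H1; rewrite bumpD addNr bump0 => ->; rewrite eup_fdn //.
by rewrite /word_wt (bigD1 k) //= H1.
Qed.
Lemma word_wt_pos w k i : resid (w k) i -> (0 < word_wt w i)%N.
Proof. by move=> H; rewrite /word_wt (bigD1 k) //= H. Qed.

Lemma E_at_supp i k f w : E_at i k f w != 0 -> resid (w k) i /\ f (bumpw w k 1) != 0.
Proof.
rewrite /E_at; case: ifP => [_ H|_]; last by rewrite eqxx.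
split; first exact: isT.
by apply: contraNN H => /eqP->; rewrite mulr0 eqxx.
Qed.
Lemma F_at_supp i k f w : F_at i k f w != 0 -> resid (w k - 1) i /\ f (bumpw w k (-1)) != 0.
Proof.
rewrite /F_at; case: ifP => [_ H|_]; last by rewrite eqxx.
split; first exact: isT.
by apply: contraNN H => /eqP->; rewrite mulr0 eqxx.
Qed.

Lemma sum_neq0 (I : finType) (g : I -> Qv) : \sum_p g p != 0 -> exists p, g p != 0.
Proof.
move=> H; apply: contrapT => no; case/negP: H; rewrite big1 ?eqxx // => p _.
by apply: contrapT => /eqP h; apply: no; exists p.
Qed.

Lemma Eo_supp i f w : Eo i f w != 0 -> exists k, resid (w k) i /\ f (bumpw w k 1) != 0.
Proof. by move=> /sum_neq0[k /E_at_supp H]; exists k. Qed.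
Lemma Fo_supp i f w : Fo i f w != 0 -> exists k, resid (w k - 1) i /\ f (bumpw w k (-1)) != 0.
Proof. by move=> /sum_neq0[k /F_at_supp H]; exists k. Qed.

Lemma vec_ext f : (forall w, f w != 0 -> False) -> f = 0.
Proof. by move=> H; apply/funext => w; apply: contrapT => /eqP /H. Qed.

Lemma kappa_sub i t : kappa i t - (kappa i t)^-1 =
  (v - v^-1) * ((resid t i)%:R - (resid (t - 1) i)%:R).
Proof.
rewrite /kappa; have E : resid (t - 1) i = resid t (ordS i) by rewrite -residS subrK.
rewrite E; case: (boolP (resid t i)) => H; case: (boolP (resid t (ordS i))) => H'.
- by have := resid_inj H H' => e; have := ordS_neq i n1; rewrite -e eqxx.
- by rewrite invr1 !mulr1 mulr0n mulr1n subr0 mulr1.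
- by rewrite mul1r invrK mulr0n mulr1n sub0r mulrN mulr1 opprB.
by rewrite invr1 mulr1 invr1 mulr0n !subrr mulr0.
Qed.

Lemma prod_kappa i w : \prod_k kappa i (w k) = v ^ ((word_wt w i)%:Z - (word_wt w (ordS i))%:Z).
Proof.
rewrite expfzDr ?v_neq0 // -invr_expz -!exprnP /word_wt !expr_sum -prodfV -big_split /=.
apply: eq_bigr => k _; rewrite /kappa.
by case: (resid _ i); case: (resid _ (ordS i)); rewrite ?expr0 ?expr1.
Qed.

(** Operators at different tensor factors commute and cancel. The diagonal terms telescope to the
    product of all [kappa] minus its inverse. *)
Lemma Eo_Fo_same i f w : Eo i (Fo i f) w = Fo i (Eo i f) w +
  qnum v ((word_wt w i)%:Z - (word_wt w (ordS i))%:Z) * f w.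
Proof.
rewrite EF_sum FE_sum !fct_sumE; apply/eqP; rewrite addrC -subr_eq; apply/eqP.
rewrite -sumrB.
pose u (m : nat) := (\prod_(l < r | (l < m)%N) kappa i (w l)) *
                    (\prod_(l < r | (m <= l)%N) (kappa i (w l))^-1).
transitivity (\sum_(k < r) ((v - v^-1)^-1 * f w) * (u k.+1 - u k)).
  apply: eq_bigr => k _; rewrite !fct_sumE -sumrB (bigD1 k) //= big1 ?addr0; last first.
    by move=> l lk; rewrite E_F_at ?subrr // eq_sym.
  have -> : u k.+1 = left_weight i w k * right_weight i w k * kappa i (w k).
    rewrite /u (bigD1 k) //= mulrC [RHS]mulrC mulrCA; congr (_ * _).
    rewrite mulrC; congr (_ * _); apply: eq_bigl => p.
    by rewrite ltnS ltn_neqAle andbC -(inj_eq (@ord_inj r)).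
  have -> : u k = left_weight i w k * right_weight i w k * (kappa i (w k))^-1.
    rewrite /u -mulrA; congr (_ * _); rewrite (bigD1 k) //= mulrC; congr (_ * _).
    apply: eq_bigl => p; rewrite ltn_neqAle andbC -(inj_eq (@ord_inj r)) eq_sym.
    by rewrite eq_sym [X in _ && X]eq_sym.
  rewrite -mulrBr kappa_sub /E_at /F_at !bump_k !bumpD addrK addrN addNr !bump0.
  rewrite right_weight_out ?ltnn // left_weight_out ?ltnn //.
  exact: (diag_aux _ _ _ _ _ v_sub_neq0).
rewrite -mulr_sumr -(big_mkord xpredT (fun m : nat => u m.+1 - u m)) telescope_sumr //.
have -> : u r = \prod_k kappa i (w k).
  rewrite /u [X in _ * X]big_pred0 ?mulr1 => [|k]; last by rewrite leqNgt ltn_ord.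
  by apply: eq_bigl => k; rewrite ltn_ord.
have -> : u 0%N = (\prod_k kappa i (w k))^-1.
  rewrite /u [X in X * _]big_pred0 ?mul1r => [|k]; last by rewrite ltn0.
  by rewrite prodfV.
rewrite prod_kappa invr_expz /qnum; exact: mulrCA_aux.
Qed.

Lemma vec_weight_module : weight_module v Eo Fo wt_vec.
Proof.
split.
- exact: E_op_lin.
- exact: F_op_lin.
- move=> lam a f g Hf Hg w H; have [f0|f0] := eqVneq (f w) 0; last exact: Hf.
  by apply: Hg; apply: contraNN H => /eqP g0; rewrite addrfctE scalrfctE f0 g0 scaler0 addr0 eqxx.
- move=> i lam f H e; apply: vec_ext => w /Eo_supp[k [Hk /H El]].
  have : resid (bumpw w k 1 k) (ordS i) by rewrite bump_k residS.
  by move=> /word_wt_pos; rewrite El e ltnn.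
- move=> i lam f H e w /Eo_supp[k [Hk /H <-]].
  by rewrite (word_wt_bump Hk) eup_fdn //; apply: word_wt_pos Hk.
- move=> i lam f H e; apply: vec_ext => w /Fo_supp[k [Hk /H El]].
  have : resid (bumpw w k (-1) k) i by rewrite bump_k.
  by move=> /word_wt_pos; rewrite El e ltnn.
- move=> i lam f H e w /Fo_supp[k [Hk /H <-]].
  rewrite (word_wt_bump' Hk) fdn_eup //; apply: (@word_wt_pos _ k).
  by rewrite -(subrK 1 (w k)) residS.
- move=> i lam f H; apply/funext => w; rewrite Eo_Fo_same addrfctE scalrfctE.
  congr (_ + _); have [f0|/H ->] := eqVneq (f w) 0; last exact: erefl.
  by rewrite f0 mulr0 scaler0.
- exact: Eo_Fo.
- exact: Eo_Eo.
- exact: Fo_Fo.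
- by move=> i j f; apply: Eo_serre.
- by move=> i j f; apply: Fo_serre.
Qed.

End TensorSpace.

Lemma neq_wt n (lam : 'I_n -> nat) a b : lam a != lam b -> a != b.
Proof. by apply: contra => /eqP ->. Qed.

(** * Moving single particles *)

Section Sites.
Variables (n : nat) (n2 : (2 < n)%N).
Let n0 : (0 < n)%N. Proof. by lia. Qed.
Definition site (k : nat) : 'I_n := Ordinal (ltn_pmod k n0).
Lemma siteE k : (k < n)%N -> site k = k :> nat.
Proof. by move=> H; rewrite /= modn_small. Qed.
Lemma site_ord (i : 'I_n) : site i = i.
Proof. by apply: val_inj; rewrite /= modn_small. Qed.
Lemma ordS_site k : ordS (site k) = site k.+1.
Proof. by apply: val_inj; rewrite /= -addn1 modnDml addn1. Qed.
Lemma ordS_nw (i : 'I_n) : (i.+1 < n)%N -> ordS i = i.+1 :> nat.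
Proof. by move=> H; rewrite ordSE; case: eqP => // e; rewrite e ltnn in H. Qed.
Lemma site_inj j k : (j < n)%N -> (k < n)%N -> site j = site k -> j = k.
Proof. by move=> Hj Hk /(congr1 (@nat_of_ord n)); rewrite !siteE. Qed.
Definition lastsite : 'I_n := site n.-1.
Lemma lastsiteE : lastsite = n.-1 :> nat. Proof. by rewrite siteE //; lia. Qed.
Lemma ordS_last : ordS lastsite = site 0.
Proof. by rewrite /lastsite ordS_site prednK //; apply: val_inj; rewrite /= modnn mod0n. Qed.
Lemma last_neq (i : 'I_n) : (i.+1 < n)%N -> i != lastsite.
Proof. by move=> H; rewrite -val_eqE /=; have := lastsiteE => /= ->; lia. Qed.
Lemma nw_or_last (i : 'I_n) : (i.+1 < n)%N \/ i = lastsite.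
Proof.
case: (ltnP i.+1 n) => H; [by left|right]; apply: val_inj; have := lastsiteE => /= ->.
by have := ltn_ord i; lia.
Qed.
End Sites.

Set Default Proof Using "All".

Section Omega.
Variables (n r : nat).
Hypotheses (n2 : (2 < n)%N) (rn : (r < n)%N).
Implicit Types (i j : 'I_n) (lam : 'I_n -> nat).
Let n1 : (1 < n)%N := ltnW n2.

Definition omega : 'I_n -> nat := fun p => (p < r)%N.

Lemma simple_omega : simple_wt omega.
Proof. by move=> p; rewrite /omega; case: ltnP. Qed.

Lemma omega_stuck i : (i.+1 < n)%N -> omega i = 0%N -> omega (ordS i) = 1%N -> False.
Proof.
by move=> H; rewrite /omega ordS_nw //; case: ltnP => // H1; case: ltnP => //; lia.
Qed.

Lemma sum_ltn k : (k <= n)%N -> (\sum_(p < n) (p < k) = k)%N.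
Proof.
move=> H; rewrite -(big_mkord xpredT (fun p => nat_of_bool (p < k)%N)).
rewrite (big_cat_nat (n := k)) //= [X in (_ + X)%N]big_nat_cond [X in (_ + X)%N]big1 ?addn0.
  rewrite big_nat_cond (eq_bigr (fun=> 1%N)).
    by rewrite -big_nat_cond sum_nat_const_nat subn0 muln1.
  by move=> p; case: ltnP => //; rewrite andbT => H' /andP[_]; lia.
by move=> p; rewrite andbT => /andP[H' _]; rewrite ltnNge H'.
Qed.

Lemma size_omega : size_wt omega = r.
Proof. by rewrite /size_wt sum_ltn // ltnW. Qed.

(** If no slide is possible, emptiness of a site passes on to the next one, so the particles fill an
    initial segment, whose length must be [r]. *)
Lemma slide_or_omega lam : simple_wt lam -> size_wt lam = r ->
  lam = omega \/ exists i, [/\ lam i = 0%N, lam (ordS i) = 1%N & (i.+1 < n)%N].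
Proof.
move=> S Hs; case: (pselect (exists i, [/\ lam i = 0%N, lam (ordS i) = 1%N & (i.+1 < n)%N])).
  by right.
move=> no; left.
have mono : forall d (p p' : 'I_n), p' = (p + d)%N :> nat -> lam p = 0%N -> lam p' = 0%N.
  elim=> [|d IH] p p' e e0; first by rewrite (_ : p' = p) //; apply: ord_inj; rewrite e addn0.
  have Hd : (p + d < n)%N by have := ltn_ord p'; lia.
  have := IH p (Ordinal Hd) erefl e0 => e1.
  have e2 : p' = ordS (Ordinal Hd).
    by apply: ord_inj; rewrite ordS_nw; rewrite /=; have := ltn_ord p'; lia.
  case El: (lam p') => [//|k]; case: no; exists (Ordinal Hd); split => //.
    by rewrite -e2; have := S p'; lia.
  by have := ltn_ord p'; rewrite /=; lia.
apply/funext => p; rewrite /omega.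
case Ep: (lam p) => [|k].
  have : (size_wt lam <= \sum_(j < n) (j < p))%N.
    apply: leq_sum => j _; case: ltnP => H; first exact: S.
    by rewrite (mono (j - p)%N p j) //; lia.
  by rewrite sum_ltn ?Hs; [case: ltnP => //; lia|have := ltn_ord p; lia].
have : (\sum_(j < n) (j < p.+1) <= size_wt lam)%N.
  apply: leq_sum => j _; case: ltnP => // H; case Ej: (lam j) => [|//].
  by rewrite (mono (p - j)%N j p) in Ep; lia.
rewrite sum_ltn ?Hs // => H; rewrite H; have := S p; lia.
Qed.

(** The sum of the positions drops with every slide that does not cross the boundary, so sliding
    terminates. *)
Definition moment lam := (\sum_(p < n) p * lam p)%N.

Lemma moment_eup i lam : lam (ordS i) = 1%N -> (i.+1 < n)%N ->
  moment lam = (moment (eup i lam)).+1.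
Proof.
move=> e nw; have := weighted_sum_eup (fun p => p : nat) n1 e.
by cbv beta; rewrite /moment (ordS_nw nw) addnS -addSn => /addIn.
Qed.

Lemma slides_ind (P : ('I_n -> nat) -> Prop) : P omega ->
  (forall lam i, simple_wt lam -> size_wt lam = r -> lam i = 0%N -> lam (ordS i) = 1%N ->
     (i.+1 < n)%N -> P (eup i lam) -> P lam) ->
  forall lam, simple_wt lam -> size_wt lam = r -> P lam.
Proof.
move=> H0 H1 lam; have [m] := ubnP (moment lam); elim: m lam => // m IH lam Hm S Hs.
have [->//|[i [e e' nw]]] := slide_or_omega S Hs.
apply: (H1 lam i) => //; apply: IH.
- by rewrite (moment_eup e' nw) in Hm; lia.
- exact: simple_eup.
- by rewrite size_eup // e'.
Qed.

End Omega.

Ltac boolcase := do ?case: eqP => ? //=; do ?case: ltnP => ?; rewrite /=; lia.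

Section SlidePaths.
Variables (n r : nat).
Hypotheses (n2 : (2 < n)%N) (rn : (r < n)%N) (r0 : (0 < r)%N).
Implicit Types (i j : 'I_n) (lam : 'I_n -> nat) (s : seq 'I_n).
Let n1 : (1 < n)%N := ltnW n2.
Notation site := (site n2).
Notation lastsite := (lastsite n2).
Notation omega := (@omega n r).

Fixpoint slidable s lam : Prop :=
  if s is i :: s' then [/\ lam i = 0%N, lam (ordS i) = 1%N & slidable s' (eup i lam)]
  else True.
Definition eups s lam := foldl (fun l i => eup i l) lam s.
Lemma eups_cat s1 s2 lam : eups (s1 ++ s2) lam = eups s2 (eups s1 lam).
Proof. exact: foldl_cat. Qed.

Lemma slidable_cat s1 s2 lam :
  slidable s1 lam -> slidable s2 (eups s1 lam) -> slidable (s1 ++ s2) lam.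
Proof. by elim: s1 lam => //= i s1 IH lam [? ? /IH H] /H. Qed.

(** This starts after the first particle has crossed from site 0 to [n - 1]: the particles at
    [1, ..., r - 1] step left in turn, then the one at [n - 1] travels down to [r - 1]. *)
Definition back_slides : seq 'I_n :=
  map site (iota 0 r.-1) ++ map site (rev (iota r.-1 (n - r))).

(** The weights on this path. In its first half the block of [omega] has a hole at [h]; in its
    second half one particle, at [m], is separate from a block of length [r - 1]. *)
Definition punctured (h : nat) : 'I_n -> nat :=
  fun p => (((p < r) && (p != h :> nat)) || (p == n.-1 :> nat))%N.
Definition detached (m : nat) : 'I_n -> nat :=
  fun p => ((p < r.-1) || (p == m :> nat))%N.

Lemma eup_site k lam p : (k.+1 < n)%N ->
  eup (site k) lam p = if p == k :> nat then (lam p).+1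
                       else if p == k.+1 :> nat then (lam p).-1 else lam p.
Proof.
move=> H; rewrite /eup -!val_eqE ordS_site /= !modn_small //; exact: ltnW.
Qed.

Lemma eup_punctured h : (h.+1 < r)%N -> eup (site h) (punctured h) = punctured h.+1.
Proof. by move=> H; apply/funext => p; rewrite eup_site /punctured; [boolcase|lia]. Qed.
Lemma punctured_detached : punctured r.-1 = detached n.-1.
Proof. by apply/funext => p; rewrite /punctured /detached; boolcase. Qed.
Lemma eup_detached m : (r.-1 <= m)%N -> (m.+1 < n)%N ->
  eup (site m) (detached m.+1) = detached m.
Proof. by move=> H H'; apply/funext => p; rewrite eup_site // /detached; boolcase. Qed.
Lemma detached_omega : detached r.-1 = omega.
Proof. by apply/funext => p; rewrite /detached /omega; boolcase. Qed.
Lemma eup_omega : eup lastsite omega = punctured 0.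
Proof.
apply/funext => p; rewrite /eup ordS_last -!val_eqE /= /punctured /omega.
rewrite mod0n modn_small; last by lia.
by have := ltn_ord p; boolcase.
Qed.

Lemma slidable_punctured k : (k < r)%N ->
  slidable (map site (iota 0 k)) (punctured 0) /\
  eups (map site (iota 0 k)) (punctured 0) = punctured k.
Proof.
elim: k => // k IH kr; have [H1 H2] := IH (ltnW kr).
rewrite -addn1 iotaD map_cat eups_cat H2 add0n.
split; last by rewrite /= eup_punctured ?addn1.
apply: slidable_cat => //=; rewrite H2 ordS_site; split => //.
  by rewrite /punctured siteE; lia.
by rewrite /punctured siteE; lia.
Qed.

Lemma slidable_detached k : (r.-1 + k < n)%N ->
  slidable (map site (rev (iota r.-1 k))) (detached (r.-1 + k)) /\
  eups (map site (rev (iota r.-1 k))) (detached (r.-1 + k)) = omega.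
Proof.
elim: k => [|k IH] kn; first by rewrite addn0 detached_omega.
have [|H1 H2] := IH _; first by lia.
rewrite -addn1 iotaD rev_cat map_cat /= addnA addn1 eup_detached //; try lia.
rewrite ordS_site; split => //; split => //.
  by rewrite /detached siteE; lia.
by rewrite /detached siteE; lia.
Qed.

Lemma back_slides_nw : all (fun i => (i.+1 < n)%N) back_slides.
Proof.
rewrite /back_slides all_cat; apply/andP; split; apply/allP => i /mapP[k].
  by rewrite mem_iota => H ->; rewrite siteE; lia.
by rewrite mem_rev mem_iota => H ->; rewrite siteE; lia.
Qed.

Lemma slidable_back :
  slidable back_slides (punctured 0) /\ eups back_slides (punctured 0) = omega.
Proof.
have [H1 H2] := @slidable_punctured r.-1 ltac:(lia).
have [|H3 H4] := @slidable_detached (n - r); first by lia.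
have En : (r.-1 + (n - r) = n.-1)%N by lia.
rewrite En -punctured_detached // in H3 H4.
split; first by apply: slidable_cat; rewrite // H2.
by rewrite eups_cat H2.
Qed.

Lemma slidable_rotate :
  slidable (lastsite :: back_slides) omega /\ eups (lastsite :: back_slides) omega = omega.
Proof.
have [H1 H2] := slidable_back.
rewrite /= eup_omega //; split => //; split => //.
  by rewrite /omega lastsiteE; lia.
by rewrite ordS_last /omega siteE; lia.
Qed.

End SlidePaths.

(** * Runs of particles behind a stack, and the nearest hole *)

Section Runs.
Variable n : nat.
Hypothesis n2 : (2 < n)%N.
Let n1 : (1 < n)%N := ltnW n2.
Implicit Types (i j p s : 'I_n) (lam mu : 'I_n -> nat).

Lemma iter_ordS k i : iter k (@ordS n) i = ((i + k) %% n)%N :> nat.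
Proof.
elim: k => [|k IH] /=; first by rewrite addn0 modn_small.
by rewrite IH -addn1 modnDml addn1 addnS.
Qed.
Lemma ordS_closed (P : 'I_n -> Prop) i : P i -> (forall p, P p -> P (ordS p)) -> forall p, P p.
Proof.
move=> Pi PS p; have -> : p = iter (n - i + p) (@ordS n) i.
  apply: ord_inj; rewrite iter_ordS addnA subnKC; last exact: ltnW.
  by rewrite modnDl modn_small.
by elim: (n - i + p)%N => //= k /PS.
Qed.

(** Reading from [i] to the left, [lam] has singly occupied sites up to a site with at
    least two particles. *)
Inductive run lam : 'I_n -> Prop :=
| run_stack i : (2 <= lam i)%N -> run lam i
| run_single i : run lam i -> lam (ordS i) = 1%N -> run lam (ordS i).

Lemma run_pos lam i : run lam i -> (0 < lam i)%N.
Proof. by case=> [j /ltnW|j _ ->]. Qed.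
Lemma run_not_simple lam i : run lam i -> ~ simple_wt lam.
Proof. by elim=> // j Hj S; have := S j; lia. Qed.

(** The premises single out the sites that can lie on the run to [i]: occupied, equal to [i] or with
    an occupied right neighbour, and, if singly occupied, with an occupied left neighbour. Elsewhere
    [mu] is free. *)
Lemma run_frame lam mu i : run lam i ->
  (forall p, (0 < lam p)%N -> p = i \/ (0 < lam (ordS p))%N ->
     (forall p', ordS p' = p -> lam p = 1%N -> (0 < lam p')%N) -> mu p = lam p) ->
  run mu i.
Proof.
elim=> [j Hj|j Rj IH ej] H.
  apply: run_stack; rewrite H //; [by lia|by left|by move=> p' _ e; rewrite e in Hj].
apply: run_single.
  apply: IH => p Hp Hp' Hp''; apply: H => //; right.
  by case: Hp' => // ->; rewrite ej.
rewrite H ?ej //; first by left.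
by move=> p' /ordS_inj -> _; apply: run_pos Rj.
Qed.

Lemma run_fdn lam i j : run lam i -> j != i -> lam (ordS j) = 0%N -> run (fdn j lam) i.
Proof.
move=> R ji ej; apply: run_frame R _ => p Hp Hp' _; apply: fdn_p.
  apply/eqP => e; subst p; case: Hp' => [e|]; last by rewrite ej.
  by rewrite e eqxx in ji.
by apply: (@neq_wt _ lam); rewrite ej -lt0n.
Qed.

Lemma run_eup lam i j : run lam i -> lam j = 0%N -> lam (ordS j) = 1%N -> run (eup j lam) i.
Proof.
move=> R ej ej'; apply: run_frame R _ => p Hp Hp' Hp''; apply: eup_p.
  by apply: (@neq_wt _ lam); rewrite ej -lt0n.
by apply/eqP => e; subst p; have := Hp'' j erefl ej'; rewrite ej.
Qed.

Lemma excess_eup i lam : lam i = 0%N -> (0 < lam (ordS i))%N ->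
  (excess (eup i lam) + (lam (ordS i)).-1 = excess lam + (lam (ordS i)).-2)%N.
Proof. by move=> e H; have := sum_eup predn i lam n1; rewrite e /excess; lia. Qed.
Lemma excess_fdn_le i lam : (0 < lam i)%N -> lam (ordS i) = 0%N ->
  (excess (fdn i lam) + (lam i).-1 = excess lam + (lam i).-2)%N.
Proof. by move=> e H; have := sum_fdn predn i lam n1; rewrite H /excess; lia. Qed.

(** Otherwise, going round the circle from the hole [i], every other site belongs to a run and is
    occupied; with the second particle at [ordS i] this makes at least [n] particles. *)
Lemma other_run lam i : lam i = 0%N -> (2 <= lam (ordS i))%N -> (size_wt lam < n)%N ->
  exists j, [/\ run lam j, lam (ordS j) = 0%N & ordS j != i].
Proof.
move=> ei Hi Hs; apply: contrapT => no.
have P : forall p, p = i \/ run lam p.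
  apply: (@ordS_closed _ i); first by left.
  move=> p [->|Rp]; first by right; apply: run_stack.
  case Ep: (lam (ordS p)) => [|[|k]].
  - by case: (eqVneq (ordS p) i) => [|npi]; [left|case: no; exists p].
  - by right; apply: run_single.
  - by right; apply: run_stack; rewrite Ep.
suff: (n <= size_wt lam)%N by lia.
have En : (\sum_(p < n) ((p != i) + (p == ordS i)) = n)%N.
  rewrite big_split /= (bigD1 i) //= eqxx add0n.
  rewrite (eq_bigr (fun=> 1%N)) => [|p -> //].
  rewrite [X in (_ + X)%N](bigD1 (ordS i)) //= eqxx.
  rewrite [X in (_ + (_ + X))%N]big1 => [|p /negPf-> //].
  by rewrite sum1_card; have := cardC1 i; rewrite card_ord => ->; lia.
rewrite -[X in (X <= _)%N]En.
apply: leq_sum => p _; case: (P p) => [->|/run_pos Hp].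
  by rewrite eqxx ei eq_sym (negPf (ordS_neq i n1)).
by case: (eqVneq p (ordS i)) => [->|_]; [case: eqP; lia|case: eqP; lia].
Qed.

(** [gap lam k s p]: the first hole to the right of [s] is [ordS p], [k + 1] sites away. *)
Inductive gap lam : nat -> 'I_n -> 'I_n -> Prop :=
| gap_stop s : lam (ordS s) = 0%N -> gap lam 0 s s
| gap_step k s p : (0 < lam (ordS s))%N -> gap lam k (ordS s) p -> gap lam k.+1 s p.

Lemma gap_end lam k s p : gap lam k s p -> lam (ordS p) = 0%N.
Proof. by elim. Qed.
Lemma gap_pos lam k s p : gap lam k s p -> (0 < k)%N -> (0 < lam p)%N.
Proof.
elim=> // {}k {}s {}p H Hg IH _; case: k Hg IH => [|k] Hg IH; last exact: IH.
by inversion Hg; subst.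
Qed.

Lemma gap_ex lam s : (exists i, lam i = 0%N) -> exists k p, gap lam k s p.
Proof.
move=> [i ei]; apply: contrapT => no.
suff: forall p, ~ exists k p', gap lam k p p'.
  by move/(_ (ord_pred i)); apply; exists 0%N, (ord_pred i); apply: gap_stop; rewrite ord_predK.
apply: (ordS_closed no) => p nop [k [p' H]]; apply: nop.
case: (posnP (lam (ordS p))) => e; first by exists 0%N, p; apply: gap_stop.
by exists k.+1, p'; apply: gap_step.
Qed.

(** The last particle before the hole steps into it, so the hole comes one site closer to [s]. *)
Lemma gap_fdn lam k s p : gap lam k.+1 s p -> lam p = 1%N ->
  exists p', gap (fdn p lam) k s p'.
Proof.
elim: k s => [|k IH] s H ep; inversion H as [|k' s' p' Hs Hg]; subst.
  inversion Hg; subst; exists s; apply: gap_stop; by rewrite fdn_i ep.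
have Hg' := gap_end Hg.
have [p' Hp'] := IH _ Hg ep.
inversion Hg as [|k' s' p0 Hs' _]; subst.
exists p'; apply: gap_step => //; rewrite fdn_p //.
  by apply/eqP => e; rewrite -e in Hg'; rewrite Hg' in Hs'.
by apply: (@neq_wt _ lam); rewrite Hg' -lt0n.
Qed.
End Runs.

(** * The extended affine Hecke algebra *)

Section Span.
Variables (K : pzRingType) (M : lmodType K).

Inductive lspan (P : M -> Prop) : M -> Prop :=
| lspan0 : lspan P 0
| lspanD a x y : P x -> lspan P y -> lspan P (a *: x + y).

Lemma lspan_gen P x : P x -> lspan P x.
Proof. by move=> Px; have := lspanD 1 Px (lspan0 P); rewrite scale1r addr0. Qed.
Lemma lspan_lin P a x y : lspan P x -> lspan P y -> lspan P (a *: x + y).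
Proof.
move=> Hx Hy; elim: Hx => [|b z x' Pz _ IH]; first by rewrite scaler0 add0r.
by rewrite scalerDr scalerA -addrA; apply: lspanD.
Qed.
Lemma lspan_sub P (Z : M -> Prop) : Z 0 -> (forall a x y, Z x -> Z y -> Z (a *: x + y)) ->
  (forall x, P x -> Z x) -> forall x, lspan P x -> Z x.
Proof. by move=> Z0 ZL PZ x; elim=> // a {}x y /PZ Zx _; apply: ZL. Qed.
(** Linearity is asked on [Z] only, because the inverse rotation [dn] inherits it from [up] just
    there. *)
Lemma lspan_map P (Z : M -> Prop) (f : M -> M) :
  Z 0 -> (forall a x y, Z x -> Z y -> Z (a *: x + y)) -> (forall x, P x -> Z x) ->
  (forall a x y, Z x -> Z y -> f (a *: x + y) = a *: f x + f y) ->
  (forall x, P x -> lspan P (f x)) -> forall x, lspan P x -> lspan P (f x).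
Proof.
move=> Z0 ZL PZ fL fP x; elim=> [|a {}x y Px Hy IH].
  by have := fL (-1) 0 0 Z0 Z0; rewrite scaler0 addr0 scaleN1r addNr => ->; apply: lspan0.
rewrite fL; [|exact: PZ|exact: (lspan_sub Z0 ZL PZ)].
by apply: lspan_lin => //; apply: fP.
Qed.
End Span.

(** * Standard basis elements derived from the Hecke relations *)

Section AffineHecke.
Variables (K : fieldType) (q : K) (M : lmodType K) (r : nat).
Variables (Z : M -> Prop) (up dn : M -> M) (T : nat -> M -> M).
Hypotheses (q0 : q != 0) (r0 : (0 < r)%N).
Hypothesis ZL : forall a x y, Z x -> Z y -> Z (a *: x + y).
Hypothesis upL : forall a x y, up (a *: x + y) = a *: up x + up y.
Hypothesis TL : forall j a x y, T j (a *: x + y) = a *: T j x + T j y.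
Hypotheses (Zup : forall z, Z z -> Z (up z)) (Zdn : forall z, Z z -> Z (dn z)).
Hypothesis ZT : forall j z, (j.+1 < r)%N -> Z z -> Z (T j z).
Hypotheses (updnK : forall z, Z z -> up (dn z) = z) (dnupK : forall z, Z z -> dn (up z) = z).
Hypothesis T_quad : forall j z, (j.+1 < r)%N -> Z z -> T j (T j z) = (q + q^-1) *: T j z.
Hypothesis T_braid : forall j z, (j.+2 < r)%N -> Z z ->
  T j (T j.+1 (T j z)) - T j z = T j.+1 (T j (T j.+1 z)) - T j.+1 z.
Hypothesis T_comm : forall j k z, (j.+1 < k)%N -> (k.+1 < r)%N -> Z z ->
  T j (T k z) = T k (T j z).
Hypothesis T_up : forall j z, (j.+2 < r)%N -> Z z -> up (T j z) = T j.+1 (up z).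
Hypothesis T_wrap : forall z, (1 < r)%N -> Z z -> up (up (T r.-2 z)) = T 0 (up (up z)).

Implicit Types (x y z : M) (t : int).

Definition rotate (c : int) z :=
  match c with Posz k => iter k up z | Negz k => iter k.+1 dn z end.

Lemma Z_iter_up k z : Z z -> Z (iter k up z).
Proof. by move=> H; elim: k => //= k; apply: Zup. Qed.
Lemma Z_iter_dn k z : Z z -> Z (iter k dn z).
Proof. by move=> H; elim: k => //= k; apply: Zdn. Qed.
Lemma Z_rotate c z : Z z -> Z (rotate c z).
Proof. by case: c => k H; [apply: Z_iter_up|apply: Z_iter_dn]. Qed.

Lemma rotateS c z : Z z -> rotate (c + 1) z = up (rotate c z).
Proof.
case: c => k H; first by rewrite (_ : Posz k + 1 = Posz k.+1) //; lia.
case: k => [|k]; first by rewrite /= updnK.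
rewrite (_ : Negz k.+1 + 1 = Negz k); last by lia.
by rewrite /= updnK //; apply: Zdn; apply: Z_iter_dn.
Qed.

Definition res t : nat := `|(t %% r)%Z|%N.

(** The hypotheses concern [T j] for [j < r - 1]; conjugating [T 0] by the rotation supplies a
    generator for every residue modulo [r]. [T_wrap] makes the passage from residue [r - 1] to 0
    consistent. *)
Definition tz t z := iter (res t) up (T 0 (iter (res t) dn z)).

Lemma iter_T k z : (k.+1 < r)%N -> Z z -> iter k up (T 0 (iter k dn z)) = T k z.
Proof.
elim: k z => // k IH z kr H.
rewrite iterS iterSr IH ?T_up ?updnK //; by [lia|apply: Zdn].
Qed.

Lemma resE t : (res t : int) = (t %% r)%Z.
Proof. by rewrite /res gez0_abs // modz_ge0 //; lia. Qed.
Lemma res_lt t : (res t < r)%N.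
Proof. have := resE t; have := @ltz_pmod t r; lia. Qed.
Lemma res_mod t t' : (t = t' %[mod r])%Z -> res t = res t'.
Proof. by rewrite /res => ->. Qed.
Lemma res_nat k : (k < r)%N -> res k = k.
Proof. by move=> H; rewrite /res modz_nat absz_nat modn_small. Qed.
Lemma resK t : (res t = t %[mod r])%Z.
Proof. by rewrite resE modz_mod. Qed.

Lemma tz_mod t t' z : (t = t' %[mod r])%Z -> tz t z = tz t' z.
Proof. by rewrite /tz => /res_mod->. Qed.

Lemma tz_nat k z : (k.+1 < r)%N -> Z z -> tz k z = T k z.
Proof. by move=> H Hz; rewrite /tz res_nat; [apply: iter_T|lia]. Qed.

Lemma modzD1 t t' : (t = t' %[mod r])%Z -> (t + 1 = t' + 1 %[mod r])%Z.
Proof. by move=> e; rewrite -modzDml e modzDml. Qed.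

Lemma upD x y : up (x + y) = up x + up y.
Proof. by rewrite -{1}[x]scale1r upL scale1r. Qed.
Lemma up0 : up 0 = 0.
Proof. by have := upL (-1) 0 0; rewrite !scaleN1r !addNr. Qed.
Lemma upZ a x : up (a *: x) = a *: up x.
Proof. by rewrite -[a *: x]addr0 upL up0 addr0. Qed.
Lemma upN x : up (- x) = - up x.
Proof. by rewrite -scaleN1r upZ scaleN1r. Qed.

Lemma iter_upL k a x y : iter k up (a *: x + y) = a *: iter k up x + iter k up y.
Proof. by elim: k => //= k ->. Qed.
Lemma dnL a x y : Z x -> Z y -> dn (a *: x + y) = a *: dn x + dn y.
Proof.
move=> Hx Hy; rewrite -{1}(updnK Hx) -{1}(updnK Hy) -upL dnupK //.
by apply: ZL; apply: Zdn.
Qed.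
Lemma iter_dnL k a x y : Z x -> Z y ->
  iter k dn (a *: x + y) = a *: iter k dn x + iter k dn y.
Proof.
by move=> Hx Hy; elim: k => //= k ->; rewrite dnL //; apply: Z_iter_dn.
Qed.
Section Braids.
Hypothesis r1 : (1 < r)%N.

Lemma Ztz t z : Z z -> Z (tz t z).
Proof. by move=> H; apply: Z_iter_up; apply: ZT => //; apply: Z_iter_dn. Qed.

Lemma tz_up t z : Z z -> up (tz t z) = tz (t + 1) (up z).
Proof.
move=> H; have Et : (t + 1 = (res t).+1 %[mod r])%Z.
  by rewrite -addn1 PoszD; apply/modzD1/esym/resK.
rewrite (tz_mod _ Et); set k := res t.
case: (ltnP k.+1 r) => kr.
  by rewrite /tz res_nat // -/k [in RHS]iterS [in RHS]iterSr dnupK.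
have Ek : k = r.-1 by have := res_lt t; rewrite -/k; lia.
have E0 : (k.+1 = 0%N %[mod r])%Z by rewrite Ek prednK // modzz mod0z.
rewrite (tz_mod _ E0) tz_nat //; last exact: Zup.
rewrite /tz -/k (_ : k = r.-2.+1); last by lia.
rewrite iterS iterSr iter_T //; [|lia|exact: Zdn].
by rewrite T_wrap ?updnK //; apply: Zdn.
Qed.

(** By [tz_up] the rotation carries the generator at [t] to the one at [t + 1], so relations have to
    be checked at residue 0 only, where they are hypotheses on the [T j]. *)
Lemma residue_ind (Q : int -> Prop) : (forall t t', (t = t' %[mod r])%Z -> Q t -> Q t') ->
  Q 0 -> (forall t, Q t -> Q (t + 1)) -> forall t, Q t.
Proof.
move=> Qm Q0 QS t; apply: (Qm (res t)); first exact: resK.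
elim: (res t) => // k IH; rewrite (_ : Posz k.+1 = Posz k + 1) //; [exact: QS|lia].
Qed.

Lemma tzL t a x y : Z x -> Z y -> tz t (a *: x + y) = a *: tz t x + tz t y.
Proof. by move=> Hx Hy; rewrite /tz iter_dnL // TL iter_upL. Qed.

Lemma tz_quad t z : Z z -> tz t (tz t z) = (q + q^-1) *: tz t z.
Proof.
move: t z; apply: residue_ind => [t t' e Q z H|z H|t Q z H].
- by rewrite -!(tz_mod _ e); apply: Q.
- by rewrite !tz_nat //; [apply: T_quad|apply: ZT].
rewrite -{1 2}(updnK H) -!tz_up; try by do ?apply: Ztz; apply: Zdn.
by rewrite Q ?upZ ?tz_up ?updnK //; apply: Zdn.
Qed.

Lemma tz_braid t z : (2 < r)%N -> Z z ->
  tz t (tz (t + 1) (tz t z)) - tz t z = tz (t + 1) (tz t (tz (t + 1) z)) - tz (t + 1) z.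
Proof.
move=> r2; move: t z; apply: residue_ind => [t t' e Q z H|z H|t Q z H].
- by rewrite -!(tz_mod _ e) -!(tz_mod _ (modzD1 e)); apply: Q.
- rewrite add0r.
  by rewrite !tz_nat //; [apply: T_braid|do ?apply: ZT..].
have Hd := Zdn H; rewrite -(updnK H).
rewrite -!tz_up -?upN -?upD ?Q //; by do ?apply: Ztz.
Qed.

Lemma tz_comm t d z : (1 < d)%N -> (d.+1 < r)%N -> Z z ->
  tz t (tz (t + d%:Z) z) = tz (t + d%:Z) (tz t z).
Proof.
move=> d1 dr; move: t z; apply: residue_ind => [t t' e Q z H|z H|t Q z H].
- have e' : (t + d = t' + d %[mod r])%Z by rewrite -modzDml e modzDml.
  by rewrite -!(tz_mod _ e) -!(tz_mod _ e'); apply: Q.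
- rewrite add0r !tz_nat //; [exact: T_comm|exact: ZT..].
have Hd := Zdn H; rewrite -(updnK H) addrAC.
rewrite -!tz_up ?Q //; by do ?apply: Ztz.
Qed.

Lemma tz_comm_far t t' z : ~ (t = t' %[mod r])%Z -> ~ (t + 1 = t' %[mod r])%Z ->
  ~ (t' + 1 = t %[mod r])%Z -> Z z -> tz t (tz t' z) = tz t' (tz t z).
Proof.
move=> n0 n1 n1' H; set d := res (t' - t).
have Ed : (t + d = t' %[mod r])%Z by rewrite -modzDmr resK modzDmr addrC subrK.
have dr := res_lt (t' - t); rewrite -/d in dr.
rewrite -!(tz_mod _ Ed); apply: tz_comm => //.
  case: d Ed dr => [|[|d]] // Ed dr.
  by case: n0; rewrite -Ed addr0.
rewrite ltn_neqAle dr andbT; apply/eqP => Er; case: n1'.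
by rewrite -modzDml -Ed modzDml -addrA (_ : d%:Z + 1 = r%:Z) ?modzDr //; lia.
Qed.

(** For [a = q] and [a = q^-1] the quadratic relation makes these two operators mutually inverse:
    the normalised Hecke generator and its inverse. *)
Definition theta (a : K) t z := tz t z - a *: z.

Lemma ZN a x y : Z x -> Z y -> Z (x - a *: y).
Proof. by move=> Hx Hy; rewrite addrC -scaleNr; apply: ZL. Qed.

Lemma Ztheta a t z : Z z -> Z (theta a t z).
Proof. by move=> H; apply: ZN => //; apply: Ztz. Qed.

Lemma theta_up a t z : Z z -> up (theta a t z) = theta a (t + 1) (up z).
Proof. by move=> H; rewrite /theta upD upN upZ tz_up. Qed.

Lemma tzN t x y : Z x -> Z y -> tz t (x - y) = tz t x - tz t y.
Proof. by move=> Hx Hy; rewrite addrC -scaleN1r tzL // scaleN1r addrC. Qed.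
Lemma tzB t a x y : Z x -> Z y -> tz t (x - a *: y) = tz t x - a *: tz t y.
Proof. by move=> Hx Hy; rewrite addrC -scaleNr tzL // scaleNr addrC. Qed.

Lemma thetaK a t z : a = q \/ a = q^-1 -> Z z -> theta a^-1 t (theta a t z) = z.
Proof.
move=> Ha H; have Ht := Ztz t H.
rewrite /theta tzB // tz_quad //.
have a0 : a != 0 by case: Ha => ->; rewrite ?invr_eq0.
have -> : q + q^-1 = a + a^-1 by case: Ha => ->; rewrite // invrK addrC.
lin_norm K M; first by ring.
by rewrite mulr1 !(mulr0, addr0, add0r, oppr0, sub0r) mulrN opprK mulVf.
Qed.

Lemma theta_comm a a' t t' z : ~ (t = t' %[mod r])%Z -> ~ (t + 1 = t' %[mod r])%Z ->
  ~ (t' + 1 = t %[mod r])%Z -> Z z -> theta a t (theta a' t' z) = theta a' t' (theta a t z).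
Proof.
move=> n0 n1 n1' H; have Ht := Ztz t H; have Ht' := Ztz t' H.
rewrite /theta !tzB // (@tz_comm_far t t' z) //.
by lin_norm K M; ring.
Qed.

(** The two sides differ by [(a - b)(b - c)] times [tz t z - tz (t + 1) z], whence the condition on
    the middle parameter. *)
Lemma theta_braid a b c t z : (2 < r)%N -> a = q \/ a = q^-1 -> b = q \/ b = q^-1 ->
  c = q \/ c = q^-1 -> b = a \/ b = c -> Z z ->
  theta a t (theta b (t + 1) (theta c t z)) =
  theta c (t + 1) (theta b t (theta a (t + 1) z)).
Proof.
move=> r2 Ha Hb Hc Hbac H.
have Hs s := Ztz s; have B := @tz_braid t z r2 H.
have Hb2 : 1 - b * (q + q^-1) + b * (a + c) - a * c = 0.
  have b0 : b != 0 by case: Hb => ->; rewrite ?invr_eq0.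
  have -> : q + q^-1 = b + b^-1 by case: Hb => ->; rewrite // invrK addrC.
  by rewrite !mulrDr mulfV //; case: Hbac => <-; ring.
rewrite /theta !tzB ?tzN //; try by do ?apply: ZN; do ?apply: Ztz.
rewrite !tz_quad //; try by do ?apply: Ztz.
have -> : tz t (tz (t + 1) (tz t z)) =
   tz (t + 1) (tz t (tz (t + 1) z)) - tz (t + 1) z + tz t z.
  by rewrite -B subrK.
apply/eqP; rewrite -subr_eq0; apply/eqP.
transitivity ((1 - b * (q + q^-1) + b * (a + c) - a * c) *: (tz t z - tz (t + 1) z)).
  by lin_norm K M; ring.
by rewrite Hb2 scale0r.
Qed.
End Braids.

Variable y0 : M.
Implicit Types w : {ffun 'I_r -> int}.
Hypothesis Zy0 : Z y0.

Definition swap_weight (k l : 'I_r) : K := if (k < l)%N then q else q^-1.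

(** The mixed products of [tau - q] and its inverse [tau - q^-1] that match the standard
    basis of tensor space: which of the two occurs only depends on the tensor positions. *)
Inductive basis_elt : {ffun 'I_r -> int} -> M -> Prop :=
| basis_shift c : basis_elt (shiftw (base_word r) c) (rotate c y0)
| basis_swap w k l b : next_to w k l -> descent w k l -> basis_elt (swapw w k l) b ->
    basis_elt w (theta (swap_weight l k) (w k) b).

Lemma neq_r1 (k l : 'I_r) : k != l -> (1 < r)%N.
Proof.
by rewrite -(inj_eq (@ord_inj r)); have := ltn_ord k; have := ltn_ord l; lia.
Qed.

Lemma swap_weightP k l : swap_weight k l = q \/ swap_weight k l = q^-1.
Proof. by rewrite /swap_weight; case: ifP; [left|right]. Qed.
Lemma swap_weightV k l : k != l -> (swap_weight k l)^-1 = swap_weight l k.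
Proof.
rewrite -(inj_eq (@ord_inj r)) /swap_weight.
by case: (ltnP k l) => H1; case: (ltnP l k) => H2 //; rewrite ?invrK //; lia.
Qed.

Lemma basis_Z w b : basis_elt w b -> Z b.
Proof.
elim=> [c|{}w k l {}b _ d _ IH]; first exact: Z_rotate.
by apply: Ztheta => //; apply: neq_r1 (descent_neq d).
Qed.

Lemma basis_ex w : distinct w -> exists b, basis_elt w b.
Proof.
have [m] := ubnP `|energy w|%N; elim: m w => // m IH w Hm D.
have [[k [l [a d]]]|no] := pselect (exists k l, next_to w k l /\ descent w k l).
  have kl := descent_neq d.
  have [|b Hb] := IH (swapw w k l) _ (distinct_swapw D a kl).
    have := energy_swapw r0 a d; have := energy_ge0 (swapw w k l); lia.
  by exists (theta (swap_weight l k) (w k) b); apply: basis_swap.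
have [|c ->] := no_descent_shift r0 D; last by exists (rotate c y0); apply: basis_shift.
by move=> k l a d; apply: no; exists k, l.
Qed.

Lemma basis_inv w b : basis_elt w b ->
  (exists2 c, w = shiftw (base_word r) c & b = rotate c y0) \/
  exists k l b', [/\ next_to w k l, descent w k l, basis_elt (swapw w k l) b'
    & b = theta (swap_weight l k) (w k) b'].
Proof. by case=> [c|w' k l b' *]; [left; exists c|right; exists k, l, b']. Qed.

Lemma theta_mod a t t' z : (t = t' %[mod r])%Z -> theta a t z = theta a t' z.
Proof. by rewrite /theta => /tz_mod->. Qed.

Lemma swapwC w k l k' l' : k != k' -> k != l' -> l != k' -> l != l' ->
  swapw (swapw w k l) k' l' = swapw (swapw w k' l') k l.
Proof.
move=> n1 n2 n3 n4; apply/ffunP => p; rewrite !ffunE.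
case: (eqVneq p k) => [->|_]; first by rewrite (negPf n1) (negPf n2).
by case: (eqVneq p l) => [->|//]; rewrite (negPf n3) (negPf n4).
Qed.

Lemma swapw_braid w k l m : k != l -> l != m -> k != m ->
  swapw (swapw (swapw w k l) k m) l m = swapw (swapw (swapw w l m) k m) k l.
Proof.
move=> kl lm km; have [lk ml mk] : [/\ l != k, m != l & m != k].
  by rewrite !(eq_sym m) (eq_sym l).
apply/ffunP => p; rewrite !ffunE.
case: (eqVneq p k) => [->|_]; first by rewrite (negPf kl) (negPf km).
case: (eqVneq p l) => [->|_]; first by rewrite (negPf lm); ring.
by case: (eqVneq p m) => // _; ring.
Qed.

(** Two descents of one word can be continued to a common word, overlapping ones by the braid
    relation and disjoint ones by commutation. This is Matsumoto's argument along the energy instead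
    of the length. *)
Lemma basis_fun w b b' : distinct w -> basis_elt w b -> basis_elt w b' -> b = b'.
Proof.
have [N] := ubnP `|energy w|%N; elim: N w b b' => // N IH w b b' HN D Hb Hb'.
have IHs k l c c' : next_to w k l -> descent w k l ->
    basis_elt (swapw w k l) c -> basis_elt (swapw w k l) c' -> c = c'.
  move=> a d; apply: IH; last exact: distinct_swapw (descent_neq d).
  have := energy_swapw r0 a d; have := energy_ge0 (swapw w k l); lia.
case: (basis_inv Hb) => [[c Ew ->]|[k [l [b1 [a d H1 ->]]]]].
  case: (basis_inv Hb') => [[c' Ew' ->]|[k [l [b1 [a d _ _]]]]].
    move: Ew'; rewrite Ew => /ffunP/(_ (Ordinal r0)); rewrite !ffunE => e.
    by congr rotate; lia.
  by rewrite Ew in a d; case: (shift_no_descent r0 a d).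
case: (basis_inv Hb') => [[c' Ew' _]|[k' [l' [b1' [a' d' H1' ->]]]]].
  by rewrite Ew' in a d; case: (shift_no_descent r0 a d).
have kl := descent_neq d; have kl' := descent_neq d'; have r1 := neq_r1 kl.
(* Overlapping descents: [k2], [l2], [m2] carry consecutive residues. Both words admit two more
   descents, and they meet by [swapw_braid]. *)
have chain k2 l2 m2 c1 c2 : next_to w k2 l2 -> descent w k2 l2 -> next_to w l2 m2 ->
    descent w l2 m2 -> basis_elt (swapw w k2 l2) c1 -> basis_elt (swapw w l2 m2) c2 ->
    theta (swap_weight l2 k2) (w k2) c1 = theta (swap_weight m2 l2) (w l2) c2.
  move=> {a d H1 kl a' d' H1' kl'} a d a2 d2 H1 H2.
  have kl := descent_neq d; have lm := descent_neq d2.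
  have km : k2 != m2.
    by apply/eqP => e; move: d d2; rewrite /descent e; do 2!case: ltnP => _; lia.
  have [lk ml mk] : [/\ l2 != k2, m2 != l2 & m2 != k2].
    by rewrite !(eq_sym m2) (eq_sym l2).
  have r2 : (2 < r)%N.
    have := ltn_ord k2; have := ltn_ord l2; have := ltn_ord m2.
    by move: kl lm km; rewrite -!(inj_eq (@ord_inj r)); lia.
  set w1 := swapw w k2 l2 in H1; set v1 := swapw w l2 m2 in H2.
  pose w2 := swapw w1 k2 m2; pose v2 := swapw v1 k2 m2.
  have n1 : next_to w1 k2 m2.
    by rewrite /next_to /w1 swapw_k swapw_p // a2; apply: modzDr_eq.
  have d1 : descent w1 k2 m2.
    rewrite /descent /w1 swapw_k swapw_p //; move: d d2; rewrite /descent.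
    by clear; do 3!case: ltnP => ? /=; lia.
  have D1 : distinct w1 by apply: distinct_swapw.
  have n2 : next_to w2 l2 m2.
    rewrite /next_to /w2 swapw_l // swapw_p // /w1 swapw_l // swapw_p //.
    by rewrite (modzDr_eq (-1) a2) addrK subrK.
  have d3 : descent w2 l2 m2.
    rewrite /descent /w2 swapw_l // swapw_p // /w1 swapw_l // swapw_p //.
    by move: d2; rewrite /descent; clear; lia.
  have D2 : distinct w2 by apply: distinct_swapw.
  have [c Hc] := basis_ex (distinct_swapw D2 n2 lm); have Zc := basis_Z Hc.
  have m1 : next_to v1 k2 m2.
    by rewrite /next_to /v1 swapw_l // swapw_p // (modzDr_eq (-1) a2) addrK.
  have e1 : descent v1 k2 m2.
    rewrite /descent /v1 swapw_l // swapw_p //; move: d d2; rewrite /descent.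
    by clear; do 3!case: ltnP => ? /=; lia.
  have m3 : next_to v2 k2 l2.
    by rewrite /next_to /v2 swapw_k swapw_p // /v1 swapw_k swapw_p //; apply: modzDr_eq.
  have e3 : descent v2 k2 l2.
    rewrite /descent /v2 swapw_k swapw_p // /v1 swapw_k swapw_p //.
    by move: d; rewrite /descent; clear; lia.
  have B1 : basis_elt w1 (theta (swap_weight m2 k2) (w1 k2)
                           (theta (swap_weight m2 l2) (w2 l2) c)).
    by apply: basis_swap n1 d1 _; apply: basis_swap n2 d3 Hc.
  have B2 : basis_elt v1 (theta (swap_weight m2 k2) (v1 k2)
                           (theta (swap_weight l2 k2) (v2 k2) c)).
    apply: basis_swap m1 e1 _; apply: basis_swap m3 e3 _.
    by rewrite /v2 /v1 -swapw_braid.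
  rewrite (IHs _ _ _ _ a d H1 B1) (IHs _ _ _ _ a2 d2 H2 B2).
  have -> : w2 l2 = w l2 - 1 by rewrite /w2 swapw_p // /w1 swapw_l.
  have -> : w1 k2 = w k2 + 1 by rewrite /w1 swapw_k.
  have -> : v2 k2 = w k2 + 1 by rewrite /v2 swapw_k /v1 swapw_p.
  have -> : v1 k2 = w k2 by rewrite /v1 swapw_p.
  have El : (w l2 - 1 = w k2 %[mod r])%Z by rewrite (modzDr_eq (-1) a) addrK.
  rewrite (@theta_mod _ _ _ c El) (@theta_mod _ (w l2) _ _ a).
  apply: theta_braid => //; try exact: swap_weightP.
  (* By transitivity of the order of positions, the middle parameter agrees with the outer ones
     whenever these are equal. *)
  move: kl lm km; rewrite -!(inj_eq (@ord_inj r)) /swap_weight; clear => kl lm km.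
  case: (ltnP m2 k2) => h1; case: (ltnP l2 k2) => h2; case: (ltnP m2 l2) => h3; auto; lia.
case: (eqVneq k k') => [Ek|nk].
  subst k'; have El : l = l' by apply: (next_to_l D a a').
  by subst l'; rewrite (IHs _ _ _ _ a d H1 H1').
case: (eqVneq l k') => [El|nl]; first by subst k'; apply: chain H1 H1'.
case: (eqVneq l' k) => [El|nl']; first by subst k; apply/esym; apply: chain H1' H1.
have nll : l != l'.
  by apply/eqP => e; subst l'; case/eqP: nk; apply: (next_to_k D a a').
have kl1 : k != l' by rewrite eq_sym.
have D2 : distinct (swapw (swapw w k l) k' l').
  apply: distinct_swapw => //; first exact: distinct_swapw.
  by rewrite /next_to !swapw_p // 1?eq_sym.
have [c Hc] := basis_ex D2; have Zc := basis_Z Hc.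
have nk' : k' != k by rewrite eq_sym.
have nl1 : k' != l by rewrite eq_sym.
have nll1 : l' != l by rewrite eq_sym.
have C1 : basis_elt (swapw w k l) (theta (swap_weight l' k') (w k') c).
  have <- : swapw w k l k' = w k' by rewrite swapw_p.
  by apply: basis_swap => //; rewrite /next_to /descent !swapw_p.
have C2 : basis_elt (swapw w k' l') (theta (swap_weight l k) (w k) c).
  have <- : swapw w k' l' k = w k by rewrite swapw_p.
  apply: basis_swap; first by rewrite /next_to !swapw_p.
    by rewrite /descent !swapw_p.
  by rewrite -(@swapwC w k l k' l').
rewrite (IHs _ _ _ _ a d H1 C1) (IHs _ _ _ _ a' d' H1' C2).
apply: theta_comm => // e.
- by case/eqP: nk; apply: D.
- by case/eqP: nl; apply: D; rewrite -e a.
- by case/eqP: nl'; apply: D; rewrite a'.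
Qed.

Lemma shiftwD w c c' : shiftw (shiftw w c) c' = shiftw w (c + c').
Proof. by apply/ffunP => k; rewrite !ffunE addrA. Qed.
Lemma shiftw_swapw w k l c : shiftw (swapw w k l) c = swapw (shiftw w c) k l.
Proof. by apply/ffunP => p; rewrite !ffunE; do !case: eqP => _ //; ring. Qed.
Lemma distinct_shiftw w c : distinct w -> distinct (shiftw w c).
Proof. by move=> D k l; rewrite !ffunE => /modzDr_inj /D. Qed.

Lemma basis_up w b : basis_elt w b -> basis_elt (shiftw w 1) (up b).
Proof.
elim=> [c|{}w k l {}b a d Hb IH].
  by rewrite shiftwD -rotateS //; apply: basis_shift.
have kl := descent_neq d; have r1 := neq_r1 kl.
rewrite theta_up //; last exact: basis_Z Hb.
have -> : w k + 1 = shiftw w 1 k by rewrite ffunE.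
apply: basis_swap; rewrite -?shiftw_swapw //.
  by rewrite /next_to !ffunE; apply: modzDr_eq.
by move: d; rewrite /descent !ffunE; clear; lia.
Qed.

(** Rotating up an element of the shifted word gives an element of [w]; by uniqueness this is
    [b]. *)
Lemma basis_dn w b : distinct w -> basis_elt w b -> basis_elt (shiftw w (- 1)) (dn b).
Proof.
move=> D Hb; have D' := distinct_shiftw (c := - 1) D.
have [c Hc] := basis_ex D'.
have := basis_up Hc; rewrite shiftwD addNr => Hu.
have E : shiftw w 0 = w by apply/ffunP => k; rewrite ffunE addr0.
rewrite E in Hu; rewrite (basis_fun D Hb Hu) dnupK //; exact: basis_Z Hc.
Qed.

(** Along a descent [theta] cancels the outermost factor of [b]; otherwise the swapped word has the
    reverse descent and [theta] is its defining step. *)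
Lemma basis_theta w k l b : distinct w -> next_to w k l -> k != l -> basis_elt w b ->
  basis_elt (swapw w k l) (theta (swap_weight k l) (w k) b).
Proof.
move=> D a kl Hb; have r1 := neq_r1 kl; have lk : l != k by rewrite eq_sym.
have Da := distinct_swapw D a kl.
have [d|nd] := pselect (descent w k l).
  have [c Hc] := basis_ex Da; have Zc := basis_Z Hc.
  rewrite (basis_fun D Hb (basis_swap a d Hc)) -(swap_weightV lk) thetaK //.
  exact: swap_weightP.
have El : (swapw w k l l = w k %[mod r])%Z.
  by rewrite swapw_l // (modzDr_eq (-1) a) addrK.
rewrite -(@theta_mod _ _ _ b El); apply: basis_swap.
- exact: next_to_swapw.
- move: nd kl; rewrite /descent swapw_k swapw_l // -(inj_eq (@ord_inj r)); clear.
  by do 2!case: ltnP => ? /=; lia.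
by rewrite swapwK.
Qed.

Lemma basis_T w b j : distinct w -> (j.+1 < r)%N -> basis_elt w b ->
  exists k l, [/\ next_to w k l, k != l, (w k = j %[mod r])%Z &
    T j b = theta (swap_weight k l) (w k) b + swap_weight k l *: b].
Proof.
move=> D jr Hb; have [k Ek] := residue_surj r0 j D.
have [l a] := next_ex r0 k D; have r1 : (1 < r)%N by lia.
exists k, l; split => //.
  apply/eqP => e; move: a; rewrite -e /next_to => /modz_witness[m].
  move: r1; clear => r1 H.
  have E : m * r = - 1 by lia.
  have [h|h] : 0 <= m \/ m <= - 1 by lia.
    by nia.
  by nia.
rewrite /theta subrK (@tz_mod (w k) j) ?tz_nat //; exact: basis_Z Hb.
Qed.

Definition basis_family b := exists2 w, distinct w & basis_elt w b.

Lemma basis_family_Z b : basis_family b -> Z b.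
Proof. by case=> w _; apply: basis_Z. Qed.

Let Z0 : Z 0. Proof. by have := ZL (-1) Zy0 Zy0; rewrite scaleN1r addNr. Qed.

Lemma span_up y : lspan basis_family y -> lspan basis_family (up y).
Proof.
apply: (lspan_map Z0 ZL basis_family_Z) => [*|b [w D Hb]]; first exact: upL.
apply: lspan_gen; exists (shiftw w 1); [exact: distinct_shiftw|exact: basis_up].
Qed.
Lemma span_dn y : lspan basis_family y -> lspan basis_family (dn y).
Proof.
apply: (lspan_map Z0 ZL basis_family_Z) => [*|b [w D Hb]]; first exact: dnL.
apply: lspan_gen; exists (shiftw w (- 1)); [exact: distinct_shiftw|exact: basis_dn].
Qed.
Lemma span_T j y : (j.+1 < r)%N -> lspan basis_family y -> lspan basis_family (T j y).
Proof.
move=> jr; apply: (lspan_map Z0 ZL basis_family_Z) => [*|b [w D Hb]]; first exact: TL.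
have [k [l [a kl _ ->]]] := basis_T D jr Hb.
rewrite addrC; apply: lspan_lin; first by apply: lspan_gen; exists w.
apply: lspan_gen; exists (swapw w k l); first exact: distinct_swapw.
exact: basis_theta.
Qed.

End AffineHecke.

Local Opaque v.

Lemma distinct_base r : distinct (base_word r).
Proof.
move=> k l; rewrite !ffunE !modz_nat !modn_small // => -[]; exact: ord_inj.
Qed.

(** * Weight modules *)

Section WeightModules.
Variables (K : fieldType) (q : K) (n : nat) (M : lmodType K).
Variables (E F : 'I_n -> M -> M) (wt : ('I_n -> nat) -> M -> Prop).
Hypotheses (n2 : (2 < n)%N) (q0 : q != 0) (qN : forall m : int, m != 0 -> qnum q m != 0).
Hypothesis W : weight_module q E F wt.
Implicit Types (i j p : 'I_n) (lam mu : 'I_n -> nat) (x y z : M) (s : seq 'I_n).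
Let n1 : (1 < n)%N := ltnW n2.
Notation site := (site n2).
Notation lastsite := (lastsite n2).

Lemma E_0 i : E i 0 = 0.
Proof. by have := wm_EL W i (-1) 0 0; rewrite scaler0 add0r scaleN1r addNr. Qed.
Lemma F_0 i : F i 0 = 0.
Proof. by have := wm_FL W i (-1) 0 0; rewrite scaler0 add0r scaleN1r addNr. Qed.
Lemma E_D i x y : E i (x + y) = E i x + E i y.
Proof. by have := wm_EL W i 1 x y; rewrite !scale1r. Qed.
Lemma F_D i x y : F i (x + y) = F i x + F i y.
Proof. by have := wm_FL W i 1 x y; rewrite !scale1r. Qed.
Lemma E_Z i a x : E i (a *: x) = a *: E i x.
Proof. by have := wm_EL W i a x 0; rewrite !addr0 E_0 addr0. Qed.
Lemma F_Z i a x : F i (a *: x) = a *: F i x.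
Proof. by have := wm_FL W i a x 0; rewrite !addr0 F_0 addr0. Qed.

Lemma E_F_hole i lam y : wt lam y -> lam (ordS i) = 0%N ->
  E i (F i y) = qnum q (lam i)%:Z *: y.
Proof. by move=> H e; rewrite (wm_EF W _ H) (wm_E0 W H e) F_0 add0r e subr0. Qed.
Lemma F_E_hole i lam y : wt lam y -> lam i = 0%N ->
  F i (E i y) = qnum q (lam (ordS i))%:Z *: y.
Proof.
move=> H e; have := wm_EF W i H; rewrite (wm_F0 W H e) E_0 e sub0r qnumN scaleNr.
by move/esym/eqP; rewrite subr_eq0 => /eqP.
Qed.
Lemma E_F_slide i lam y : wt lam y -> lam i = 1%N -> lam (ordS i) = 0%N ->
  E i (F i y) = y.
Proof. by move=> H e e'; rewrite (E_F_hole H e') e qnum1 ?scale1r. Qed.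
Lemma F_E_slide i lam y : wt lam y -> lam i = 0%N -> lam (ordS i) = 1%N ->
  F i (E i y) = y.
Proof. by move=> H e e'; rewrite (F_E_hole H e) e' qnum1 ?scale1r. Qed.
Lemma F_E_comm i lam y : wt lam y ->
  F i (E i y) = E i (F i y) - qnum q ((lam i)%:Z - (lam (ordS i))%:Z) *: y.
Proof. by move=> H; rewrite (wm_EF W _ H) addrK. Qed.

Lemma F_F_hole i j lam y : (0 < lam i)%N -> lam (ordS i) = 0%N ->
  (0 < lam j)%N -> lam (ordS j) = 0%N -> F i (F j y) = F j (F i y).
Proof.
move=> pi ei pj ej; apply: (wm_FF W).
by apply/negP => /orP[] /eqP e; move: pi pj; rewrite e ?ei ?ej.
Qed.
Lemma E_E_hole i j lam y : lam i = 0%N -> (0 < lam (ordS i))%N ->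
  lam j = 0%N -> (0 < lam (ordS j))%N -> E i (E j y) = E j (E i y).
Proof.
move=> ei pi ej pj; apply: (wm_EE W).
by apply/negP => /orP[] /eqP e; move: pi pj; rewrite -e ?ei ?ej.
Qed.

(** With single particles at [i] and [ordS i] this is the Hecke generator, normalised by
    [x^2 = (q + q^-1) x]. *)
Definition tau i y := F i (E i y).

Lemma wt_tau i lam y : wt lam y -> lam i = 1%N -> lam (ordS i) = 1%N -> wt lam (tau i y).
Proof.
move=> H e e'; have H1 : wt (eup i lam) (E i y) by apply: (wm_EU W) => //; rewrite e'.
have := wm_FD W (i := i) H1; rewrite eup_i fdn_eup ?e' //; exact.
Qed.

Lemma tau_comm i lam y : wt lam y -> lam i = 1%N -> lam (ordS i) = 1%N ->
  E i (F i y) = tau i y.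
Proof. by move=> H e e'; rewrite (wm_EF W i H) e e' subrr qnum0 scale0r addr0. Qed.

Lemma tau_quad i lam y : wt lam y -> lam i = 1%N -> lam (ordS i) = 1%N ->
  tau i (tau i y) = (q + q^-1) *: tau i y.
Proof.
move=> H e e'; rewrite /tau.
have H1 : wt (eup i lam) (E i y) by apply: (wm_EU W) => //; rewrite e'.
rewrite (E_F_hole H1) ?eup_S ?e' // F_Z eup_i e qnum2 //.
Qed.

Section Pair.
Variables (i : 'I_n).
Let j := ordS i.
Let k := ordS j.
Let ij : i != j. Proof. by rewrite eq_sym /j ordS_neq. Qed.
Let jk : j != k. Proof. by rewrite eq_sym /k ordS_neq. Qed.
Let ik : i != k. Proof. by rewrite eq_sym /k /j ordSS_neq. Qed.
Let aij : adjacent i j. Proof. by rewrite /adjacent eqxx. Qed.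

Let q2 : q + q^-1 != 0. Proof. by rewrite -qnum2 // qN. Qed.

(** Two neighbouring particles slide together into a hole on their right; this is where
    the Serre relation enters. *)
Lemma tau_shift lam y : wt lam y -> lam i = 1%N -> lam j = 1%N -> lam k = 0%N ->
  tau j (F i (F j y)) = F i (F j (tau i y)).
Proof.
move=> H ei ej ek; rewrite /tau.
rewrite (wm_EFn W _ (j := i)) ?(eq_sym j) // (E_F_slide H) //.
have H1 : wt (eup i lam) (E i y) by apply: (wm_EU W) => //; rewrite -/j ej.
have H2 : wt (fdn i lam) (F i y) by apply: (wm_FD W) => //; rewrite ei.
have := wm_SF W (E i y) aij.
rewrite (wm_F0 W (i := j) H1) ?F_0 ?add0r; last by rewrite eup_S // -/j ej.
(* The weight of [F i y] is empty at [i], so in commuting the outer [F i] past [E i] only the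
   commutator survives; its value is [[2]]. *)
have -> : F i (F i (E i y)) = (q + q^-1) *: F i y.
  have -> : F i (E i y) = E i (F i y) by rewrite (tau_comm H).
  rewrite (F_E_comm _ H2) (wm_F0 W (i := i) H2) ?E_0 ?sub0r; last by rewrite fdn_i ei.
  by rewrite fdn_i fdn_S // ei -/j ej -scaleNr -qnumN opprB subr0 qnum2.
rewrite F_Z scaleNr addrC => /eqP; rewrite subr_eq0 => /eqP.
by move/(scalerI q2).
Qed.

(** The sides reduce to [F_i F_j F_i E_i E_j E_i y] and [F_j E_i F_i E_j y]. By the Serre relations
    [[2]^2] times the first is [F_j F_i^2 E_i^2 E_j y]; on the weight of [E_j y] one has [F_i^2
    E_i^2 = ([3] + 1) E_i F_i], and [[3] + 1 = [2]^2]. *)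
Lemma tau_braid lam y : wt lam y -> lam i = 1%N -> lam j = 1%N -> lam k = 1%N ->
  tau i (tau j (tau i y)) - tau i y = tau j (tau i (tau j y)) - tau j y.
Proof.
move=> H ei ej ek; rewrite /tau.
have Hz : wt (eup i lam) (E i y) by apply: (wm_EU W) => //; rewrite -/j ej.
have H2 : wt (eup j lam) (E j y) by apply: (wm_EU W) => //; rewrite -/k ek.
have ji : j != i by rewrite eq_sym.
have ki : k != i by rewrite eq_sym.
have kj : k != j by rewrite eq_sym.
set z := E i y; set z2 := E j y.
have Hz1 : wt (eup j (eup i lam)) (E j z).
  by apply: (wm_EU W) => //; rewrite -/k eup_p // ek.
have Hz2 : wt (eup i (eup j lam)) (E i z2).
  by apply: (wm_EU W) => //; rewrite -/j eup_i.
have L : F i (E i (F j (E j (F i z)))) - F i z = F i (F j (F i (E i (E j z)))).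
  rewrite (wm_EFn W _ (i := j)) // (wm_EFn W _ (i := i)) //.
  rewrite (wm_EF W i Hz1) eup_p // !eup_i eup_S // -/j ej ei.
  rewrite (_ : _ - _ = 1) // qnum1 // scale1r !F_D.
  by rewrite (F_E_slide Hz) ?addrK // ?eup_S // -/j ?ej // -/k eup_p // ek.
have R : F j (E j (F i (E i (F j z2)))) - F j z2 = F j (E i (F i z2)).
  rewrite (wm_EFn W _ (i := i)) // (wm_EFn W _ (i := j)) //.
  rewrite (E_F_slide Hz2); last first.
  - by rewrite -/k eup_p // eup_S // -/k ek.
  - by rewrite eup_S // -/j eup_i ej.
  rewrite (wm_EF W i H2) -/j eup_i eup_p // ei ej F_D.
  by rewrite (_ : _ - _ = - 1) // F_Z qnumN qnum1 // scaleN1r.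
rewrite L R -/z2.
have Hz2' : wt (fdn i (eup j lam)) (F i z2).
  by apply: (wm_FD W) => //; rewrite eup_p // ei.
set x3 := E i (E j z).
have Ex : (q + q^-1) *: x3 = E i (E i z2).
  have := wm_SE W y aij; rewrite -/z (wm_E0 W (i := i) Hz) ?E_0 ?addr0; last first.
    by rewrite eup_S // -/j ej.
  by rewrite scaleNr => /eqP; rewrite subr_eq0 => /eqP <-.
have Hx3 : wt (eup i (eup j (eup i lam))) x3.
  by apply: (wm_EU W) => //; rewrite -/j eup_i.
have Fx : (q + q^-1) *: F i (F j (F i x3)) = F j (F i (F i x3)).
  have := wm_SF W x3 aij; rewrite (wm_F0 W (i := j) Hx3) ?F_0 ?add0r; last first.
    by rewrite eup_S // eup_i // -/j eup_S // -/j ej.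
  by rewrite scaleNr addrC => /eqP; rewrite subr_eq0 => /eqP.
set u := E i (F i z2).
have Fz2 : F i (E i z2) = u + z2.
  rewrite (F_E_comm i H2) -/u -/j eup_i eup_p // ei ej.
  by rewrite (_ : _ - _ = - 1) // qnumN qnum1 // scaleN1r opprK.
have Hu : wt (eup j lam) u.
  have := wm_EU W (i := i) Hz2'; rewrite fdn_S // => /(_ isT).
  by rewrite eup_fdn // eup_p // ei.
have FEu : F i (E i u) = (qnum q 3 + 1) *: u.
  rewrite (F_E_comm i Hu) -/j eup_i eup_p // ei ej.
  rewrite (_ : _ - _ = - 1) // qnumN qnum1 // scaleN1r opprK /u.
  rewrite (F_E_comm i Hz2') (wm_F0 W (i := i) Hz2') ?E_0 ?sub0r; last first.
    by rewrite fdn_i eup_p // ei.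
  rewrite fdn_i fdn_S // -/j eup_i eup_p // ei ej -scaleNr -qnumN.
  by rewrite (_ : - _ = 3) // E_Z scalerDl scale1r.
have FFEE : F i (F i (E i (E i z2))) = (qnum q 3 + 1) *: u.
  rewrite (F_E_comm i Hz2) eup_i eup_S // -/j eup_i eup_p // ei ej.
  by rewrite (_ : _ - _ = 1) // qnum1 // scale1r Fz2 E_D addrK.
apply: (scalerI q2); apply: (scalerI q2).
by rewrite Fx -[in LHS]F_Z -[in LHS]F_Z -[in LHS]F_Z Ex FFEE qnum3 // F_Z scalerA.
Qed.
End Pair.

Variable r : nat.
Hypothesis rn : (r < n)%N.
Notation omega := (@omega n r).

(** [slides_to m lam y z]: [m] slides to the left, never across the boundary between the
    sites [n-1] and [0], bring [y] of weight [lam] to [z] of weight [omega]. *)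
Inductive slides_to : nat -> ('I_n -> nat) -> M -> M -> Prop :=
| slides_stop y : wt omega y -> slides_to 0 omega y y
| slides_step m lam i y z : simple_wt lam -> lam i = 0%N -> lam (ordS i) = 1%N ->
    (i.+1 < n)%N -> wt lam y -> slides_to m (eup i lam) (E i y) z ->
    slides_to m.+1 lam y z.

Lemma slides_facts m lam y z : slides_to m lam y z ->
  [/\ wt lam y, wt omega z, simple_wt lam & size_wt lam = r].
Proof.
elim=> {m lam y z} [y H|m lam i y z S e e' nw H _ [_ Hz _ Hs]]; split => //.
- exact: (simple_omega n2 rn).
- exact: (size_omega n2 rn).
- by rewrite -Hs size_eup // e'.
Qed.

(** Different slides use disjoint pairs of sites and commute, so any available slide can be made the
    first one; hence the end point does not depend on the path. *)
Lemma slides_conf m lam y z i : slides_to m lam y z ->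
  lam i = 0%N -> lam (ordS i) = 1%N -> (i.+1 < n)%N ->
  exists2 m', m = m'.+1 & slides_to m' (eup i lam) (E i y) z.
Proof.
move=> H; elim: H i => {m lam y z} [y H|m lam j y z S e e' nw H HC IH] i ei ei' nwi.
  by case: (omega_stuck n2 rn nwi ei ei').
case: (eqVneq i j) => [->|ij]; first by exists m.
have Hij : i != ordS j by apply: (@neq_wt _ lam); rewrite ei e'.
have Hji : j != ordS i by apply: (@neq_wt _ lam); rewrite e ei'.
have Sij : ordS i != ordS j by rewrite (inj_eq (@ordS_inj n)).
have [ji Hij' Hji' Sji] : [/\ j != i, ordS j != i, ordS i != j & ordS j != ordS i].
  by rewrite eq_sym ij eq_sym Hij eq_sym Hji eq_sym Sij.
case: (IH i _ _ nwi) => [||m' em HC'].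
- by rewrite eup_p.
- by rewrite eup_p.
exists m => //; rewrite em; apply: (slides_step (i := j)) => //.
- exact: simple_eup.
- by rewrite eup_p.
- by rewrite eup_p.
- by apply: (wm_EU W) => //; rewrite ei'.
by rewrite (E_E_hole (i := j) (j := i) (lam := lam)) ?e' ?ei' // eup_eup ?e' ?ei'.
Qed.

Lemma slides_omega m y z : slides_to m omega y z -> y = z.
Proof.
have: forall lam, slides_to m lam y z -> lam = omega -> y = z; last by move/(_ omega) => /[apply]; exact.
move=> lam; case=> // {}m {}lam i y' z' _ e e' nw _ _ El; subst lam.
by case: (omega_stuck n2 rn nw e e').
Qed.

Lemma slides_fun m m' lam y z z' :
  slides_to m lam y z -> slides_to m' lam y z' -> z = z'.
Proof.
move=> H; elim: H m' z' => {m lam y z} [y H|m lam j y z S e e' nw H HC IH] m' z' H'.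
  exact: slides_omega H'.
by have [m1 _ H1] := slides_conf H' e e' nw; apply: IH H1.
Qed.

Lemma slides_lin m m' lam a x y z w : slides_to m lam x z -> slides_to m' lam y w ->
  slides_to m lam (a *: x + y) (a *: z + w).
Proof.
move=> H; elim: H m' y w => {m lam x z} [x H|m lam j x z S e e' nw H HC IH] m' y w H'.
  by rewrite -(slides_omega H'); apply: slides_stop; have [Hy _ _ _] := slides_facts H';
    apply: (wm_wtL W).
have [Hy _ _ _] := slides_facts H'.
have [m1 _ H1] := slides_conf H' e e' nw.
apply: (slides_step (i := j)) => //; first exact: (wm_wtL W).
by rewrite (wm_EL W); apply: IH H1.
Qed.

Lemma slides_ex lam y : simple_wt lam -> size_wt lam = r -> wt lam y ->
  exists m z, slides_to m lam y z.
Proof.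
move=> S Hs; move: lam S Hs y; apply: (slides_ind n2 rn) => [y H|lam i S Hs e e' nw IH y H].
  by exists 0%N, y; apply: slides_stop.
have [|m [z Hz]] := IH (E i y); first by apply: (wm_EU W) => //; rewrite e'.
by exists m.+1, z; apply: slides_step e e' nw H Hz.
Qed.

Lemma slides_surj lam z : simple_wt lam -> size_wt lam = r -> wt omega z ->
  exists m y, slides_to m lam y z.
Proof.
move=> S Hs; move: lam S Hs z; apply: (slides_ind n2 rn) => [z H|lam i S Hs e e' nw IH z H].
  by exists 0%N, z; apply: slides_stop.
have [m [y Hy]] := IH z H; have [Hw _ _ _] := slides_facts Hy.
exists m.+1, (F i y); apply: (slides_step S e e' nw) => //.
  have : wt (fdn i (eup i lam)) (F i y) by apply: (wm_FD W) => //; rewrite eup_i.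
  by rewrite fdn_eup // e'.
by rewrite (E_F_slide Hw) // ?eup_i ?e // eup_S // e'.
Qed.

Lemma slides_F m lam i y z : slides_to m lam y z -> lam i = 1%N -> lam (ordS i) = 0%N ->
  (i.+1 < n)%N -> slides_to m.+1 (fdn i lam) (F i y) z.
Proof.
move=> H e e' nw; have [Hy _ S _] := slides_facts H.
apply: (slides_step (i := i)) => //.
- exact: simple_fdn.
- by rewrite fdn_i e.
- by rewrite fdn_S // e'.
- by apply: (wm_FD W) => //; rewrite e.
by rewrite eup_fdn ?e // (E_F_slide Hy).
Qed.

Lemma slides_E m lam i y z : slides_to m lam y z -> lam i = 0%N -> lam (ordS i) = 1%N ->
  (i.+1 < n)%N -> exists m', slides_to m' (eup i lam) (E i y) z.
Proof. by move=> H e e' nw; have [m' _ ?] := slides_conf H e e' nw; exists m'. Qed.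

Definition Es s y := foldl (fun y i => E i y) y s.
Definition Fs s y := foldr F y s.

Lemma slidable_E s lam y : slidable s lam -> wt lam y ->
  wt (eups s lam) (Es s y) /\ Fs s (Es s y) = y.
Proof.
elim: s lam y => //= i s IH lam y [e e' H] Hy.
have [|H1 H2] := IH _ (E i y) H; first by apply: (wm_EU W) => //; rewrite e'.
by split => //; rewrite H2 (F_E_slide Hy).
Qed.

Lemma slidable_F s lam z : slidable s lam -> wt (eups s lam) z ->
  wt lam (Fs s z) /\ Es s (Fs s z) = z.
Proof.
elim: s lam => //= i s IH lam [e e' H] Hz.
have [H1 H2] := IH _ H Hz; split.
  have : wt (fdn i (eup i lam)) (F i (Fs s z)) by apply: (wm_FD W) => //; rewrite eup_i.
  by rewrite fdn_eup // e'.
rewrite (E_F_slide H1) //; first by rewrite eup_i e.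
by rewrite eup_S // e'.
Qed.

Lemma slidable_slides s lam y : simple_wt lam -> slidable s lam ->
  all (fun i => (i.+1 < n)%N) s -> eups s lam = omega -> wt lam y ->
  slides_to (size s) lam y (Es s y).
Proof.
elim: s lam y => /= [|i s IH] lam y S; first by move=> _ _ -> H; apply: slides_stop.
move=> [e e' H] /andP[nw ns] eo Hy.
apply: (slides_step S e e' nw Hy); apply: IH => //; first exact: simple_eup.
by apply: (wm_EU W) => //; rewrite e'.
Qed.

(** The generator of infinite order of the extended affine Hecke algebra: every particle moves
    one place to the left, the first one around the circle. *)
Definition rotate_down y := Es (lastsite :: back_slides r n2) y.
Definition rotate_up y := Fs (lastsite :: back_slides r n2) y.

Hypothesis r0 : (0 < r)%N.

Lemma wt_rotate_down z : wt omega z -> wt omega (rotate_down z).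
Proof.
have [H1 H2] := slidable_rotate n2 rn r0; move=> /(slidable_E H1)[+ _].
by rewrite H2.
Qed.
Lemma wt_rotate_up z : wt omega z -> wt omega (rotate_up z).
Proof.
have [H1 H2] := slidable_rotate n2 rn r0; rewrite -[in X in X -> _]H2.
by move=> /(slidable_F H1)[].
Qed.
Lemma rotate_downK z : wt omega z -> rotate_up (rotate_down z) = z.
Proof. by have [H1 H2] := slidable_rotate n2 rn r0; move=> /(slidable_E H1)[]. Qed.
Lemma rotate_upK z : wt omega z -> rotate_down (rotate_up z) = z.
Proof.
have [H1 H2] := slidable_rotate n2 rn r0; rewrite -[in X in X -> _]H2.
by move=> /(slidable_F H1)[].
Qed.

(** The mirror image of [tau_shift], obtained from it by inverting the two slides. *)
Lemma tau_shift_left i lam y : wt lam y ->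
  lam i = 0%N -> lam (ordS i) = 1%N -> lam (ordS (ordS i)) = 1%N ->
  tau i (E (ordS i) (E i y)) = E (ordS i) (E i (tau (ordS i) y)).
Proof.
set j := ordS i; set k := ordS j => H ei ej ek.
have ji : j != i by rewrite ordS_neq.
have kj : k != j by rewrite ordS_neq.
have ki : k != i by rewrite ordSS_neq.
have ij : i != j by rewrite eq_sym.
have ik : i != k by rewrite eq_sym.
have H1 : wt (eup i lam) (E i y) by apply: (wm_EU W) => //; rewrite -/j ej.
have H2 : wt (eup j (eup i lam)) (E j (E i y)).
  by apply: (wm_EU W) => //; rewrite -/k eup_p // ek.
have vi : eup j (eup i lam) i = 1%N by rewrite eup_p // eup_i ei.
have vj : eup j (eup i lam) j = 1%N by rewrite eup_i eup_S // -/j ej.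
have vk : eup j (eup i lam) k = 0%N by rewrite eup_S // eup_p // -/k ek.
have := tau_shift H2 vi vj vk.
rewrite -/j -/k (F_E_slide H1) ?eup_S // -/j ?ej // -/k ?eup_p //.
rewrite (F_E_slide H) // => ->.
have H3 := wt_tau H2 vi vj.
have H4 : wt (fdn j (eup j (eup i lam))) (F j (tau i (E j (E i y)))).
  by apply: (wm_FD W) => //; rewrite vj.
rewrite (E_F_slide H4) ?(E_F_slide H3) //.
  by rewrite fdn_p // vi.
by rewrite fdn_i vj.
Qed.

(** The crossing commutes with the slides and can be postponed until the weight is [omega]. There it
    is the first factor of [rotate_down], and the other factors are slides. *)
Lemma slides_wrap m lam y z : slides_to m lam y z ->
  lam lastsite = 0%N -> lam (site 0) = 1%N ->
  exists m', slides_to m' (eup lastsite lam) (E lastsite y) (rotate_down z).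
Proof.
elim=> {m lam y z} [y H|m lam i y z S e e' nw H _ IH] el e1.
  have [H1 H2] := slidable_back n2 rn r0.
  exists (size (back_slides r n2)); rewrite (eup_omega n2 rn r0).
  apply: (slidable_slides) => //.
  - by rewrite -(eup_omega n2 rn r0); apply: simple_eup => //; apply: (simple_omega n2 rn).
  - exact: (back_slides_nw n2 rn r0).
  - by rewrite -(eup_omega n2 rn r0); apply: (wm_EU W); rewrite // ordS_last e1.
have il := last_neq n2 nw.
have il' : lastsite != ordS i by apply: (@neq_wt _ lam); rewrite el e'.
have i0 : i != site 0 by apply: (@neq_wt _ lam); rewrite e e1.
have i0' : ordS i != site 0 by rewrite -(ordS_last n2) (inj_eq (@ordS_inj n)).
have li : lastsite != i by rewrite eq_sym.
have [i01 i01'] : site 0 != i /\ site 0 != ordS i by rewrite eq_sym i0 eq_sym i0'.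
have i0l : ordS i != lastsite by rewrite eq_sym.
have [||m' Hm] := IH.
- by rewrite eup_p.
- by rewrite eup_p.
exists m'.+1; apply: (slides_step (i := i)) => //.
- exact: simple_eup.
- by rewrite eup_p // ordS_last.
- by rewrite eup_p ?ordS_last.
- by apply: (wm_EU W); rewrite // ordS_last e1.
rewrite eup_eup ?e' ?ordS_last ?e1 //.
by rewrite (E_E_hole (i := i) (j := lastsite) (lam := lam)) ?ordS_last ?e1 ?e'.
Qed.

Lemma slides_wrapF m lam y z : slides_to m lam y z ->
  lam lastsite = 1%N -> lam (site 0) = 0%N ->
  exists m', slides_to m' (fdn lastsite lam) (F lastsite y) (rotate_up z).
Proof.
move=> H el e1; have [Hy Hz S Hs] := slides_facts H.
have Hy' : wt (fdn lastsite lam) (F lastsite y) by apply: (wm_FD W); rewrite // el.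
have S' : simple_wt (fdn lastsite lam) by apply: simple_fdn; rewrite // ordS_last.
have Hs' : size_wt (fdn lastsite lam) = r by rewrite size_fdn // el.
have [m' [z' Hm]] := slides_ex S' Hs' Hy'.
exists m'; have [m2] := slides_wrap Hm ltac:(by rewrite fdn_i el)
  ltac:(by rewrite -ordS_last fdn_S // ordS_last e1).
rewrite eup_fdn ?el // (E_F_slide Hy) ?ordS_last // => H2.
have [_ Hz' _ _] := slides_facts Hm.
by rewrite (slides_fun H H2) (rotate_downK Hz').
Qed.

(** Slides preserve the order of the particles, so a single particle at site [i] arrives at this
    site of [omega]. *)
Definition count_below (i : nat) lam := (\sum_(p < n) (p < i) * lam p)%N.

Lemma count_below_eup (i : nat) j lam : (j.+1 < n)%N -> (j.+1 < i)%N \/ (i <= j)%N ->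
  lam (ordS j) = 1%N -> count_below i (eup j lam) = count_below i lam.
Proof.
move=> nw H e; have := weighted_sum_eup (fun p => (p < i)%N) n1 e.
cbv beta; rewrite /count_below (ordS_nw nw) => H1.
by apply/(@addIn (j < i)%N); rewrite -[in RHS]H1; congr (_ + nat_of_bool _)%N; lia.
Qed.

Lemma count_below_S (i : nat) lam : (i < n)%N -> lam (site i) = 0%N ->
  count_below i.+1 lam = count_below i lam.
Proof.
move=> H e; apply: eq_bigr => p _; rewrite ltnS leq_eqVlt.
case: eqP => //= ep; rewrite ep ltnn mul0n mul1n -e; congr lam.
by apply: ord_inj; rewrite siteE.
Qed.

Lemma count_below_omega (i : nat) : (i <= r)%N -> count_below i omega = i.
Proof.
move=> H; rewrite -[RHS](sum_ltn n2 rn); last by lia.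
by apply: eq_bigr => p _; rewrite /omega; boolcase.
Qed.

Lemma slides_inv m lam y z : slides_to m lam y z ->
  lam = omega /\ y = z \/
  exists m' j, [/\ m = m'.+1, lam j = 0%N, lam (ordS j) = 1%N, (j.+1 < n)%N
    & slides_to m' (eup j lam) (E j y) z].
Proof.
case=> [y' _|m' lam' j y' z' _ e e' nw _ H]; first by left.
by right; exists m', j.
Qed.

Lemma E_tau i j y : j != i -> ~~ adjacent j i -> E j (tau i y) = tau i (E j y).
Proof. by move=> ji nadj; rewrite /tau (wm_EFn W) // (wm_EE W). Qed.
Lemma F_tau i j y : i != j -> ~~ adjacent j i -> F j (tau i y) = tau i (F j y).
Proof. by move=> ij nadj; rewrite /tau (wm_FF W) // (wm_EFn W). Qed.

(** A slide away from the pair commutes with [tau i]. A hole directly to the left of the pair lets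
    both particles slide, and [tau_shift_left] carries [tau] along. *)
Lemma slides_tau m lam i y z : slides_to m lam y z ->
  (i.+1 < n)%N -> lam i = 1%N -> lam (ordS i) = 1%N ->
  exists m', slides_to m' lam (tau i y) (tau (site (count_below i lam)) z).
Proof.
elim/ltn_ind: m lam i y z => m IH lam i y z H nw ei ei'.
have [Hy Hz S Hs] := slides_facts H.
have Ht := wt_tau Hy ei ei'.
case: (slides_inv H) => [[El Ey]|[m' [j [Em ej ej' nwj Hm]]]].
  subst lam y; exists 0%N; rewrite count_below_omega ?site_ord.
    exact: slides_stop.
  by move: ei; rewrite /omega; case: ltnP; lia.
have ji : j != i by apply: (@neq_wt _ lam); rewrite ej ei.
have ji' : j != ordS i by apply: (@neq_wt _ lam); rewrite ej ei'.
case: (eqVneq (ordS j) i) => [Eji|Sji]; last first.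
  have Sji' : ordS j != ordS i by rewrite (inj_eq (@ordS_inj n)).
  have iSj : i != ordS j by rewrite eq_sym.
  have na : ~~ adjacent j i by rewrite /adjacent negb_or iSj ji'.
  have [ij Sij SiSj] : [/\ i != j, ordS i != j & ordS i != ordS j].
    by rewrite !(eq_sym (ordS i)) (eq_sym i).
  have m'm : (m' < m)%N by rewrite Em.
  have [||m2 H2] := IH m' m'm (eup j lam) i (E j y) z Hm nw.
  - by rewrite eup_p.
  - by rewrite eup_p.
  exists m2.+1; apply: (slides_step S ej ej' nwj Ht).
  rewrite E_tau //; move: H2; rewrite count_below_eup //.
  have : j != i :> nat by rewrite (inj_eq (@ord_inj n)).
  have : ordS j != i :> nat by rewrite (inj_eq (@ord_inj n)).
  by rewrite ordS_nw //; lia.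
subst i; set i := ordS j in H nw ei ei' Hy Ht ji ji' *; set k := ordS i in ei' *.
have iSi : k != i by rewrite /k ordS_neq.
have kj : k != j by rewrite eq_sym.
have ij : i != j by rewrite eq_sym.
have [|||m2 Em2 H2] := slides_conf (i := i) Hm.
- by rewrite eup_S // -/i ei.
- by rewrite -/k eup_p.
- exact: nw.
have [||m3 H3] := IH m2 ltac:(by rewrite Em Em2; lia) (eup i (eup j lam)) j _ z H2 nwj.
- by rewrite eup_p ?eup_i ?ej // eq_sym.
- by rewrite -/i eup_i eup_S // -/i ei.
rewrite (tau_shift_left Hy ej ei ei') in H3.
exists m3.+2; apply: (slides_step S ej ej' nwj Ht).
have vi : eup j lam i = 0%N by rewrite eup_S // -/i ei.
have vk : eup j lam k = 1%N by rewrite eup_p.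
apply: (slides_step _ vi vk nw).
- exact: simple_eup.
- by apply: (wm_EU W); rewrite // -/i ei.
have Ec : count_below i lam = count_below j lam.
  rewrite /i (ordS_nw nwj) count_below_S ?site_ord //.
have Ec1 : count_below j (eup j lam) = count_below j lam by apply: count_below_eup => //; right.
have Ec2 : count_below j (eup i (eup j lam)) = count_below j (eup j lam).
  by apply: count_below_eup => //; right; rewrite /i ordS_nw //; lia.
by move: H3; rewrite Ec2 Ec1 Ec.
Qed.

Lemma slides_shift_last m lam y z : slides_to m lam y z ->
  lam lastsite = 1%N -> lam (site 0) = 1%N -> lam (site 1) = 0%N ->
  exists m', slides_to m' (fdn lastsite (fdn (site 0) lam))
                          (F lastsite (F (site 0) y)) (rotate_up z).
Proof.
move=> H el e0 e1; have ln : lastsite != site 0.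
  by rewrite eq_sym; apply: last_neq; rewrite siteE; lia.
have ln1 : lastsite != site 1 by apply: (@neq_wt _ lam); rewrite el e1.
have e1' : lam (ordS (site 0)) = 0%N by rewrite ordS_site.
have nw : ((site 0).+1 < n)%N by rewrite siteE; lia.
apply: (slides_wrapF (slides_F H e0 e1' nw)).
  by rewrite fdn_p ?ordS_site.
by rewrite fdn_i e0.
Qed.

(** Moving both particles one place to the right turns a pair across the boundary into a pair at
    sites 0 and 1. Room is made by bringing the nearest hole to site 1, with moves that commute with
    [tau lastsite]. *)
Lemma slides_tau_last m m1 lam y z z1 :
  slides_to m lam y z -> slides_to m1 lam (tau lastsite y) z1 ->
  lam lastsite = 1%N -> lam (site 0) = 1%N -> rotate_up z1 = tau (site 0) (rotate_up z).
Proof.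
move=> H H1 el e0.
have [_ _ _ Hs] := slides_facts H.
have exh : exists h, lam (site h) == 0%N.
  have [|i ei] := @hole_exists n lam; first by rewrite Hs.
  by exists i; rewrite site_ord ei.
(* The least [h] ensures that the site before the hole is occupied, so its particle can step into
   the hole. *)
have : exists h, [/\ lam (site h) = 0%N, forall k, (k < h)%N -> (0 < lam (site k))%N & (h < n)%N].
  have := ex_minnP exh => -[h /eqP eh hmin]; exists h; split => //.
    by move=> k kh; rewrite lt0n; apply/negP => /hmin; lia.
  rewrite ltnNge; apply/negP => nh; have := hmin (h %% n)%N.
  have -> : site (h %% n) = site h by apply: val_inj; rewrite /= modn_mod.
  by rewrite eh eqxx => /(_ isT); have := ltn_pmod h (ltnW n1); lia.
move=> {exh Hs} [h]; elim: h m m1 lam y z z1 H H1 el e0 => [|h IH] m m1 lam y z z1 H H1 el e0 [eh hk hn].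
  by rewrite eh in e0.
have [Hy Hz S Hs] := slides_facts H.
case: h IH eh hk hn => [|h] IH eh hk hn.
  have [m2 H2] := slides_shift_last H el e0 eh.
  have [m3 H3] := slides_shift_last H1 el e0 eh.
  have ln : lastsite != site 0 by rewrite eq_sym; apply: last_neq; rewrite siteE; lia.
  have [|||m4 H4] := slides_tau (i := site 0) H2.
  - by rewrite siteE; lia.
  - by rewrite -{2}(ordS_last n2) fdn_S // ordS_last fdn_i e0.
  - rewrite ordS_site fdn_p //; last by rewrite ordS_last -val_eqE /= !modn_small //; lia.
      by rewrite -ordS_site fdn_S // ordS_site eh.
    by apply: (@neq_wt _ lam); rewrite eh el.
  have Ec : site (count_below (site 0) (fdn lastsite (fdn (site 0) lam))) = site 0.
    rewrite siteE; last by lia.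
    by rewrite /count_below big1 // => p _; rewrite ltn0.
  rewrite Ec in H4; have := tau_shift (i := lastsite) Hy el.
  rewrite ordS_last ordS_site => /(_ e0 eh) Esh.
  by rewrite Esh in H4; apply: (slides_fun H3 H4).
set j := site h.+1; have jv : j = h.+1 :> nat by rewrite /j siteE //; lia.
have Sj : ordS j = site h.+2 by rewrite /j ordS_site.
have ej : lam j = 1%N by have := hk h.+1 (ltnSn _); have := S j; rewrite -/j; lia.
have eSj : lam (ordS j) = 0%N by rewrite Sj.
have nwj : (j.+1 < n)%N by rewrite jv.
have lj : lastsite != j by rewrite eq_sym; apply: last_neq.
have lSj : lastsite != ordS j by apply: (@neq_wt _ lam); rewrite el eSj.
have j0 : site 0 != j by apply/eqP => e; have := jv; rewrite -e siteE; lia.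
have Sj0 : site 0 != ordS j by apply: (@neq_wt _ lam); rewrite e0 eSj.
have na : ~~ adjacent j lastsite.
  by rewrite /adjacent negb_or lSj ordS_last eq_sym j0.
apply: (IH _ _ (fdn j lam) (F j y) z z1).
- exact: (slides_F H ej eSj nwj).
- by rewrite -F_tau //; apply: (slides_F H1 ej eSj nwj).
- by rewrite fdn_p.
- by rewrite fdn_p.
split; [by rewrite fdn_i ej| |by lia].
move=> k kh; rewrite fdn_p; first by apply: hk; lia.
  by apply/eqP => /site_inj; lia.
by rewrite Sj; apply/eqP => /site_inj; lia.
Qed.

Lemma simple_punctured0 : simple_wt (punctured r 0 : 'I_n -> nat).
Proof.
rewrite -(eup_omega n2 rn r0); apply: simple_eup; first exact: (simple_omega n2 rn).
by rewrite /omega lastsiteE; lia.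
Qed.
Lemma size_punctured0 : size_wt (punctured r 0 : 'I_n -> nat) = r.
Proof.
by rewrite -(eup_omega n2 rn r0) size_eup ?(size_omega n2 rn) // ordS_last /omega siteE; lia.
Qed.

Lemma count_below_wrap (i : nat) lam : (0 < i)%N -> (i < n)%N -> lam (site 0) = 1%N ->
  (count_below i (eup lastsite lam)).+1 = count_below i lam.
Proof.
move=> i0 ni e; rewrite -ordS_last in e.
have := weighted_sum_eup (fun p => (p < i)%N) n1 e.
cbv beta; rewrite /count_below ordS_last lastsiteE siteE; last by lia.
have -> : (n.-1 < i)%N = false by lia.
by rewrite i0 addn0 addn1.
Qed.

(** Take the weight with particles at [1, ..., r - 1] and [n - 1]. There the pair at [j + 1] has
    rank [j] and slides to [tau (site j)], while the step across the boundary leads to [omega] and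
    commutes with this pair. *)
Lemma rotate_up_tau j z : wt omega z -> (j.+2 < r)%N ->
  rotate_up (tau (site j) z) = tau (site j.+1) (rotate_up z).
Proof.
move=> Hz jr.
have [m [y Hy]] := slides_surj simple_punctured0 size_punctured0 Hz.
have e0 : omega (site 0) = 1%N by rewrite /omega siteE; lia.
have el : omega lastsite = 0%N by rewrite /omega lastsiteE; lia.
have pl : punctured r 0 lastsite = 1%N by rewrite -(eup_omega n2 rn r0) eup_i el.
have p0 : punctured r 0 (site 0) = 0%N.
  by rewrite -(eup_omega n2 rn r0) -ordS_last eup_S // ordS_last e0.
have v1 : punctured r 0 (site j.+1) = 1%N by rewrite /punctured siteE; lia.
have v2 : punctured r 0 (ordS (site j.+1)) = 1%N.
  by rewrite ordS_site /punctured siteE; lia.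
have nw : ((site j.+1).+1 < n)%N by rewrite siteE; lia.
have [m' Ht] := slides_tau Hy nw v1 v2.
have Ec : site (count_below (site j.+1) (punctured r 0)) = site j.
  congr site; apply: succn_inj; rewrite siteE; last by lia.
  rewrite -(eup_omega n2 rn r0) count_below_wrap ?count_below_omega //; lia.
rewrite {}Ec in Ht.
have Eo : fdn lastsite (punctured r 0) = omega.
  by rewrite -(eup_omega n2 rn r0) fdn_eup // ordS_last e0.
have [m1 H1] := slides_wrapF Hy pl p0; have [m2 H2] := slides_wrapF Ht pl p0.
rewrite Eo in H1 H2.
rewrite -(slides_omega H1) -(slides_omega H2) F_tau //.
  by rewrite eq_sym; apply/eqP => /(congr1 (@nat_of_ord n)); rewrite lastsiteE siteE; lia.
rewrite /adjacent ordS_last ordS_site negb_or; apply/andP; split.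
  by apply/eqP => /site_inj; lia.
by apply/eqP => /(congr1 (@nat_of_ord n)); rewrite lastsiteE siteE; lia.
Qed.

(** At the weight with particles at [0, ..., r - 2] and [n - 1] the pair across the boundary is
    evaluated twice: moved right it becomes [tau (site 0)] after [rotate_up], moved left it becomes
    [tau (site r.-2)] after [rotate_down]. *)
Lemma rotate_up_tau_wrap z : wt omega z -> (1 < r)%N ->
  rotate_up (rotate_up (tau (site r.-2) z)) = tau (site 0) (rotate_up (rotate_up z)).
Proof.
move=> Hu r1; set z0 := rotate_up z.
have Hz : wt omega z0 by apply: wt_rotate_up.
have [_ Ep] := slidable_punctured n2 rn r0 (k := r.-1) ltac:(lia).
pose lam : 'I_n -> nat := punctured r r.-1.
have vl : lam lastsite = 1%N by rewrite /lam /punctured lastsiteE; lia.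
have v0 : lam (site 0) = 1%N by rewrite /lam /punctured siteE; lia.
have Sl : simple_wt lam by move=> p; rewrite /lam /punctured; case: (_ || _).
have Hs : size_wt lam = r.
  rewrite /lam -Ep; have : forall s mu, slidable s mu -> size_wt (eups s mu) = size_wt mu.
    elim=> [//|i s IH] mu [e e' /IH /= ->]; by rewrite size_eup // e'.
  by move=> ->; [exact: size_punctured0|case: (slidable_punctured n2 rn r0 (k := r.-1) ltac:(lia))].
have [m [y Hy]] := slides_surj Sl Hs Hz.
have [Hwy _ _ _] := slides_facts Hy.
pose i := site n.-2; have iv : i = n.-2 :> nat by rewrite /i siteE //; lia.
have Si : ordS i = lastsite by apply: ord_inj; rewrite lastsiteE ordS_nw iv; lia.
have vi : lam i = 0%N by rewrite /lam /punctured iv; lia.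
have nw : (i.+1 < n)%N by lia.
have Ht := wt_tau Hwy vl ltac:(by rewrite ordS_last).
have [m1 [z1 H1]] := slides_ex Sl Hs Ht.
have E1 := slides_tau_last Hy H1 vl v0.
have i0 : site 0 != i by apply: (@neq_wt _ lam); rewrite v0 vi.
have l0 : site 0 != ordS i by rewrite Si; apply: last_neq; rewrite siteE; lia.
have il : i != lastsite by apply: (@neq_wt _ lam); rewrite vl vi.
have shift x m3 z3 : slides_to m3 lam x z3 ->
  exists m4, slides_to m4 (eup lastsite (eup i lam)) (E lastsite (E i x)) (rotate_down z3).
  move=> H3; have [m4 H4] := slides_E H3 vi ltac:(by rewrite Si) nw.
  apply: (slides_wrap H4); first by rewrite -Si eup_S // Si vl.
  by rewrite eup_p.
have [m2 H2] := shift _ _ _ Hy; have [m3 H3] := shift _ _ _ H1.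
have [||m4 H4] := slides_tau H2 nw.
- by rewrite eup_p ?eup_i ?vi // ordS_last eq_sym.
- by rewrite Si eup_i -Si eup_S // Si vl.
have Ec : site (count_below i (eup lastsite (eup i lam))) = site r.-2.
  congr site; apply: succn_inj; rewrite count_below_wrap; try lia; last by rewrite eup_p.
  rewrite count_below_eup //; [|by right|by rewrite Si].
  rewrite -[RHS](sum_ltn n2 rn); last by lia.
  by apply: eq_bigr => p _; rewrite iv /lam /punctured; have := ltn_ord p; boolcase.
rewrite {}Ec in H4; have := tau_shift_left (i := i) Hwy vi.
rewrite Si ordS_last => /(_ vl v0) Esh; rewrite Esh in H4.
have Ed := slides_fun H3 H4.
rewrite /z0 (rotate_upK Hu) in Ed.
have [_ Hz1 _ _] := slides_facts H1.
by rewrite -Ed (rotate_downK Hz1).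
Qed.

(** * The Hecke span inside the weight space of omega *)

Section HeckeSpan.
Variable y0 : M.
Hypothesis Zy0 : wt omega y0.
Local Notation up := rotate_up.
Local Notation dn := rotate_down.
Local Notation T := (fun k : nat => tau (site k)).
Local Notation Z := (wt omega).

Let ZL a x y : Z x -> Z y -> Z (a *: x + y). Proof. exact: (wm_wtL W). Qed.
Let Fs_lin (s : seq 'I_n) a x y : Fs s (a *: x + y) = a *: Fs s x + Fs s y.
Proof. by elim: s => //= i s ->; rewrite (wm_FL W). Qed.
Let upL a x y : up (a *: x + y) = a *: up x + up y.
Proof. exact: Fs_lin. Qed.
Let TL (j : nat) a x y : T j (a *: x + y) = a *: T j x + T j y.
Proof. by rewrite /tau (wm_EL W) (wm_FL W). Qed.
Let Zup z : Z z -> Z (up z).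
Proof. exact: wt_rotate_up. Qed.
Let Zdn z : Z z -> Z (dn z).
Proof. exact: wt_rotate_down. Qed.
Let om (j : nat) : (j < r)%N -> omega (site j) = 1%N.
Proof. by move=> H; rewrite /omega siteE ?H //; lia. Qed.
Let ZT (j : nat) z : (j.+1 < r)%N -> Z z -> Z (T j z).
Proof.
move=> H Hz; apply: (wt_tau Hz); first by apply: om; lia.
by rewrite ordS_site om.
Qed.
Let updnK z : Z z -> up (dn z) = z.
Proof. exact: rotate_downK. Qed.
Let dnupK z : Z z -> dn (up z) = z.
Proof. exact: rotate_upK. Qed.
Let T_quad (j : nat) z : (j.+1 < r)%N -> Z z -> T j (T j z) = (q + q^-1) *: T j z.
Proof.
move=> H Hz; apply: (tau_quad Hz); first by apply: om; lia.
by rewrite ordS_site om.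
Qed.
Let T_braid (j : nat) z : (j.+2 < r)%N -> Z z ->
  T j (T j.+1 (T j z)) - T j z = T j.+1 (T j (T j.+1 z)) - T j.+1 z.
Proof.
move=> H Hz; have := @tau_braid (site j) _ _ Hz.
rewrite !ordS_site; apply; apply: om; lia.
Qed.
Let T_comm (j k : nat) z : (j.+1 < k)%N -> (k.+1 < r)%N -> Z z -> T j (T k z) = T k (T j z).
Proof.
move=> jk kr Hz.
have far : ~~ adjacent (site j) (site k).
  rewrite /adjacent !ordS_site -!val_eqE /= !modn_small; lia.
have ne : site j != site k by rewrite -val_eqE /= !modn_small; lia.
have ne' : site k != site j by rewrite eq_sym.
by rewrite /tau (wm_EFn W _ ne) (wm_EFn W _ ne') (wm_EE W _ far) (wm_FF W _ far).
Qed.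
Let T_up (j : nat) z : (j.+2 < r)%N -> Z z -> up (T j z) = T j.+1 (up z).
Proof.
move=> H Hz; have jn : (j < n)%N by lia.
exact: (@rotate_up_tau (Ordinal jn) _ Hz H).
Qed.
Let T_wrap z : (1 < r)%N -> Z z -> up (up (T r.-2 z)) = T 0%N (up (up z)).
Proof. by move=> H Hz; apply: (rotate_up_tau_wrap Hz). Qed.

Definition word_elt (w : {ffun 'I_r -> int}) x := basis_elt q up dn T y0 w x.
Definition hecke_span y := lspan (basis_family q r up dn T y0) y.

Lemma hecke_span_lin a x y : hecke_span x -> hecke_span y -> hecke_span (a *: x + y).
Proof. exact: lspan_lin. Qed.
Lemma hecke_span_up x : hecke_span x -> hecke_span (up x).
Proof. exact: (span_up q0 r0 ZL upL TL Zup Zdn ZT updnK dnupK T_quad T_braid T_comm T_up T_wrap Zy0). Qed.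
Lemma hecke_span_dn x : hecke_span x -> hecke_span (dn x).
Proof. exact: (span_dn q0 r0 ZL upL TL Zup Zdn ZT updnK dnupK T_quad T_braid T_comm T_up T_wrap Zy0). Qed.
Lemma hecke_span_tau (j : nat) x : (j.+1 < r)%N -> hecke_span x -> hecke_span (T j x).
Proof. exact: (span_T q0 r0 ZL upL TL Zup Zdn ZT updnK dnupK T_quad T_braid T_comm T_up T_wrap Zy0). Qed.
Lemma word_elt_fun w x y : distinct w -> word_elt w x -> word_elt w y -> x = y.
Proof. exact: (basis_fun q0 r0 ZL upL TL Zup Zdn ZT updnK dnupK T_quad T_braid T_comm T_up T_wrap Zy0). Qed.

Lemma hecke_span_base : hecke_span y0.
Proof.
apply: lspan_gen; exists (shiftw (base_word r) 0).
  by move=> k l; rewrite !ffunE !addr0 => e; apply: distinct_base; rewrite !ffunE.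
exact: (@basis_shift K q M r up dn T y0 (Posz 0)).
Qed.

(** A family of linear forms dual to the word elements; it will be given by coefficients in tensor
    space. *)
Definition detects (p : {ffun 'I_r -> int} -> M -> K) : Prop :=
  (forall w a x y, p w (a *: x + y) = a * p w x + p w y) /\
  (forall w w' x, distinct w -> word_elt w x -> p w' x = (w' == w)%:R).

Lemma hecke_span_detect (p : {ffun 'I_r -> int} -> M -> K) : detects p ->
  forall y, hecke_span y -> (forall w, p w y = 0) -> y = 0.
Proof.
move=> [pL pb].
(* The default at other words is harmless, since [p] vanishes there on the span. *)
have pick w : {x | distinct w -> word_elt w x}.
  apply: cid; have [D|nD] := pselect (distinct w); last by exists 0.
  have [x Hx] := basis_ex q0 r0 ZL upL TL Zup Zdn ZT updnK dnupK T_quad T_braid T_comm T_up T_wrap Zy0 D.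
  by exists x.
pose b w := sval (pick w).
have p0 w : p w 0 = 0.
  by have := pL w (-1) 0 0; rewrite scaleN1r addNr mulN1r addNr.
(* The expansion holds over every large enough list without repetitions, so that one list can serve
   both summands. *)
suff expand y : hecke_span y -> exists s0 : seq {ffun 'I_r -> int},
    forall s : seq {ffun 'I_r -> int}, uniq s -> {subset s0 <= s} -> y = \sum_(w <- s) p w y *: b w.
  move=> y /expand[s0 Hs] py; rewrite (Hs (undup s0)) ?undup_uniq //.
    by rewrite big1 // => w _; rewrite py scale0r.
  by move=> w; rewrite mem_undup.
elim=> [|a x {}y [w D Hx] _ [s0 IH]].
  by exists [::] => s _ _; rewrite big1 // => w _; rewrite p0 scale0r.
exists (w :: s0) => s us ss.
have -> : \sum_(w' <- s) p w' (a *: x + y) *: b w' =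
          a *: (\sum_(w' <- s) p w' x *: b w') + \sum_(w' <- s) p w' y *: b w'.
  by rewrite scaler_sumr -big_split; apply: eq_bigr => w' _; rewrite pL scalerDl scalerA.
rewrite -IH //; last by move=> w' Hw'; apply: ss; rewrite inE Hw' orbT.
congr (_ *: _ + _).
rewrite (bigD1_seq w) //=; last by apply: ss; rewrite inE eqxx.
rewrite big1 ?addr0 => [|w' ne]; last by rewrite (pb _ _ _ D Hx) (negPf ne) scale0r.
rewrite (pb _ _ _ D Hx) eqxx scale1r.
by apply: (word_elt_fun D Hx); apply: (svalP (pick w)).
Qed.
End HeckeSpan.

(** * Straightening *)

Section Straightening.
Variable X : M -> Prop.
Hypothesis XL : forall a x y, X x -> X y -> X (a *: x + y).
Hypothesis X_up : forall x, X x -> X (rotate_up x).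
Hypothesis X_down : forall x, X x -> X (rotate_down x).
Hypothesis X_tau : forall (j : nat) x, (j.+1 < r)%N -> X x -> X (tau (site j) x).

Definition simple_good lam y := exists m z, slides_to m lam y z /\ X z.

Lemma simple_good_facts lam y : simple_good lam y ->
  [/\ wt lam y, simple_wt lam & size_wt lam = r].
Proof. by case=> m [z [H _]]; have [] := slides_facts H. Qed.

Lemma simple_good_lin lam a x y :
  simple_good lam x -> simple_good lam y -> simple_good lam (a *: x + y).
Proof.
move=> [m [z [H Hz]]] [m' [w [H' Hw]]]; exists m, (a *: z + w); split; last exact: XL.
exact: (slides_lin a H H').
Qed.

Lemma simple_good_E lam i y : simple_good lam y -> lam i = 0%N -> lam (ordS i) = 1%N ->
  simple_good (eup i lam) (E i y).
Proof.
move=> [m [z [H Hz]]] e e'; have [nw|El] := nw_or_last n2 i.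
  by have [m' Hm] := slides_E H e e' nw; exists m', z.
subst i; rewrite ordS_last in e'.
have [m' Hm] := slides_wrap H e e'.
by exists m', (rotate_down z); split => //; apply: X_down.
Qed.

Lemma simple_good_F lam i y : simple_good lam y -> lam i = 1%N -> lam (ordS i) = 0%N ->
  simple_good (fdn i lam) (F i y).
Proof.
move=> [m [z [H Hz]]] e e'; have [nw|El] := nw_or_last n2 i.
  by exists m.+1, z; split => //; apply: (slides_F H e e' nw).
subst i; rewrite ordS_last in e'.
have [m' Hm] := slides_wrapF H e e'.
by exists m', (rotate_up z); split => //; apply: X_up.
Qed.

Lemma simple_good_tau lam i y : simple_good lam y -> lam i = 1%N -> lam (ordS i) = 1%N ->
  simple_good lam (tau i y).
Proof.
move=> [m [z [H Hz]]] e e'; have [Hw Hzw S Hs] := slides_facts H.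
have [nw|El] := nw_or_last n2 i.
  have [m' Hm] := slides_tau H nw e e'.
  exists m', (tau (site (count_below i lam)) z); split => //; apply: X_tau => //.
  (* The rank is less than [r - 1], because the particles at [i] and [ordS i] count for [r] but not
     for [count_below i]. *)
  rewrite -Hs /size_wt /count_below.
  rewrite (bigD1 i) // (bigD1 (ordS i)) //=; last by rewrite ordS_neq.
  rewrite [X in (_ < X)%N](bigD1 i) // [X in (_ < _ + X)%N](bigD1 (ordS i)) //=; last by rewrite ordS_neq.
  have /= -> := ordS_nw nw; rewrite ltnn mul0n e e'.
  have -> : (i.+1 < i)%N = false by lia.
  rewrite mul0n !add0n add1n add1n !ltnS.
  by apply: leq_sum => p _; case: ltnP; lia.
subst i; rewrite ordS_last in e'.
have Ht := wt_tau Hw e ltac:(by rewrite ordS_last).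
have [m1 [z1 H1]] := slides_ex S Hs Ht.
exists m1, z1; split => //.
have [_ Hz1 _ _] := slides_facts H1.
(* [z1] is recovered from [rotate_up z1], which is a Hecke operator applied to [rotate_up z]. *)
rewrite -(rotate_upK Hz1); apply: X_down.
rewrite (slides_tau_last H H1 e e'); apply: X_tau; last exact: X_up.
rewrite -Hs /size_wt (bigD1 lastsite) // (bigD1 (site 0)) /= ?e ?e' //.
by rewrite -(ordS_last n2) ordS_neq.
Qed.

(** [good_at m lam y]: [m] slides or splits to the right, each filling the hole that ends a
    run, take [y] to a weight without multiplicities. *)
Inductive good_at : nat -> ('I_n -> nat) -> M -> Prop :=
| good_stop lam y : simple_good lam y -> good_at 0 lam y
| good_step m lam i y : run lam i -> lam (ordS i) = 0%N -> wt lam y ->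
    good_at m (fdn i lam) (F i y) -> good_at m.+1 lam y.

Definition good lam y := exists m, good_at m lam y.

Lemma good_at_facts m lam y : good_at m lam y -> wt lam y /\ size_wt lam = r.
Proof.
elim=> [{}lam {}y /simple_good_facts[]//|{}m {}lam i {}y R e Hy _ [_ Hs]].
by split => //; rewrite -Hs size_fdn //; apply: (run_pos n2 R).
Qed.
Lemma good_facts lam y : good lam y -> wt lam y /\ size_wt lam = r.
Proof. by case=> m /good_at_facts. Qed.

Lemma run_neq lam i j : run lam i -> lam (ordS j) = 0%N -> i != ordS j.
Proof. by move=> /(run_pos n2) R e; apply: (@neq_wt _ lam); rewrite e -lt0n. Qed.

(** Moves into different holes commute and neither disturbs the run of the other. *)
Lemma good_at_conf m lam y i : good_at m lam y -> run lam i -> lam (ordS i) = 0%N ->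
  exists2 m', m = m'.+1 & good_at m' (fdn i lam) (F i y).
Proof.
move=> H; elim: H i => {m lam y} [lam y /simple_good_facts[_ S _]|m lam j y Rj ej Hy H IH] i Ri ei.
  by case: (run_not_simple n2 Ri S).
case: (eqVneq i j) => [->|ij]; first by exists m.
have ji : j != i by rewrite eq_sym.
have iSj := run_neq Ri ej; have jSi := run_neq Rj ei.
have Sij : ordS i != ordS j by rewrite (inj_eq (@ordS_inj n)).
have Sji : ordS j != ordS i by rewrite eq_sym.
have [||m' Em H'] := IH i.
- exact: run_fdn.
- by rewrite fdn_p // eq_sym.
exists m => //; rewrite Em; apply: (good_step (i := j)).
- exact: run_fdn.
- by rewrite fdn_p // eq_sym.
- by apply: (wm_FD W) => //; apply: (run_pos n2 Ri).
rewrite fdn_fdn; [|exact: (run_pos n2 Rj)|exact: (run_pos n2 Ri)].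
rewrite (F_F_hole (i := j) (j := i) (lam := lam)) //.
  exact: (run_pos n2 Rj).
exact: (run_pos n2 Ri).
Qed.

Lemma good_lin lam a x y : good lam x -> good lam y -> good lam (a *: x + y).
Proof.
move=> [m Hx] [m' Hy]; exists m; elim: Hx m' y Hy => {m lam x}.
  move=> lam x Hx m' y Hy; apply: good_stop; apply: simple_good_lin => //.
  have [_ S _] := simple_good_facts Hx.
  inversion Hy as [lam' y' Hy'|m0 lam' i y' R]; subst => //.
  by case: (run_not_simple n2 R S).
move=> m lam i x R e Hx H IH m' y Hy.
have [m1 _ H1] := good_at_conf Hy R e; have [Hwy _] := good_at_facts Hy.
apply: (good_step R e); first exact: (wm_wtL W).
by rewrite (wm_FL W); apply: IH H1.
Qed.

Lemma good_Z lam a y : good lam y -> good lam (a *: y).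
Proof.
move=> H; have := good_lin (-1) H H; rewrite scaleN1r addNr => H0.
by have := good_lin a H H0; rewrite addr0.
Qed.

Lemma good_F_hole m lam i y : good_at m lam y -> (0 < lam i)%N -> lam (ordS i) = 0%N ->
  good (fdn i lam) (F i y).
Proof.
move=> H; elim: H i => {m lam y} [lam y Hy|m lam j y Rj ej Hy H IH] i Hi ei.
  exists 0%N; apply: good_stop; apply: simple_good_F => //.
  by have [_ S _] := simple_good_facts Hy; have := S i; lia.
case: (eqVneq i j) => [->|ij]; first by exists m.
have ji : j != i by rewrite eq_sym.
have iSj : i != ordS j by apply: (@neq_wt _ lam); rewrite ej -lt0n.
have jSi := run_neq Rj ei.
have Sij : ordS i != ordS j by rewrite (inj_eq (@ordS_inj n)).
have Sji : ordS j != ordS i by rewrite eq_sym.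
have [||m' H'] := IH i.
- by rewrite fdn_p.
- by rewrite fdn_p // eq_sym.
exists m'.+1; apply: (good_step (i := j)).
- exact: run_fdn.
- by rewrite fdn_p // eq_sym.
- exact: (wm_FD W).
rewrite fdn_fdn //; last exact: (run_pos n2 Rj).
rewrite (F_F_hole (i := j) (j := i) (lam := lam)) //.
exact: (run_pos n2 Rj).
Qed.

Lemma run_case lam j : run lam j ->
  (2 <= lam j)%N \/ exists p, [/\ j = ordS p, run lam p & lam j = 1%N].
Proof. by case=> [i|i R e]; [left|right; exists i]. Qed.

(** Induction on the excess, then on the number of moves. A move of [y] is carried past [E i]; the
    obstruction is that [E i] may destroy the run that justifies this move. *)
Lemma good_E_hole lam i y : good lam y -> lam i = 0%N -> (0 < lam (ordS i))%N ->
  good (eup i lam) (E i y).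
Proof.
have [d] := ubnP (excess lam); elim: d lam i y => // d IHd lam i y Hd [m Hm].
elim: m lam i y Hd Hm => [|m IH] lam i y Hd Hm ei Hi.
  inversion Hm as [lam' y' Hy|]; subst; exists 0%N; apply: good_stop.
  apply: simple_good_E => //.
  by have [_ S _] := simple_good_facts Hy; have := S (ordS i); lia.
have [Hwy Hsz] := good_at_facts Hm.
have HEy : wt (eup i lam) (E i y) by apply: (wm_EU W).
have ESi := ordS_neq i n1; have iSi : i != ordS i by rewrite eq_sym.
have far j : run lam j -> lam (ordS j) = 0%N -> ordS j != i -> good (eup i lam) (E i y).
  move=> Rj ej Sji; have [m0 [Em] Hj] := good_at_conf Hm Rj ej; subst m0.
  have ij : i != j by apply: (@neq_wt _ lam); rewrite ei eq_sym -lt0n; apply: (run_pos n2 Rj).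
  have ji : j != i by rewrite eq_sym.
  have SiSj : ordS i != ordS j by rewrite (inj_eq (@ordS_inj n)).
  have SjSi : ordS j != ordS i by rewrite eq_sym.
  have iSj : i != ordS j by rewrite eq_sym.
  have Hj2 : ordS i = j -> (2 <= lam j)%N.
    move=> e; case: (run_case Rj) => // -[p [ep Rp _]].
    by move: ep; rewrite -e => /ordS_inj ep; have := run_pos n2 Rp; rewrite -ep ei.
  have Hex : (excess (fdn j lam) <= excess lam)%N.
    by have := excess_fdn_le n2 (run_pos n2 Rj) ej; lia.
  have [|||m1 H1] := IH (fdn j lam) i (F j y) _ Hj.
  - by lia.
  - by rewrite fdn_p.
  - case: (eqVneq (ordS i) j) => [e|nij]; last by rewrite fdn_p.
    by rewrite e fdn_i; have := Hj2 e; lia.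
  rewrite (wm_EFn W) // eup_fdnC // in H1.
  have emu : eup i lam (ordS j) = 0%N by rewrite eup_p.
  (* If the run survives, [F j] is a first move for [E i y]. If not, [E i] took a particle from a
     stack and left [j] singly occupied; the excess has dropped, and the outer induction undoes
     [F j] by [E j]. *)
  have [Rmu|nRmu] := pselect (run (eup i lam) j); first by exists m1.+1; apply: good_step H1.
  have b2 : (2 <= lam (ordS i))%N.
    rewrite ltnNge; apply/negP => b1; apply: nRmu; apply: run_eup => //; lia.
  have mu1 : eup i lam j = 1%N.
    case: (eqVneq (ordS i) j) => [e|nij].
      have := Hj2 e; rewrite -{2}e eup_S // e; case: (ltnP 2 (lam j)) => h; last by lia.
      by case: nRmu; apply: run_stack; rewrite -e eup_S // e; lia.
    have nij' : j != ordS i by rewrite eq_sym.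
    rewrite eup_p //; case: (run_case Rj) => [h|[p []//]].
    by case: nRmu; apply: run_stack; rewrite eup_p.
  have := IHd (fdn j (eup i lam)) j (F j (E i y)) _ (ex_intro _ _ H1).
  rewrite eup_fdn ?mu1 // (E_F_slide HEy) //; apply.
  - have := excess_fdn_le n2 (i := j) (lam := eup i lam); rewrite mu1 emu => /(_ isT erefl).
    have := excess_eup n2 ei Hi; lia.
  - by rewrite fdn_i mu1.
  - by rewrite fdn_S // emu.
inversion Hm as [|m' lam' j y' Rj ej _ Hj]; subst.
case: (eqVneq (ordS j) i) => [e|Sji]; last exact: (far j).
(* The given move fills the hole [i] itself. A stack at [ordS i] yields another run. For a single
   particle there, [E i] extends the run by [i], and [F i], which restores [y], is a new first
   move. *)
case: (ltnP 1 (lam (ordS i))) => b2.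
  have [|j' [Rj' ej' Sj'i]] := other_run n2 ei b2; first by rewrite Hsz.
  exact: (far j').
have b1 : lam (ordS i) = 1%N by lia.
exists m.+2; apply: (good_step (i := i)) => //.
- have R1 : run (eup i lam) (ordS j).
    by apply: run_single; [exact: (run_eup n2 Rj ei b1)|rewrite e eup_i ei].
  by rewrite e in R1.
- by rewrite eup_S // b1.
by rewrite fdn_eup ?b1 // (F_E_slide Hwy).
Qed.

(** For a stack at [i] the move is a legitimate first step; for a single particle it is undone by
    [good_E_hole]. *)
Lemma good_F_test lam i y : wt lam y -> (0 < lam i)%N -> lam (ordS i) = 0%N ->
  good (fdn i lam) (F i y) -> good lam y.
Proof.
move=> Hy Hi e H; case: (ltnP 1 (lam i)) => h.
  by have [m Hm] := H; exists m.+1; apply: (good_step (i := i)) => //; apply: run_stack.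
have e1 : lam i = 1%N by lia.
have := good_E_hole (i := i) H; rewrite fdn_i e1 fdn_S // e => /(_ erefl isT).
by rewrite eup_fdn ?e1 // (E_F_slide Hy).
Qed.
Lemma not_adjacent i j : i != ordS j -> j != ordS i -> ~~ adjacent i j.
Proof. by rewrite /adjacent negb_or => -> ->. Qed.

(** [E i] opens a hole at [ordS i], which reduces the claim to goodness of [tau i y]. On simple
    weights this is a Hecke operator; otherwise the first move commutes with [E i] or belongs to a
    run through the pair. *)
Lemma good_E_pair m lam i y : good_at m lam y -> lam i = 1%N -> lam (ordS i) = 1%N ->
  good (eup i lam) (E i y).
Proof.
elim/ltn_ind: m lam i y => m IH lam i y Hm ei ei'.
have [Hwy Hsz] := good_at_facts Hm.
have HEy : wt (eup i lam) (E i y) by apply: (wm_EU W); rewrite // ei'.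
have Si := ordS_neq i n1; have iS : i != ordS i by rewrite eq_sym.
have mi : eup i lam i = 2%N by rewrite eup_i ei.
have mi' : eup i lam (ordS i) = 0%N by rewrite eup_S // ei'.
have from_tau : good lam (tau i y) -> good (eup i lam) (E i y).
  by move=> H; apply: (good_F_test (i := i)); rewrite ?mi // fdn_eup // ei'.
case: m IH Hm => [|m] IH Hm.
  inversion Hm as [lam' y' Hy|]; subst; apply: from_tau; exists 0%N; apply: good_stop.
  exact: simple_good_tau.
inversion Hm as [|m' lam' j y' Rj ej _ Hj]; subst.
have iSj : i != ordS j by apply: (@neq_wt _ lam); rewrite ej ei.
have SiSj' : ordS i != ordS j by apply: (@neq_wt _ lam); rewrite ej ei'.
have ij : i != j by apply: contra SiSj' => /eqP->.
have [ji Sji SjSi] : [/\ j != i, ordS j != i & ordS j != ordS i].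
  by rewrite !(eq_sym (ordS j)) (eq_sym j).
case: (eqVneq j (ordS i)) => [Ej|jSi]; last first.
  have Sij : ordS i != j by rewrite eq_sym.
  have [||m1 H1] := IH m (ltnSn _) (fdn j lam) i (F j y) Hj.
  - by rewrite fdn_p.
  - by rewrite fdn_p.
  rewrite (wm_EFn W) // eup_fdnC // in H1.
  apply: (good_F_test (i := j)) => //; last by exists m1.
  - by rewrite eup_p //; apply: (run_pos n2 Rj).
  - by rewrite eup_p.
subst j; set k := ordS (ordS i) in ej iSj SiSj' Sji SjSi.
have ki : k != i by rewrite /k ordSS_neq.
(* The run passes through the pair and ends at the hole [k]. Both particles move right, the
   induction hypothesis applies to the pair at [ordS i] and [k], and [tau_shift] brings [tau]
   back. *)
have Ri : run lam i.
  case: (run_case Rj) => [|[p [/ordS_inj <- //]]]; by rewrite ei'.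
have [Rf ef] : run (fdn (ordS i) lam) i /\ fdn (ordS i) lam (ordS i) = 0%N.
  by split; [apply: run_fdn|rewrite fdn_i ei'].
have [m2 Em H2] := good_at_conf Hj Rf ef.
have [Hw2 _] := good_at_facts H2.
pose mu := fdn i (fdn (ordS i) lam).
have u1 : mu (ordS i) = 1%N by rewrite /mu fdn_S // ef.
have u2 : mu k = 1%N by rewrite /mu fdn_p // fdn_S // -/k ej.
have H3 := IH m2 ltac:(by rewrite Em; lia) mu (ordS i) _ H2 u1 u2.
have [m3 /good_F_hole H4] := H3.
have {H4} := H4 (ordS i); rewrite eup_i u1 eup_S // -/k u2 => /(_ isT erefl).
rewrite fdn_eup // -/k ?u2 // -/(tau _ _).
rewrite (tau_shift Hwy ei ei' ej) => H5.
have Ht := wt_tau Hwy ei ei'.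
have Ht1 : wt (fdn (ordS i) lam) (F (ordS i) (tau i y)) by apply: (wm_FD W); rewrite // ei'.
apply: from_tau; apply: (good_F_test (i := ordS i)) => //; first by rewrite ei'.
apply: (good_F_test (i := i)) => //.
by rewrite fdn_p // ?ei.
Qed.

Lemma excess_fdn_hole lam i : (0 < lam i)%N -> lam (ordS i) = 0%N ->
  (excess (fdn i lam) <= excess lam)%N.
Proof. by move=> H e; have := excess_fdn_le n2 H e; lia. Qed.

(** A stack pushed onto an occupied site whose right neighbour is a hole can make room first. *)
Lemma F_via_hole lam i y : wt lam y -> (0 < lam (ordS i))%N -> lam (ordS (ordS i)) = 0%N ->
  F i y = (qnum q (lam (ordS i)))^-1 *: E (ordS i) (F i (F (ordS i) y)).
Proof.
move=> Hy Hi e; have Si := ordS_neq i n1.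
rewrite (wm_EFn W) // (E_F_hole Hy e) (F_Z) scalerA mulVf ?scale1r //.
by apply: qN; rewrite eqz_nat -lt0n.
Qed.

(** Induction on the distance to the next hole on the right. If it is adjacent, [F_via_hole] gives
    two moves of single particles followed by an [E] on a pair; otherwise a move commuting with
    [F i] brings it closer. *)
Lemma good_F_pair lam i y : simple_good lam y -> lam i = 1%N -> lam (ordS i) = 1%N ->
  good (fdn i lam) (F i y).
Proof.
move=> Hy ei ei'; have [_ _ Hs] := simple_good_facts Hy.
have [|k [p Hg]] := @gap_ex n n2 lam (ordS i).
  by apply: hole_exists; rewrite Hs.
elim: k lam i y p Hy ei ei' Hs Hg => [|k IH] lam i y p Hy ei ei' Hs Hg.
  have e := gap_end n2 Hg; inversion Hg; subst p; have [Hwy S _] := simple_good_facts Hy.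
  have Si := ordS_neq i n1; have iS : i != ordS i by rewrite eq_sym.
  have SSiSi := ordS_neq (ordS i) n1.
  have SSi := ordSS_neq i n2; have iSS : i != ordS (ordS i) by rewrite eq_sym.
  rewrite (F_via_hole Hwy) ?ei' //; apply: good_Z.
  have G1 := simple_good_F Hy ei' e.
  have v1 : fdn (ordS i) lam i = 1%N by rewrite fdn_p.
  have v2 : fdn (ordS i) lam (ordS i) = 0%N by rewrite fdn_i ei'.
  have G2 := simple_good_F G1 v1 v2.
  have w1 : fdn i (fdn (ordS i) lam) (ordS i) = 1%N by rewrite fdn_S // v2.
  have w2 : fdn i (fdn (ordS i) lam) (ordS (ordS i)) = 1%N.
    by rewrite fdn_p // fdn_S // e.
  have := good_E_pair (good_stop G2) w1 w2.
  by rewrite fdn_fdn ?ei ?ei' // eup_fdn // fdn_S.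
have [Hwy S _] := simple_good_facts Hy.
have Hp := gap_pos n2 Hg isT; have ep := gap_end n2 Hg.
have ep1 : lam p = 1%N by have := S p; lia.
have [p' Hg'] := gap_fdn n2 Hg ep1.
have Sp : p != ordS i.
  apply/eqP => e; inversion Hg as [|k' s' p0 Hn _]; subst.
  by rewrite ep in Hn.
have iSp : i != ordS p by apply: (@neq_wt _ lam); rewrite ep ei.
have SiSp : ordS i != ordS p by apply: (@neq_wt _ lam); rewrite ep ei'.
have ip : i != p by apply: contra SiSp => /eqP->.
have [pi Sip SpSi Spi] : [/\ p != i, ordS i != p, ordS p != ordS i & ordS p != i].
  by rewrite !(eq_sym (ordS p)) (eq_sym p) (eq_sym (ordS i)).
have H1 := simple_good_F Hy ep1 ep.
have [|||//|m1 H2] := IH (fdn p lam) i (F p y) p' H1.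
- by rewrite fdn_p.
- by rewrite fdn_p.
- by rewrite size_fdn.
apply: (good_F_test (i := p)).
- by apply: (wm_FD W); rewrite // ei.
- by rewrite fdn_p // ep1.
- by rewrite fdn_p.
exists m1; rewrite fdn_fdn ?ep1 ?ei // (wm_FF W) //; exact: not_adjacent.
Qed.
(** [D] bounds the excess at both ends of a move; all moves between weights of smaller excess are
    then available when a particle joins a stack. *)
Lemma good_moves D lam y : good lam y -> (excess lam <= D)%N ->
  (forall i, (0 < lam (ordS i))%N -> (excess (eup i lam) <= D)%N -> good (eup i lam) (E i y)) /\
  (forall i, (0 < lam i)%N -> (excess (fdn i lam) <= D)%N -> good (fdn i lam) (F i y)).
Proof.
elim/ltn_ind: D lam y => D IHD.
(* A single particle joins a stack, and the hole it leaves allows a test by [F i]. The commutator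
   reduces [F i (E i y)] to [E i (F i y)] and [y]; both steps of the former stay at the excess of
   [y], below [D]. *)
have UE lam y i : good lam y -> (0 < lam i)%N -> lam (ordS i) = 1%N ->
    (excess (eup i lam) <= D)%N -> good (eup i lam) (E i y).
  move=> Hy Hi ei' HD; case: (ltnP 1 (lam i)) => h; last first.
    by have [m Hm] := Hy; apply: good_E_pair Hm _ ei'; lia.
  have [Hwy _] := good_facts Hy; have Si := ordS_neq i n1.
  have x1 : excess (eup i lam) = (excess lam).+1.
    by have := sum_eup predn i lam n1; rewrite -/(excess _) -/(excess _) ei'; clear -Hi; lia.
  have x2 : excess (fdn i lam) = excess lam.
    by have := sum_fdn predn i lam n1; rewrite -/(excess _) -/(excess _) ei'; clear -h; lia.
  have D1 : (D.-1 < D)%N by move: HD; rewrite x1; clear; lia.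
  have xD : (excess lam <= D.-1)%N by move: HD; rewrite x1; clear; lia.
  have H1 : good (fdn i lam) (F i y) by apply: (IHD _ D1 lam y Hy xD).2; rewrite // x2.
  have H2 : good lam (E i (F i y)).
    rewrite -{1}(eup_fdn (i := i) n1 Hi); apply: (IHD _ D1 _ _ H1 _).1.
    - by rewrite x2.
    - by rewrite fdn_S // ei'.
    - by rewrite eup_fdn.
  have HEy : wt (eup i lam) (E i y) by apply: (wm_EU W); rewrite // ei'.
  apply: (good_F_test (i := i)) => //; first by rewrite eup_i.
    by rewrite eup_S // ei'.
  rewrite fdn_eup ?ei' // (F_E_comm i Hwy) addrC -scaleNr.
  exact: good_lin.
(* For a stack at [ordS i] the first move of [y] commutes with [E i] and remains possible, even if
   it starts at that stack. *)
have NE m lam y i : good_at m lam y -> (0 < lam i)%N -> (0 < lam (ordS i))%N ->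
    (excess (eup i lam) <= D)%N -> good (eup i lam) (E i y).
  elim: m lam y i => [|m IH] lam y i Hm Hi Hi' HD.
    inversion Hm as [lam' y' Hy|]; subst; have [_ S _] := simple_good_facts Hy.
    by apply: UE => //; [exists 0%N|have := S (ordS i); clear -Hi'; lia].
  have [Hwy _] := good_at_facts Hm; have Si := ordS_neq i n1.
  case: (ltnP 1 (lam (ordS i))) => h; last first.
    by apply: UE => //; [exists m.+1|clear -h Hi'; lia].
  inversion Hm as [|m' lam' j y' Rj ej _ Hj]; subst.
  have iSj : i != ordS j by apply: (@neq_wt _ lam); rewrite ej -lt0n.
  have SiSj : ordS i != ordS j by apply: (@neq_wt _ lam); rewrite ej -lt0n.
  have ij : i != j by apply: contra SiSj => /eqP->.
  have [ji Sji SjSi] : [/\ j != i, ordS j != i & ordS j != ordS i].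
    by rewrite !(eq_sym (ordS j)) (eq_sym j).
  have HEy : wt (eup i lam) (E i y) by apply: (wm_EU W).
  have pj : (0 < eup i lam j)%N.
    case: (eqVneq j (ordS i)) => [->|jSi]; first by rewrite eup_S //; clear -h; lia.
    by rewrite eup_p //; apply: (run_pos n2 Rj).
  have ej' : eup i lam (ordS j) = 0%N by rewrite eup_p.
  have pi : (0 < fdn j lam i)%N by rewrite fdn_p.
  have pSi : (0 < fdn j lam (ordS i))%N.
    case: (eqVneq j (ordS i)) => [->|jSi]; first by rewrite fdn_i; clear -h; lia.
    by rewrite fdn_p // eq_sym.
  have [|m1 H1] := IH _ _ i Hj pi pSi.
    by rewrite eup_fdnC //; apply: leq_trans HD; apply: excess_fdn_hole.
  apply: (good_F_test (i := j)) => //.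
  by exists m1; rewrite -(wm_EFn W) // -eup_fdnC.
have NF m lam y i : good_at m lam y -> (0 < lam i)%N -> (0 < lam (ordS i))%N ->
    (excess (fdn i lam) <= D)%N -> good (fdn i lam) (F i y).
  elim: m lam y i => [|m IH] lam y i Hm Hi Hi' HD.
    inversion Hm as [lam' y' Hy|]; subst; have [_ S _] := simple_good_facts Hy.
    apply: good_F_pair => //.
      by have := S i; clear -Hi; lia.
    by have := S (ordS i); clear -Hi'; lia.
  have [Hwy _] := good_at_facts Hm; have Si := ordS_neq i n1.
  inversion Hm as [|m' lam' j y' Rj ej _ Hj]; subst.
  have iSj : i != ordS j by apply: (@neq_wt _ lam); rewrite ej -lt0n.
  have SiSj : ordS i != ordS j by apply: (@neq_wt _ lam); rewrite ej -lt0n.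
  have ij : i != j by apply: contra SiSj => /eqP->.
  have [ji Sji SjSi] : [/\ j != i, ordS j != i & ordS j != ordS i].
    by rewrite !(eq_sym (ordS j)) (eq_sym j).
  have pi : (0 < fdn j lam i)%N by rewrite fdn_p.
  have pj := run_pos n2 Rj.
  case: (eqVneq j (ordS i)) => [Ej|jSi]; last first.
    have Sij : ordS i != j by rewrite eq_sym.
    have ej' : fdn i lam (ordS j) = 0%N by rewrite fdn_p.
    have pj' : (0 < fdn i lam j)%N by rewrite fdn_p.
    have [||m1 H1] := IH _ _ i Hj pi.
    - by rewrite fdn_p.
    - by rewrite fdn_fdn //; apply: leq_trans HD; apply: excess_fdn_hole.
    apply: (good_F_test (i := j)) => //; first exact: (wm_FD W).
    exists m1; rewrite fdn_fdn // (wm_FF W) //; exact: not_adjacent.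
  (* The first move starts at [ordS i] and interferes with [F i]. [F_via_hole] replaces [F i] by two
     moves and an [E] of a single particle, to which [UE] applies. *)
  subst j; have iS : i != ordS i by rewrite eq_sym.
  have SSi := ordSS_neq i n2; have SSiSi := ordS_neq (ordS i) n1.
  have pSi : (0 < fdn i lam (ordS i))%N by rewrite fdn_S.
  rewrite (F_via_hole Hwy) //; apply: good_Z.
  have H1 : good (fdn i (fdn (ordS i) lam)) (F i (F (ordS i) y)).
    case: (posnP (fdn (ordS i) lam (ordS i))) => h; first exact: (good_F_hole Hj).
    apply: (IH _ _ i Hj pi h); rewrite fdn_fdn //; apply: leq_trans HD.
    by apply: excess_fdn_hole => //; rewrite fdn_p.
  rewrite fdn_fdn // in H1.
  rewrite -(eup_fdn (i := ordS i) n1 pSi); apply: UE => //.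
  - have := pSi; rewrite fdn_i fdn_S // fdn_i; clear -Hi'; lia.
  - by rewrite fdn_S // fdn_p // ej.
  - by rewrite eup_fdn.
move=> lam y Hy HD0; have [m Hm] := Hy; split=> i Hi HD.
  case: (posnP (lam i)) => e; first exact: good_E_hole.
  exact: NE Hm e Hi HD.
case: (posnP (lam (ordS i))) => e; first exact: good_F_hole Hm Hi e.
exact: NF Hm Hi e HD.
Qed.

Lemma good_E lam i y : good lam y -> (0 < lam (ordS i))%N -> good (eup i lam) (E i y).
Proof.
move=> Hy Hi; have [H _] := good_moves Hy (leq_maxl (excess lam) (excess (eup i lam))).
by apply: H => //; apply: leq_maxr.
Qed.
Lemma good_F lam i y : good lam y -> (0 < lam i)%N -> good (fdn i lam) (F i y).
Proof.
move=> Hy Hi; have [_ H] := good_moves Hy (leq_maxl (excess lam) (excess (fdn i lam))).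
by apply: H => //; apply: leq_maxr.
Qed.

Lemma good_of_X y : wt omega y -> X y -> good omega y.
Proof.
move=> Hy Xy; exists 0%N; apply: good_stop; exists 0%N, y; split => //.
exact: slides_stop.
Qed.
End Straightening.
End WeightModules.

(** * Basis vectors of tensor space *)

Section Delta.
Variables (n r : nat).
Hypothesis n2 : (2 < n)%N.
Let n1 : (1 < n)%N := ltnW n2.
Implicit Types (i j : 'I_n) (k l p : 'I_r) (w : Wd r) (t : int).
Notation VecM := (VecM r).

Definition delta w : VecM := fun w' => (w' == w)%:R.

Lemma bump_delta w w' k (d : int) : (bumpw w' k d == w) = (w' == bumpw w k (- d)).
Proof.
apply/eqP/eqP => [<-|->]; first by rewrite bumpD addrN bump0.
by rewrite bumpD addNr bump0.
Qed.

Lemma E_at_delta i k w :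
  E_at i k (delta w) = if resid (w k - 1) i then left_weight i w k *: delta (bumpw w k (-1)) else 0.
Proof.
apply/funext => w'; rewrite /E_at /delta bump_delta.
have [->|ne] := eqVneq w' (bumpw w k (-1)).
  rewrite bump_k left_weight_out ?ltnn //; case: ifP => _; last exact: erefl.
  by rewrite scalrfctE eqxx.
rewrite mulr0n mulr0; case: ifP => _; case: ifP => _; rewrite ?scalrfctE ?(negPf ne) ?mulr0n ?scaler0; exact: erefl.
Qed.
Lemma F_at_delta i k w :
  F_at i k (delta w) = if resid (w k) i then right_weight i w k *: delta (bumpw w k 1) else 0.
Proof.
apply/funext => w'; rewrite /F_at /delta bump_delta opprK.
have [->|ne] := eqVneq w' (bumpw w k 1).
  rewrite bump_k addrK right_weight_out ?ltnn //; case: ifP => _; last exact: erefl.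
  by rewrite scalrfctE eqxx.
rewrite mulr0n mulr0; case: ifP => _; case: ifP => _; rewrite ?scalrfctE ?(negPf ne) ?mulr0n ?scaler0; exact: erefl.
Qed.

Lemma kappa_other i t : ~~ resid t i -> ~~ resid t (ordS i) -> kappa i t = 1.
Proof. by rewrite /kappa => /negPf-> /negPf->; rewrite mul1r invr1. Qed.
Lemma kappa_i i t : resid t i -> kappa i t = v.
Proof.
by move=> H; rewrite /kappa !(residP _ H) eqxx (negPf (ordS_neq i n1)) invr1 mulr1.
Qed.

Lemma word_wt0 w i : word_wt w i = 0%N -> forall p, resid (w p) i = false.
Proof. by move=> H p; apply/negP => /word_wt_pos; rewrite H. Qed.
Lemma word_wt1 w i : word_wt w i = 1%N ->
  exists2 k, resid (w k) i & forall p, p != k -> resid (w p) i = false.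
Proof.
move=> H; have [k Hk] : exists k, resid (w k) i.
  apply: contrapT => no; move: H; rewrite /word_wt big1 // => k _.
  by case: (boolP (resid _ _)) => // h; case: no; exists k.
exists k => // p pk; move: H; rewrite /word_wt (bigD1 k) // (bigD1 p) //= Hk.
by case: (resid (w p) i).
Qed.

Definition shift_down i t : int := if resid t (ordS i) then t - 1 else t.

Lemma Eo_delta i w : word_wt w i = 0%N -> word_wt w (ordS i) = 1%N ->
  Eo i (delta w) = delta [ffun k => shift_down i (w k)].
Proof.
move=> /word_wt0 H0 /word_wt1[k Hk Hp].
have E p : resid (w p - 1) i = (p == k).
  rewrite -(residS n2 _ i) subrK; case: (eqVneq p k) => [->|pk]; [exact: Hk|exact: Hp].
rewrite EoE (bigD1 k) //= big1 ?addr0 => [|p pk]; last first.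
  by rewrite E_at_delta E (negPf pk); exact: erefl.
rewrite E_at_delta E eqxx.
have -> : left_weight i w k = 1.
  apply: big1 => p pk; apply: kappa_other; first by rewrite H0.
  by rewrite Hp //; apply: contraL pk => /eqP->; rewrite ltnn.
rewrite scale1r; congr delta; apply/ffunP => p; rewrite !ffunE /shift_down.
by case: (eqVneq p k) => [->|/Hp->//]; rewrite Hk.
Qed.

Lemma word_wt_shift i w : word_wt w i = 0%N -> word_wt w (ordS i) = 1%N ->
  word_wt [ffun k => shift_down i (w k)] = eup i (word_wt w).
Proof.
move=> /word_wt0 H0 /word_wt1[k Hk Hp].
rewrite -(word_wt_bump' (k := k) n2); last by rewrite -(residS n2 _ i) subrK.
congr word_wt; apply/ffunP => p; rewrite !ffunE /shift_down.
by case: (eqVneq p k) => [->|/Hp->//]; rewrite Hk.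
Qed.

Lemma Es_delta s w : slidable s (word_wt w) ->
  Es (@Eo n r) s (delta w) = delta [ffun k => foldl (fun t i => shift_down i t) (w k) s].
Proof.
elim: s w => /= [|i s IH] w; first by move=> _; congr delta; apply/ffunP => k; rewrite ffunE.
move=> [e e' H]; rewrite Eo_delta // IH ?word_wt_shift //.
by congr delta; apply/ffunP => k; rewrite !ffunE.
Qed.

(** The origin of [swap_weight]: once the diagonal term is subtracted, whose factor depends only on
    the order of the positions, a single basis vector remains. *)
Lemma tau_delta i w k l : word_wt w i = 1%N -> word_wt w (ordS i) = 1%N ->
  resid (w k) i -> resid (w l) (ordS i) ->
  tau (@Eo n r) (@Fo n r) i (delta w) =
    delta (bumpw (bumpw w l (-1)) k 1) + (if (k < l)%N then v else v^-1) *: delta w.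
Proof.
move=> /word_wt1[k' Hk' Hp] /word_wt1[l' Hl' Hq] Hk Hl.
have Ek : k' = k.
  by apply/eqP; rewrite eq_sym; apply/negPn/negP => /Hp; rewrite Hk.
have El : l' = l.
  by apply/eqP; rewrite eq_sym; apply/negPn/negP => /Hq; rewrite Hl.
subst k' l'.
have kl : k != l.
  apply/eqP => e; subst l; have := resid_inj Hk Hl => e.
  by have := ordS_neq i n1; rewrite -e eqxx.
have lk : l != k by rewrite eq_sym.
rewrite /tau EoE (bigD1 l) //= big1 ?addr0 => [|p pl]; last first.
  by rewrite E_at_delta -(residS n2 _ i) subrK Hq //; exact: erefl.
rewrite E_at_delta -(residS n2 _ i) subrK Hl.
set w' := bumpw w l (-1).
have Hwl : resid (w' l) i by rewrite /w' bump_k -(residS n2 _ i) subrK.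
have Hwk : resid (w' k) i by rewrite /w' bump_l.
have Hwp p : p != k -> p != l -> resid (w' p) i = false.
  by move=> pk pl; rewrite /w' bump_l // Hp.
have oth p : p != k -> p != l -> kappa i (w' p) = 1.
  move=> pk pl; apply: kappa_other; first by rewrite Hwp.
  by rewrite /w' bump_l // Hq.
have -> : Fo i (left_weight i w l *: delta w') = left_weight i w l *: Fo i (delta w').
  by have := wm_FL (vec_weight_module r n2) i (left_weight i w l) (delta w') 0;
    rewrite !addr0 (F_0 n2 v_neq0 qnum_v_neq0 (vec_weight_module r n2)) addr0.
rewrite FoE (bigD1 k) // (bigD1 l) //= big1 ?addr0 => [|p /andP[pk pl]]; last first.
  by rewrite F_at_delta Hwp //; exact: erefl.
rewrite !F_at_delta Hwk Hwl.
have -> : bumpw w' l 1 = w by rewrite /w' bumpD addNr bump0.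
have LW : left_weight i w l = if (k < l)%N then v else 1.
  rewrite -[w](bump0 _ l) -(addNr 1) -bumpD -/w' left_weight_out ?ltnn //.
  rewrite /left_weight; case: ltnP => h.
    rewrite (bigD1 k) //= big1 ?mulr1 ?kappa_i // => p /andP[pl pk].
    by apply: oth => //; apply: contraL pl => /eqP->; rewrite ltnn.
  apply: big1 => p pl; apply: oth; first by apply: contraL pl => /eqP->; rewrite -leqNgt.
  by apply: contraL pl => /eqP->; rewrite ltnn.
have RWk : right_weight i w' k = if (k < l)%N then v^-1 else 1.
  rewrite /right_weight; case: ltnP => h.
    rewrite (bigD1 l) //= big1 ?mulr1 ?kappa_i // => p /andP[pk pl].
    by rewrite oth ?invr1 //; apply: contraL pk => /eqP->; rewrite ltnn.
  apply: big1 => p pk; rewrite oth ?invr1 //; apply: contraL pk => /eqP->; rewrite ?ltnn //.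
  by rewrite -leqNgt.
have RWl : right_weight i w' l = if (l < k)%N then v^-1 else 1.
  rewrite /right_weight; case: ltnP => h.
    rewrite (bigD1 k) //= big1 ?mulr1 ?kappa_i // => p /andP[pk pl].
    by rewrite oth ?invr1 //; apply: contraL pk => /eqP->; rewrite ltnn.
  apply: big1 => p pl; rewrite oth ?invr1 //; apply: contraL pl => /eqP->; rewrite ?ltnn //.
  by rewrite -leqNgt.
rewrite LW RWk RWl; case: (ltngtP k l) => h.
- by rewrite scalerDr !scalerA mulfV ?v_neq0 // scale1r mulr1.
- by rewrite !scale1r.
by move: kl; rewrite -(inj_eq (@ord_inj r)) h eqxx.
Qed.

Section Lift.
Hypotheses (r0 : (0 < r)%N) (rn : (r < n)%N).
Local Notation site := (site n2).

(** A word has weight [omega] when its letters have distinct residues less than [r] modulo [n];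
    [lift_int] numbers the letters of this kind by the integers. *)
Definition lift_int t : int := (t %% r)%Z + n%:Z * (t %/ r)%Z.
Definition lift_word w : Wd r := [ffun k => lift_int (w k)].

Lemma resid_frame (a : nat) (c : int) i : (a < n)%N -> resid (a%:Z + n%:Z * c) i = (a == i :> nat).
Proof.
by move=> an; rewrite /resid addrC mulrC modzMDl modz_nat modn_small.
Qed.
Lemma shift_down_site (k a : nat) (c : int) : (k.+1 < n)%N -> (a < n)%N ->
  shift_down (site k) (a%:Z + n%:Z * c) = (if a == k.+1 then k else a)%:Z + n%:Z * c.
Proof.
move=> kn an; rewrite /shift_down ordS_site resid_frame // siteE //.
by case: eqP => // ->; lia.
Qed.
Lemma shift_down_last (a : nat) (c : int) : (a < n)%N ->
  shift_down (lastsite n2) (a%:Z + n%:Z * c) =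
    if a == 0%N then n.-1%:Z + n%:Z * (c - 1) else a%:Z + n%:Z * c.
Proof.
move=> an; rewrite /shift_down ordS_last resid_frame // siteE //; last by lia.
by case: eqP => // ->; lia.
Qed.

Local Notation slide := (foldl (fun t i => shift_down i t)).

Lemma slide_up (k a : nat) (c : int) : (k < n)%N -> (a < n)%N ->
  slide (a%:Z + n%:Z * c) (map site (iota 0 k)) =
  (if (0 < a <= k)%N then a.-1 else a)%:Z + n%:Z * c.
Proof.
elim: k => [|k IH] kn an; first by case: ifP => //; lia.
rewrite -addn1 iotaD map_cat foldl_cat IH ?(ltnW kn) //= add0n shift_down_site //.
  by do 3?case: ifP => //; lia.
by case: ifP; lia.
Qed.
Lemma slide_back (b k a : nat) (c : int) : (b + k < n)%N -> (a <= b)%N \/ a = (b + k)%N ->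
  slide (a%:Z + n%:Z * c) (map site (rev (iota b k))) = (if (b < a)%N then b else a)%:Z + n%:Z * c.
Proof.
elim: k a => [|k IH] a kn H; first by case: ifP => //; lia.
rewrite -addn1 iotaD rev_cat /= shift_down_site; [|lia|lia].
rewrite IH; [|lia|by case: ifP; lia].
by do 3?case: ifP => //; lia.
Qed.

Lemma lift_intP t : exists a c, [/\ (a < r)%N, t = a%:Z + r%:Z * c & lift_int t = a%:Z + n%:Z * c].
Proof.
exists `|(t %% r)%Z|%N, (t %/ r)%Z.
have H := @modz_ge0 t r; have H' := @ltz_pmod t r; have := divz_eq t r.
have ge0 : 0 <= (t %% r)%Z by apply: H; lia.
have ltr : (t %% r)%Z < r by apply: H'; lia.
by move=> E; split; rewrite /lift_int ?gez0_abs //; lia.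
Qed.
Lemma lift_intE (a : nat) (c : int) : (a < r)%N -> lift_int (a%:Z + r%:Z * c) = a%:Z + n%:Z * c.
Proof.
move=> ar; rewrite /lift_int [a%:Z + r%:Z * c]addrC [r%:Z * c]mulrC modzMDl divzMDl; last by lia.
by rewrite modz_nat divz_nat modn_small // divn_small // addr0.
Qed.

(** Letters of residue [1, ..., r - 1] step down once. One of residue 0 crosses to the preceding
    period and is brought to residue [r - 1] by the second half of the path. *)
Lemma slide_rotate t :
  slide (lift_int t) (lastsite n2 :: back_slides r n2) = lift_int (t - 1).
Proof.
have [a [c [ar -> ->]]] := lift_intP t; rewrite /back_slides.
rewrite /= shift_down_last; last by lia.
rewrite foldl_cat; case: eqP => [->|a0].
  rewrite slide_up; [|lia|lia]; rewrite slide_back; [|lia|by case: ifP; lia].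
  rewrite (_ : 0%:Z + r%:Z * c - 1 = r.-1%:Z + r%:Z * (c - 1)); last by lia.
  rewrite lift_intE; last by lia.
  by congr (Posz _ + _); do 2?case: ifP; lia.
rewrite slide_up; [|lia|lia]; rewrite slide_back; [|lia|case: ifP; lia].
rewrite (_ : a%:Z + r%:Z * c - 1 = a.-1%:Z + r%:Z * c); last by lia.
rewrite lift_intE; last by lia.
by congr (Posz _ + _); do 2?case: ifP; lia.
Qed.

Lemma resid_lift t i : resid (lift_int t) i = ((t %% r)%Z == (i : nat)%:Z).
Proof.
have [a [c [ar -> ->]]] := lift_intP t; rewrite resid_frame; last by lia.
by rewrite addrC mulrC modzMDl modz_nat modn_small.
Qed.

Lemma word_wt_lift w : distinct w -> word_wt (lift_word w) = @omega n r.
Proof.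
move=> D; apply/funext => i; rewrite /word_wt /omega.
case: ltnP => ir.
  have [k Hk] := residue_surj r0 i D.
  have E p : resid (lift_word w p) i = (p == k).
    rewrite ffunE resid_lift; apply/eqP/eqP => [e|->].
      by apply: D; rewrite e Hk modz_nat modn_small.
    by rewrite Hk modz_nat modn_small.
  by rewrite (bigD1 k) //= E eqxx big1 // => p pk; rewrite E (negPf pk).
rewrite big1 // => p _; rewrite ffunE resid_lift; case: eqP => // e.
have := @ltz_pmod (w p) r; lia.
Qed.

Lemma lift_word_inj : injective lift_word.
Proof.
move=> w w' /ffunP e; apply/ffunP => k; move: (e k); rewrite !ffunE.
have [a [c [ar -> ->]]] := lift_intP (w k).
have [b [d [br -> ->]]] := lift_intP (w' k) => H.
have [E1 E2] : a = b /\ c = d; last by rewrite E1 E2.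
have E : a%:Z - b%:Z = n%:Z * (d - c) by lia.
have : d - c = 0; last by lia.
have [h|[h|//]] : (1 <= d - c) \/ ((d - c <= -1) \/ d - c = 0) by lia.
  by nia.
by nia.
Qed.

Lemma rotate_down_lift w : distinct w ->
  rotate_down (@Eo n r) n2 r (delta (lift_word w)) = delta (lift_word (shiftw w (- 1))).
Proof.
move=> D; have [H _] := slidable_rotate n2 rn r0.
rewrite /rotate_down Es_delta ?word_wt_lift //.
by congr delta; apply/ffunP => k; rewrite !ffunE slide_rotate.
Qed.
Lemma wt_delta w : wt_vec (@word_wt n r w) (delta w : VecM).
Proof.
move=> w' H; congr word_wt; apply/eqP; move: H; rewrite /delta.
by apply: contraNT => /negPf->; apply/eqP; exact: erefl.
Qed.
Lemma wt_delta_lift w : distinct w -> wt_vec (@omega n r) (delta (lift_word w) : VecM).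
Proof. by move=> D; rewrite -(word_wt_lift D); apply: wt_delta. Qed.
Lemma rotate_up_lift w : distinct w ->
  rotate_up (@Fo n r) n2 r (delta (lift_word w)) = delta (lift_word (shiftw w 1)).
Proof.
move=> D; have D1 : distinct (shiftw w 1) by move=> k l; rewrite !ffunE => /modzDr_inj /D.
have {1}-> : w = shiftw (shiftw w 1) (- 1) by apply/ffunP => k; rewrite !ffunE addrK.
rewrite -rotate_down_lift //.
by rewrite (rotate_downK n2 v_neq0 qnum_v_neq0 (vec_weight_module r n2) rn r0) //; apply: wt_delta_lift.
Qed.
End Lift.
End Delta.

Section DeltaWords.
Variables (n r : nat).
Hypotheses (n2 : (2 < n)%N) (rn : (r < n)%N) (r0 : (0 < r)%N).
Let n1 : (1 < n)%N := ltnW n2.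
Local Notation VecM := (VecM r).
Local Notation E := (@Eo n r).
Local Notation F := (@Fo n r).
Local Notation up := (rotate_up F n2 r).
Local Notation dn := (rotate_down E n2 r).
Local Notation T := (fun j => tau E F (site n2 j)).
Local Notation d w := (delta (lift_word n w) : VecM).
Implicit Types (w : {ffun 'I_r -> int}) (f g : VecM).

Lemma rotate_up_lin a f g : up (a *: f + g) = a *: up f + up g.
Proof.
rewrite /rotate_up; elim: (_ :: _) => //= i s ->; exact: (wm_FL (vec_weight_module r n2)).
Qed.

Lemma iter_up_lift m w : distinct w -> iter m up (d w) = d (shiftw w m).
Proof.
move=> D; elim: m => [|m IH]; first by congr delta; congr lift_word; apply/ffunP => k; rewrite !ffunE addr0.
have Dm : distinct (shiftw w m) by move=> k l; rewrite !ffunE => /modzDr_inj /D.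
rewrite iterS IH (rotate_up_lift n2 r0 rn) //.
by congr delta; congr lift_word; apply/ffunP => k; rewrite !ffunE; lia.
Qed.
Lemma iter_dn_lift m w : distinct w -> iter m dn (d w) = d (shiftw w (- m%:Z)).
Proof.
move=> D; elim: m => [|m IH]; first by congr delta; congr lift_word; apply/ffunP => k; rewrite !ffunE addr0.
have Dm : distinct (shiftw w (- m%:Z)) by move=> k l; rewrite !ffunE => /modzDr_inj /D.
rewrite iterS IH (rotate_down_lift n2 r0 rn) //.
by congr delta; congr lift_word; apply/ffunP => k; rewrite !ffunE; lia.
Qed.
Lemma rotate_lift c w : distinct w -> rotate up dn c (d w) = d (shiftw w c).
Proof.
case: c => m D; first exact: iter_up_lift.
by rewrite /rotate iter_dn_lift // -NegzE.
Qed.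

Lemma tau_lift w k l : distinct w -> (w k = 0 %[mod r])%Z -> next_to w k l -> k != l ->
  T 0%N (d w) = d (swapw w k l) + swap_weight v k l *: d w.
Proof.
move=> D wk wl kl.
have r1 : (1 < r)%N.
  by move: kl; rewrite -(inj_eq (@ord_inj r)); have := ltn_ord k; have := ltn_ord l; lia.
have om j : (j < r)%N -> @omega n r (site n2 j) = 1%N.
  by move=> H; rewrite /omega siteE ?H //; lia.
have wl' : (w l = 1 %[mod r])%Z by rewrite wl -modzDml wk modzDml.
rewrite (tau_delta (k := k) (l := l) n2).
- congr (delta _ + _); apply/ffunP => p; rewrite !ffunE.
  have [a [c [ar Ea La]]] := lift_intP n2 r0 rn (w p).
  case: (eqVneq p k) => [pk|pk].
    rewrite -pk in kl *; rewrite (negPf kl) La Ea.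
    have a0 : a = 0%N.
      move: wk; rewrite -pk Ea mod0z addrC mulrC modzMDl modz_nat modn_small //.
      by case.
    rewrite a0 (_ : 0%:Z + r%:Z * c + 1 = 1%N%:Z + r%:Z * c); last by lia.
    by rewrite (lift_intE n2 r0 rn) //; lia.
  case: (eqVneq p l) => [pl|pl] //.
  rewrite La Ea.
  have a1 : a = 1%N.
    by move: wl'; rewrite -pl Ea addrC mulrC modzMDl !modz_nat !modn_small // => -[].
  rewrite a1 (_ : 1%:Z + r%:Z * c - 1 = 0%N%:Z + r%:Z * c); last by lia.
  by rewrite (lift_intE n2 r0 rn) //; lia.
- by rewrite (word_wt_lift n2 r0 rn) ?om.
- by rewrite (word_wt_lift n2 r0 rn) // ordS_site om.
- by rewrite ffunE (resid_lift n2 r0 rn) wk mod0z siteE //; lia.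
by rewrite ordS_site ffunE (resid_lift n2 r0 rn) wl' modz_nat modn_small // siteE //; lia.
Qed.

Lemma theta_lift t w k l : distinct w -> (t = w k %[mod r])%Z -> next_to w k l -> k != l ->
  theta r up dn T (swap_weight v k l) t (d w) = d (swapw w k l).
Proof.
move=> D e wl kl; rewrite /theta /tz /res e.
have /modz_witness[c wk] : (w k = `|(w k %% r)%Z|%N %[mod r])%Z.
  by rewrite gez0_abs ?modz_mod // modz_ge0 //; lia.
set m := `|_|%N in wk *.
have Dm c' : distinct (shiftw w c') by move=> p p'; rewrite !ffunE => /modzDr_inj /D.
rewrite iter_dn_lift // (tau_lift (k := k) (l := l)) //; last first.
- by rewrite /next_to !ffunE addrAC; apply: modzDr_eq.
- by rewrite ffunE wk addrC addKr mod0z modzMl.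
rewrite [X in iter m _ X]addrC; have iterL j a f g : iter j up (a *: f + g) = a *: iter j up f + iter j up g.
  by elim: j => //= j ->; rewrite rotate_up_lin.
have Ds : distinct (swapw (shiftw w (- m%:Z)) k l).
  by apply: distinct_swapw => //; rewrite /next_to !ffunE addrAC; apply: modzDr_eq.
rewrite iterL !iter_up_lift //.
have -> : shiftw (shiftw w (- m%:Z)) m = w by apply/ffunP => p; rewrite !ffunE subrK.
rewrite addrC addKr; congr delta; congr lift_word; apply/ffunP => p; rewrite !ffunE.
by case: eqP => _; [lia|case: eqP => _; lia].
Qed.

(** Each [theta] step, with the parameter chosen in [basis_elt], turns one basis vector into
    another. This makes the word elements independent. *)
Lemma word_elt_delta w f : word_elt v E F n2 (d (base_word r)) w f -> distinct w -> f = d w.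
Proof.
elim=> [c D|{}w k l b a ds _ IH D]; first by rewrite rotate_lift //; apply: distinct_base.
have kl := descent_neq ds; have lk : l != k by rewrite eq_sym.
have D' := distinct_swapw D a kl.
rewrite IH // (theta_lift D' (k := l) (l := k)) ?swapwK //.
  by rewrite swapw_l // (modzDr_eq (-1) a) addrK.
exact: next_to_swapw.
Qed.
End DeltaWords.

(** * Comparison with an algebra given by the relations *)

Section HoleMoves.
Variables (n r : nat).
Hypotheses (n2 : (2 < n)%N) (rn : (r < n)%N).
Let n1 : (1 < n)%N := ltnW n2.

(** Particles to the right of a stack step in turn towards the next hole until a stack itself loses
    one, which lowers the excess; simple weights slide to [omega]. *)
Lemma hole_moves_ind (P : ('I_n -> nat) -> Prop) : P (@omega n r) ->
  (forall lam i, (0 < lam i)%N -> lam (ordS i) = 0%N -> P (fdn i lam) -> P lam) ->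
  (forall lam i, lam i = 0%N -> (0 < lam (ordS i))%N -> P (eup i lam) -> P lam) ->
  forall lam, size_wt lam = r -> P lam.
Proof.
move=> P0 PF PE lam; have [m] := ubnP (excess lam); elim: m lam => // m IH lam Hm Hs.
have [S|nS] := pselect (simple_wt lam).
  apply: (slides_ind n2 rn P0 _ S Hs) => mu i _ _ e e' _; apply: PE => //.
  by rewrite e'.
have [s Ls] : exists s, (2 <= lam s)%N.
  by apply: contrapT => no; apply: nS => p; case: ltnP => // H; case: no; exists p.
have [k [p Hg]] : exists k p, gap lam k s p.
  by apply: gap_ex => //; apply: hole_exists; rewrite Hs.
elim: k lam p Hm Hs Ls Hg {nS} => [|k IHk] lam p Hm Hs Ls Hg.
  have e := gap_end n2 Hg; inversion Hg; subst p; apply: (PF lam s) => //; first exact: ltnW.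
  by apply: IH; rewrite ?size_fdn ?(ltnW Ls) //; have := excess_fdn_le n2 (ltnW Ls) e; lia.
have Hp := gap_pos n2 Hg isT; have ep := gap_end n2 Hg.
apply: (PF lam p) => //; have ex := excess_fdn_le n2 Hp ep.
case: (ltnP 1 (lam p)) => Lp; first by apply: IH; rewrite ?size_fdn //; lia.
have ep1 : lam p = 1%N by lia.
have [p' Hg'] := gap_fdn n2 Hg ep1.
apply: IHk Hg'; [lia|by rewrite size_fdn|].
by rewrite fdn_p //; apply: (@neq_wt _ lam); lia.
Qed.
End HoleMoves.

Section ProductModule.
Variables (K : fieldType) (q : K) (n : nat) (M M' : lmodType K).
Variables (E F : 'I_n -> M -> M) (wt : ('I_n -> nat) -> M -> Prop).
Variables (E' F' : 'I_n -> M' -> M') (wt' : ('I_n -> nat) -> M' -> Prop).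

Definition prod_op (f : M -> M) (g : M' -> M') (z : (M * M')%type) : (M * M')%type :=
  (f z.1, g z.2).
Definition prod_wt lam (z : (M * M')%type) := wt lam z.1 /\ wt' lam z.2.

Lemma prod_weight_module : weight_module q E F wt -> weight_module q E' F' wt' ->
  weight_module q (fun i => prod_op (E i) (E' i)) (fun i => prod_op (F i) (F' i)) prod_wt.
Proof.
move=> W W'; split=> [i a [x x'] [y y']|i a [x x'] [y y']|lam a [x x'] [y y'] [? ?] [? ?]
  |i lam [y y'] [? ?] ?|i lam [y y'] [? ?] ?|i lam [y y'] [? ?] ?|i lam [y y'] [? ?] ?
  |i lam [y y'] [? ?]|i j [y y'] ?|i j [y y'] ?|i j [y y'] ?|i j [y y'] ?|i j [y y'] ?];
  rewrite /prod_op /=.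
- by rewrite (wm_EL W) (wm_EL W').
- by rewrite (wm_FL W) (wm_FL W').
- by split; [apply: (wm_wtL W)|apply: (wm_wtL W')].
- by rewrite (wm_E0 W (lam := lam)) // (wm_E0 W' (lam := lam)).
- by split; [apply: (wm_EU W)|apply: (wm_EU W')].
- by rewrite (wm_F0 W (lam := lam)) // (wm_F0 W' (lam := lam)).
- by split; [apply: (wm_FD W)|apply: (wm_FD W')].
- by rewrite (wm_EF W i (lam := lam)) // (wm_EF W' i (lam := lam)).
- by rewrite (wm_EFn W) // (wm_EFn W').
- by rewrite (wm_EE W) // (wm_EE W').
- by rewrite (wm_FF W) // (wm_FF W').
- by congr pair; [apply: (wm_SE W)|apply: (wm_SE W')].
by congr pair; [apply: (wm_SF W)|apply: (wm_SF W')].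
Qed.
End ProductModule.

Section Morphism.
Variables (K : fieldType) (q : K) (n r : nat) (n2 : (2 < n)%N) (M M' : lmodType K).
Variables (E F : 'I_n -> M -> M) (E' F' : 'I_n -> M' -> M') (f : M -> M').
Hypothesis fL : forall a x y, f (a *: x + y) = a *: f x + f y.
Hypotheses (fE : forall i x, f (E i x) = E' i (f x)) (fF : forall i x, f (F i x) = F' i (f x)).

Lemma morph_up x : f (rotate_up F n2 r x) = rotate_up F' n2 r (f x).
Proof. by rewrite /rotate_up; elim: (_ :: _) => //= i s <-. Qed.
Lemma morph_down x : f (rotate_down E n2 r x) = rotate_down E' n2 r (f x).
Proof. by rewrite /rotate_down; elim: (_ :: _) x => //= i s IH x; rewrite IH fE. Qed.

(** Used for the first projection of the product, to find the tensor component of a word element. *)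
Lemma morph_word_elt y0 (w : {ffun 'I_r -> int}) x :
  word_elt q E F n2 y0 w x -> word_elt q E' F' n2 (f y0) w (f x).
Proof.
have up m y : f (iter m (rotate_up F n2 r) y) = iter m (rotate_up F' n2 r) (f y).
  by elim: m => //= m <-; rewrite morph_up.
have dn m y : f (iter m (rotate_down E n2 r) y) = iter m (rotate_down E' n2 r) (f y).
  by elim: m => //= m <-; rewrite morph_down.
elim=> [c|{}w k l b a d _ IH].
  have -> : f (rotate (rotate_up F n2 r) (rotate_down E n2 r) c y0) =
    rotate (rotate_up F' n2 r) (rotate_down E' n2 r) c (f y0).
    by case: c => m; [apply: up|apply: (dn m.+1)].
  exact: basis_shift.
set t := theta _ _ _ _ _ _ _.
have -> : f t = theta r (rotate_up F' n2 r) (rotate_down E' n2 r)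
    (fun j => tau E' F' (site n2 j)) (swap_weight q l k) (w k) (f b).
  rewrite /t /theta addrC -scaleNr fL scaleNr [RHS]addrC; congr (_ + _).
  by rewrite /tz up /tau fF fE dn.
exact: basis_swap.
Qed.
End Morphism.

Section Weights.
Variables (n r : nat).
Implicit Types (l m : Lam n r) (lam : 'I_n -> nat).

Lemma lam_at_inj : injective (@lam_at n r).
Proof.
move=> l m e; apply: val_inj; apply/ffunP => i; apply: val_inj.
exact: (congr1 (fun f => f i) e).
Qed.
Lemma size_lam l : size_wt (lam_at l) = r.
Proof. exact: (eqP (svalP l)). Qed.
Lemma lam_ex lam : size_wt lam = r -> exists l, lam_at l = lam.
Proof.
move=> Hs; have ltS i : (lam i < r.+1)%N by rewrite ltnS -Hs /size_wt (bigD1 i) //= leq_addr.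
have P : (\sum_i ([ffun i => Ordinal (ltS i)] i : nat) == r)%N.
  by apply/eqP; rewrite -[RHS]Hs; apply: eq_bigr => i _; rewrite ffunE.
exists (exist _ [ffun i => Ordinal (ltS i)] P); apply/funext => i.
by rewrite /lam_at /= ffunE.
Qed.

Hypothesis n1 : (1 < n)%N.
Lemma lam_alpha l m i : (0 < lam_at l (ordS i))%N -> lam_at m = eup i (lam_at l) ->
  forall j, (lam_at m j)%:Z = (lam_at l j)%:Z + alpha i j.
Proof.
move=> H -> j; rewrite /alpha /eup; have ne := ordS_neq i n1.
case: (eqVneq j i) => [->|ji]; first by rewrite eq_sym (negPf ne); lia.
by case: (eqVneq j (ordS i)) => [->|_]; lia.
Qed.
Lemma lam_alphaN l m i : (0 < lam_at l i)%N -> lam_at m = fdn i (lam_at l) ->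
  forall j, (lam_at m j)%:Z = (lam_at l j)%:Z - alpha i j.
Proof.
move=> H -> j; rewrite /alpha /fdn; have ne := ordS_neq i n1.
case: (eqVneq j i) => [->|ji]; first by rewrite eq_sym (negPf ne); lia.
by case: (eqVneq j (ordS i)) => [->|_]; lia.
Qed.
End Weights.

Section LeftModule.
Variables (n r : nat) (B : algType Qv).
Hypothesis n2 : (2 < n)%N.
Variables (bi : Lam n r -> B) (bE bF : 'I_n -> B).
Hypothesis R : relations (alg_ops B) bi bE bF.
Let n1 : (1 < n)%N := ltnW n2.
Implicit Types (l m : Lam n r) (lam : 'I_n -> nat) (x y : B) (i j : 'I_n).

Lemma bi_mul l m : bi l * bi m = if l == m then bi l else 0.
Proof. by have [+ _] := R; apply. Qed.
Lemma bi_sum : \sum_l bi l = 1.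
Proof. by have [_ [+ _]] := R. Qed.
Lemma bE_mul i l m : (0 < lam_at l (ordS i))%N -> lam_at m = eup i (lam_at l) ->
  bE i * bi l = bi m * bE i.
Proof.
move=> H e; have [_ [_ [+ _]]] := R; move=> /(_ i l)[+ _]; apply=> //.
exact: lam_alpha.
Qed.
Lemma bE_mul0 i l : lam_at l (ordS i) = 0%N -> bE i * bi l = 0.
Proof. by move=> e; have [_ [_ [+ _]]] := R; move=> /(_ i l)[_]; apply. Qed.
Lemma bF_mul i l m : (0 < lam_at l i)%N -> lam_at m = fdn i (lam_at l) ->
  bF i * bi l = bi m * bF i.
Proof.
move=> H e; have [_ [_ [_ [+ _]]]] := R; move=> /(_ i l)[+ _]; apply=> //.
exact: lam_alphaN.
Qed.
Lemma bF_mul0 i l : lam_at l i = 0%N -> bF i * bi l = 0.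
Proof. by move=> e; have [_ [_ [_ [+ _]]]] := R; move=> /(_ i l)[_]; apply. Qed.
Lemma bEF i j : bE i * bF j = bF j * bE i +
  if i == j then \sum_l qint ((lam_at l j)%:Z - (lam_at l (ordS j))%:Z) *: bi l else 0.
Proof.
have [_ [_ [_ [_ [+ _]]]]] := R; move=> /(_ i j) /= H.
by rewrite -H addrC scaleN1r subrK.
Qed.

(** Stated as vanishing of the other components, it makes sense for every function [lam]; if [lam]
    is no composition of [r], it forces [x = 0]. *)
Definition left_wt lam x := forall l, lam_at l <> lam -> bi l * x = 0.

Lemma left_wt_bi l x : left_wt (lam_at l) (bi l * x).
Proof.
move=> m ne; rewrite mulrA bi_mul; case: eqP => [e|_]; last by rewrite mul0r.
by rewrite e in ne.
Qed.
Lemma left_wt_eq l x : left_wt (lam_at l) x -> bi l * x = x.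
Proof.
move=> H; rewrite -[RHS]mul1r -bi_sum mulr_suml (bigD1 l) //= big1 ?addr0 // => m ne.
by apply: H => /lam_at_inj e; rewrite e eqxx in ne.
Qed.
Lemma left_wtP lam x : left_wt lam x -> x = 0 \/ exists2 l, lam_at l = lam & bi l * x = x.
Proof.
move=> H; have [[l e]|no] := pselect (exists l, lam_at l = lam).
  by subst lam; right; exists l => //; apply: left_wt_eq.
left; rewrite -[LHS]mul1r -bi_sum mulr_suml big1 // => l _; apply: H => e.
by apply: no; exists l.
Qed.

Lemma left_weight_module :
  weight_module v (fun i x => bE i * x) (fun i x => bF i * x) left_wt.
Proof.
split.
- by move=> i a x y; rewrite mulrDr scalerAr.
- by move=> i a x y; rewrite mulrDr scalerAr.
- by move=> lam a x y Hx Hy l ne; rewrite mulrDr -scalerAr Hx // Hy // scaler0 addr0.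
- move=> i lam y /left_wtP[->|[l e <-]] e0; first by rewrite mulr0.
  by rewrite mulrA bE_mul0 ?mul0r // e.
- move=> i lam y /left_wtP[->|[l e <-]] H; first by move=> m _; rewrite !mulr0.
  subst lam; have [|m em] := @lam_ex n r (eup i (lam_at l)); first by rewrite size_eup ?size_lam.
  by rewrite mulrA (bE_mul H em) -mulrA -em; apply: left_wt_bi.
- move=> i lam y /left_wtP[->|[l e <-]] e0; first by rewrite mulr0.
  by rewrite mulrA bF_mul0 ?mul0r // e.
- move=> i lam y /left_wtP[->|[l e <-]] H; first by move=> m _; rewrite !mulr0.
  subst lam; have [|m em] := @lam_ex n r (fdn i (lam_at l)); first by rewrite size_fdn ?size_lam.
  by rewrite mulrA (bF_mul H em) -mulrA -em; apply: left_wt_bi.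
- move=> i lam y /left_wtP[->|[l e Hy]]; first by rewrite !mulr0 scaler0 addr0.
  rewrite !mulrA bEF eqxx mulrDl; congr (_ + _).
  rewrite -{1}Hy mulr_suml (bigD1 l) //= big1 ?addr0 => [|m ne].
    by rewrite -scalerAl mulrA bi_mul eqxx Hy -e.
  by rewrite -scalerAl mulrA bi_mul (negPf ne) mul0r scaler0.
- by move=> i j y ij; rewrite !mulrA bEF (negPf ij) addr0.
- move=> i j y a; have [_ [_ [_ [_ [_ [+ _]]]]]] := R.
  by move=> /(_ i j a)[+ _] => /= e; rewrite !mulrA e.
- move=> i j y a; have [_ [_ [_ [_ [_ [+ _]]]]]] := R.
  by move=> /(_ i j a)[_ +] => /= e; rewrite !mulrA e.
- move=> i j y a; have [_ [_ [_ [_ [_ [_ +]]]]]] := R.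
  move=> /(_ i j a)[+ _] => /= e.
  by rewrite -[RHS](mul0r y) -e !mulrDl -scalerAl !mulrA.
move=> i j y a; have [_ [_ [_ [_ [_ [_ +]]]]]] := R.
have a' : adjacent j i by rewrite /adjacent orbC.
move=> /(_ j i a')[_ +] => /= e.
by rewrite -[RHS](mul0r y) -e !mulrDl -scalerAl !mulrA.
Qed.

End LeftModule.

Section WeightProjection.
Variables (n r : nat).
Implicit Types (l : Lam n r) (w : Wd r).

Definition word_in l (w : Wd r) := [forall i, word_wt w i == lam_at l i].
Definition weight_proj l : Op r := fun f w => if word_in l w then f w else 0.

Lemma word_inP l w : reflect (word_wt w = lam_at l) (word_in l w).
Proof.
apply: (iffP forallP) => [H|-> i //]; apply/funext => i; exact/eqP.
Qed.

End WeightProjection.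

(** * Pairs whose operator vanishes *)

Section Kernel.
Variables (n r : nat) (B : algType Qv).
Hypotheses (n2 : (2 < n)%N) (rn : (r < n)%N) (r0 : (0 < r)%N).
Variables (bi : Lam n r -> B) (bE bF : 'I_n -> B).
Hypothesis R : relations (alg_ops B) bi bE bF.
Let n1 : (1 < n)%N := ltnW n2.
Implicit Types (l m : Lam n r) (lam : 'I_n -> nat) (i j : 'I_n) (b c : B).
Local Notation V := (VecM r).
Local Notation M := (VecM r * B)%type.
Local Notation Ev := (@Eo n r).
Local Notation Fv := (@Fo n r).

Definition to_word l (f : V) : V := weight_proj l f.

Definition pE i : M -> M := prod_op (Ev i) (fun x => bE i * x).
Definition pF i : M -> M := prod_op (Fv i) (fun x => bF i * x).
Definition pI l : M -> M := prod_op (to_word l) (fun x => bi l * x).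
Definition pwt := @prod_wt Qv n V B (@wt_vec n r) (left_wt bi).

Let W : weight_module v pE pF pwt.
Proof. exact: prod_weight_module (vec_weight_module r n2) (left_weight_module n2 R). Qed.

Let l0 : Lam n r := sval (cid (lam_ex (size_omega n2 rn))).
Let l0E : lam_at l0 = @omega n r. Proof. exact: svalP (cid (lam_ex (size_omega n2 rn))). Qed.

Let y0 : M := (delta (lift_word n (base_word r)), bi l0).
Let Zy0 : pwt (@omega n r) y0.
Proof.
split; first by apply: (wt_delta_lift n2 r0 rn); apply: distinct_base.
by move=> l; rewrite -l0E => ne; rewrite (bi_mul n2 R); case: eqP => // e; rewrite e in ne.
Qed.

Local Notation X := (hecke_span v pE pF n2 r y0).
Let XL a x y : X x -> X y -> X (a *: x + y).
Proof. exact: (hecke_span_lin v_neq0 qnum_v_neq0 W rn r0 Zy0). Qed.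
Let X_up x : X x -> X (rotate_up pF n2 r x).
Proof. exact: (hecke_span_up v_neq0 qnum_v_neq0 W rn r0 Zy0). Qed.
Let X_down x : X x -> X (rotate_down pE n2 r x).
Proof. exact: (hecke_span_dn v_neq0 qnum_v_neq0 W rn r0 Zy0). Qed.
Let X_tau (j : nat) x : (j.+1 < r)%N -> X x -> X (tau pE pF (site n2 j) x).
Proof. exact: (hecke_span_tau v_neq0 qnum_v_neq0 W rn r0 Zy0). Qed.

(** The coefficients of the first component at lifted words are dual to the word elements. *)
Lemma hecke_span_fst x : X x -> x.1 = 0 -> x = 0.
Proof.
move=> Hx x0.
apply: (hecke_span_detect v_neq0 qnum_v_neq0 W rn r0 Zy0 (p := fun w z => z.1 (lift_word n w))) Hx _.
  split=> [w a x1 x2|w w' z D Hz]; first exact: erefl.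
  have := morph_word_elt (M' := V) (f := fst) (E' := Ev) (F' := Fv) _ _ _ Hz.
  move=> /(_ (fun _ _ _ => erefl) (fun _ _ => erefl) (fun _ _ => erefl)).
  move=> /(word_elt_delta rn r0)-> //; rewrite /delta.
  by rewrite (inj_eq (@lift_word_inj n r n2 r0 rn)).
by move=> w; rewrite x0.
Qed.

Local Notation good := (good pE pF pwt r X).

Lemma slides_fst k lam x z : slides_to pE pwt r k lam x z -> X z -> x.1 = 0 -> x = 0.
Proof.
elim=> [{}x _|{}k {}lam i {}x {}z _ e e' _ Hx _ IH] Hz x0; first exact: hecke_span_fst.
rewrite -(F_E_slide n2 v_neq0 qnum_v_neq0 W Hx e e') IH //.
  exact: (F_0 n2 v_neq0 qnum_v_neq0 W).
by rewrite /= x0; apply: (E_0 n2 v_neq0 qnum_v_neq0 (vec_weight_module r n2)).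
Qed.

(** Each move into a hole has a left inverse up to the nonzero factor [[lam i]], so vanishing passes
    back along the chain. *)
Lemma good_fst lam x : good lam x -> x.1 = 0 -> x = 0.
Proof.
move=> [k]; elim=> [{}lam {}x [m [z [H Hz]]]|{}k {}lam i {}x Ri e Hx _ IH] x0.
  exact: slides_fst H Hz x0.
have := E_F_hole n2 v_neq0 qnum_v_neq0 W Hx e; rewrite IH.
  rewrite (E_0 n2 v_neq0 qnum_v_neq0 W) => /esym/eqP; rewrite scaler_eq0.
  case/orP => [|/eqP //]; rewrite (negPf (qnum_v_neq0 _)) //.
  by have := run_pos n2 Ri; lia.
by rewrite /= x0; apply: (F_0 n2 v_neq0 qnum_v_neq0 (vec_weight_module r n2)).
Qed.

Definition some_good x := exists lam, good lam x.
Definition good_span := lspan some_good.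

Lemma to_word_lin l a (f g : V) : to_word l (a *: f + g) = a *: to_word l f + to_word l g.
Proof.
apply/funext => w; rewrite /to_word /weight_proj !addrfctE !scalrfctE.
by case: ifP => _; rewrite ?scaler0 ?addr0.
Qed.
Lemma pI_lin l a x y : pI l (a *: x + y) = a *: pI l x + pI l y.
Proof.
case: x y => [f x] [g y]; rewrite /pI /prod_op /= to_word_lin.
by rewrite mulrDr -scalerAr.
Qed.

Lemma pI_same l x : pwt (lam_at l) x -> pI l x = x.
Proof.
case: x => [f x] [/= Hf Hx]; rewrite /pI /prod_op /= (left_wt_eq n2 R Hx).
congr pair; apply/funext => w; rewrite /to_word /weight_proj; case: word_inP => // ne.
by apply/esym/eqP/negPn/negP => /Hf /ne.
Qed.
Lemma pI_other l lam x : pwt lam x -> lam_at l <> lam -> pI l x = 0.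
Proof.
case: x => [f x] [/= Hf Hx] ne; rewrite /pI /prod_op /= Hx //.
congr pair; apply/funext => w; rewrite /to_word /weight_proj; case: word_inP => // e.
by apply/eqP/negPn/negP => /Hf e'; apply: ne; rewrite -e.
Qed.
Let G := good_facts v_neq0 qnum_v_neq0 W rn r0 XL X_up X_down X_tau.
Let GE := good_E v_neq0 qnum_v_neq0 W rn r0 XL X_up X_down X_tau.
Let GF := good_F v_neq0 qnum_v_neq0 W rn r0 XL X_up X_down X_tau.
Let GL := good_lin v_neq0 qnum_v_neq0 W rn r0 XL X_up X_down X_tau.
Let GX := good_of_X v_neq0 qnum_v_neq0 W rn r0 XL X_up X_down X_tau.

Let span_map (f : M -> M) : (forall a x y, f (a *: x + y) = a *: f x + f y) ->
  (forall x, some_good x -> good_span (f x)) -> forall x, good_span x -> good_span (f x).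
Proof.
move=> fL Pf; apply: (lspan_map (Z := fun=> True)) => // *; exact: fL.
Qed.

Lemma good_span_E i x : good_span x -> good_span (pE i x).
Proof.
apply: span_map => [|{}x [lam Hx]]; first exact: (wm_EL W).
have [Wx _] := G Hx; case: (posnP (lam (ordS i))) => e.
  by rewrite (wm_E0 W Wx e); apply: lspan0.
by apply: lspan_gen; exists (eup i lam); apply: GE.
Qed.
Lemma good_span_F i x : good_span x -> good_span (pF i x).
Proof.
apply: span_map => [|{}x [lam Hx]]; first exact: (wm_FL W).
have [Wx _] := G Hx; case: (posnP (lam i)) => e.
  by rewrite (wm_F0 W Wx e); apply: lspan0.
by apply: lspan_gen; exists (fdn i lam); apply: GF.
Qed.
Lemma good_span_I l x : good_span x -> good_span (pI l x).
Proof.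
apply: span_map => [|{}x [lam Hx]]; first exact: pI_lin.
have [Wx _] := G Hx; have [e|ne] := pselect (lam_at l = lam).
  by subst lam; rewrite pI_same //; apply: lspan_gen; exists (lam_at l).
by rewrite (pI_other Wx ne); apply: lspan0.
Qed.

(** Good vectors of one weight form a subspace; the alternative 0 covers the case that no summand
    has this weight. *)
Lemma pI_good_span l x : good_span x -> pI l x = 0 \/ good (lam_at l) (pI l x).
Proof.
elim=> [|a {}x y [lam Hx] _ IH].
  by left; have := pI_lin l (-1) 0 0; rewrite scaleN1r addNr scaleN1r addNr.
have [Wx _] := G Hx; rewrite pI_lin; have [e|ne] := pselect (lam_at l = lam); last first.
  by rewrite (pI_other Wx ne) scaler0 add0r.
subst lam; right; rewrite pI_same //; case: IH => [->|]; last exact: GL.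
by apply: GL => //; have := GL (-1) Hx Hx; rewrite scaleN1r addNr.
Qed.

Lemma good_span_fst x : good_span x -> x.1 = 0 -> x = 0.
Proof.
move=> Hx x0; have H l : pI l x = 0.
  have [//|Hl] := pI_good_span l Hx; apply: (good_fst Hl); rewrite /= x0.
  by apply/funext => w; rewrite /to_word /weight_proj; case: ifP.
rewrite [x]surjective_pairing x0; congr pair.
rewrite -[LHS]mul1r -(bi_sum n2 R) mulr_suml big1 // => l _.
by have /(congr1 snd) := H l.
Qed.

(** The generated algebra of pairs as a relation, which becomes the graph of the homomorphism once
    [b] is determined by [x]. *)
Inductive pair_gen : Op r -> B -> Prop :=
| pair_I l : pair_gen (weight_proj l) (bi l)
| pair_E i : pair_gen (@E_op n r i) (bE i)
| pair_F i : pair_gen (@F_op n r i) (bF i)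
| pair_one : pair_gen (@op_one r) 1
| pair_add x y b c : pair_gen x b -> pair_gen y c -> pair_gen (op_add x y) (b + c)
| pair_mul x y b c : pair_gen x b -> pair_gen y c -> pair_gen (op_mul x y) (b * c)
| pair_scale a x b : pair_gen x b -> pair_gen (op_scale a x) (a *: b).

Lemma pair_gen_span x b : pair_gen x b ->
  forall z : M, good_span z -> good_span ((x z.1 : V), b * z.2).
Proof.
elim=> [l|i|i||{}x y {}b c _ IHx _ IHy|{}x y {}b c _ IHx _ IHy|a {}x {}b _ IH] z Hz.
- exact: (good_span_I l).
- exact: (good_span_E i).
- exact: (good_span_F i).
- by rewrite mul1r -surjective_pairing.
- have := lspan_lin 1 (IHx _ Hz) (IHy _ Hz); rewrite scale1r.
  by congr lspan; congr pair; rewrite /= mulrDl.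
- by rewrite -mulrA; apply: (IHx (_, _)); apply: IHy.
have := lspan_lin a (IH _ Hz) (lspan0 _); rewrite addr0.
by congr lspan; congr pair; rewrite /= scalerAl.
Qed.

Lemma good_span_base : good_span y0.
Proof.
apply: lspan_gen; exists (@omega n r); apply: GX => //.
exact: (hecke_span_base n2 v_neq0 qnum_v_neq0 W rn r0 Zy0).
Qed.

(** Only [c] needs an operator as partner: it acts on the base vector, whose second component is
    [bi l0], and [b] is multiplied from the right afterwards. *)
Lemma idempotent_factor l : exists x c b, pair_gen x c /\ bi l = c * bi l0 * b.
Proof.
pose P lam := forall l, lam_at l = lam -> exists x c b, pair_gen x c /\ bi l = c * bi l0 * b.
suff H : P (lam_at l) by exact: H.
apply: (hole_moves_ind n2 rn (P := P)); last exact: size_lam.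
- move=> m; rewrite -l0E => /lam_at_inj ->; exists (@op_one r), 1, 1.
  by split; [apply: pair_one|rewrite mul1r mulr1].
- move=> lam i Hi e IH m em.
  have [|m' em'] := @lam_ex n r (fdn i lam); first by rewrite size_fdn // -em size_lam.
  have [x [c [b [Hx Hm']]]] := IH _ em'; subst lam.
  pose k := qnum v (lam_at m i)%:Z.
  have k0 : k != 0 by apply: qnum_v_neq0; lia.
  exists (op_scale k^-1 (op_mul (@E_op n r i) x)), (k^-1 *: (bE i * c)), (b * bF i).
  split; first by apply: pair_scale; apply: pair_mul => //; apply: pair_E.
  have Hw : left_wt bi (lam_at m) (bi m) by move=> p ne; rewrite (bi_mul n2 R); case: eqP => // ep; case: ne; rewrite ep.
  have := E_F_hole n2 v_neq0 qnum_v_neq0 (left_weight_module n2 R) Hw e.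
  rewrite (bF_mul n2 R Hi em') Hm' -/k => H.
  by rewrite -!scalerAl -[LHS]scale1r -(mulVf k0) -scalerA -H !mulrA.
- move=> lam i e Hi IH m em.
  have [|m' em'] := @lam_ex n r (eup i lam); first by rewrite size_eup // -em size_lam.
  have [x [c [b [Hx Hm']]]] := IH _ em'; subst lam.
  pose k := qnum v (lam_at m (ordS i))%:Z.
  have k0 : k != 0 by apply: qnum_v_neq0; lia.
  exists (op_scale k^-1 (op_mul (@F_op n r i) x)), (k^-1 *: (bF i * c)), (b * bE i).
  split; first by apply: pair_scale; apply: pair_mul => //; apply: pair_F.
  have Hw : left_wt bi (lam_at m) (bi m) by move=> p ne; rewrite (bi_mul n2 R); case: eqP => // ep; case: ne; rewrite ep.
  have := F_E_hole n2 v_neq0 qnum_v_neq0 (left_weight_module n2 R) Hw e.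
  rewrite (bE_mul n2 R Hi em') Hm' -/k => H.
  by rewrite -!scalerAl -[LHS]scale1r -(mulVf k0) -scalerA -H !mulrA.
Qed.

Lemma pair_gen_kernel x b : pair_gen x b -> x = @op_zero r -> b = 0.
Proof.
move=> Hxb x0.
have K l : b * bi l = 0.
  have [y [c [d [Hy ->]]]] := idempotent_factor l.
  have := pair_gen_span (pair_mul Hxb Hy) good_span_base.
  move=> /good_span_fst H.
  have /(congr1 snd) /= H' := H ltac:(by rewrite x0).
  by rewrite !mulrA H' mul0r.
by rewrite -[LHS]mulr1 -(bi_sum n2 R) mulr_sumr big1 // => l _; apply: K.
Qed.

End Kernel.

Lemma op_ext r (x y : Op r) : (forall f w, x f w = y f w) -> x = y.
Proof. by move=> H; apply/funext => f; apply/funext => w. Qed.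
Lemma op_sumE r (I : finType) (g : I -> Op r) (f : Vec r) w :
  (\big[@op_add r/@op_zero r]_k g k) f w = \sum_k g k f w.
Proof. exact: (big_morph (fun x : Op r => x f w)). Qed.

(** * The case r = 0 *)

Section EmptyTensor.
Variables (n : nat) (B : algType Qv) (bi : Lam n 0 -> B) (bE bF : 'I_n -> B).
Hypothesis n2 : (2 < n)%N.
Hypothesis R : relations (alg_ops B) bi bE bF.

Lemma lam_at0 (l : Lam n 0) i : lam_at l i = 0%N.
Proof. by have := ltn_ord (sval l i); rewrite ltnS leqn0 => /eqP. Qed.
Lemma lam0_eq (l m : Lam n 0) : l = m.
Proof. by apply: lam_at_inj; apply/funext => i; rewrite !lam_at0. Qed.
Lemma bi0 l : bi l = 1.
Proof. by rewrite -(bi_sum n2 R) (bigD1 l) //= big1 ?addr0 // => m /eqP[]; apply: lam0_eq. Qed.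
Lemma bE0 i : bE i = 0.
Proof.
have [|l _] := @lam_ex n 0 (fun=> 0%N); first by rewrite /size_wt big1.
by rewrite -[LHS]mulr1 -(bi0 l) (bE_mul0 n2 R) // lam_at0.
Qed.
Lemma bF0 i : bF i = 0.
Proof.
have [|l _] := @lam_ex n 0 (fun=> 0%N); first by rewrite /size_wt big1.
by rewrite -[LHS]mulr1 -(bi0 l) (bF_mul0 n2 R) // lam_at0.
Qed.

(** Without tensor factors there is one weight, whose idempotent is 1, and [E], [F] vanish by the
    relations, so only scalars remain. *)
Lemma pair_gen_scalar x b : pair_gen bi bE bF x b ->
  exists a, x = op_scale a (@op_one 0) /\ b = a *: 1.
Proof.
elim=> [l|i|i||{}x y {}b c _ [a [-> ->]] _ [a' [-> ->]]
  |{}x y {}b c _ [a [-> ->]] _ [a' [-> ->]]|a {}x {}b _ [a' [-> ->]]].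
- exists 1; rewrite bi0 scale1r; split => //; apply/funext => f; apply/funext => w.
  rewrite /weight_proj /op_scale mul1r; case: word_inP => // -[].
  by apply/funext => i; rewrite lam_at0 /word_wt big_ord0.
- exists 0; rewrite bE0 scale0r; split => //; apply/funext => f; apply/funext => w.
  by rewrite /E_op big_ord0 /op_scale mul0r.
- exists 0; rewrite bF0 scale0r; split => //; apply/funext => f; apply/funext => w.
  by rewrite /F_op big_ord0 /op_scale mul0r.
- exists 1; rewrite scale1r; split => //; apply/funext => f; apply/funext => w.
  by rewrite /op_scale mul1r.
- exists (a + a'); rewrite scalerDl; split => //; apply/funext => f; apply/funext => w.
  by rewrite /op_scale /op_add mulrDl.
- exists (a * a'); rewrite -scalerAl mul1r scalerA; split => //.
  by apply/funext => f; apply/funext => w; rewrite /op_scale /op_mul mulrA.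
exists (a * a'); rewrite scalerA; split => //; apply/funext => f; apply/funext => w.
by rewrite /op_scale mulrA.
Qed.

Lemma pair_gen_kernel0 x b : pair_gen bi bE bF x b -> x = @op_zero 0 -> b = 0.
Proof.
move=> /pair_gen_scalar[a [-> ->]] /(congr1 (fun x : Op 0 => x (fun=> 1) [ffun=> 0])).
by rewrite /op_scale /op_one /op_zero mulr1 => ->; rewrite scale0r.
Qed.
End EmptyTensor.

(** * Generators and relations of the affine Schur algebra *)

Section OperatorAlgebra.
Variables (n r : nat).
Hypothesis n2 : (2 < n)%N.
Let n1 : (1 < n)%N := ltnW n2.
Implicit Types (l m : Lam n r) (i j : 'I_n) (w : Wd r) (f : Vec r).

Lemma resid_ex (t : int) : exists i : 'I_n, resid t i.
Proof.
have H := @modz_ge0 t n; have H' := @ltz_pmod t n.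
have tn : (`|(t %% n)%Z|%N < n)%N by lia.
exists (Ordinal tn); rewrite /resid /= gez0_abs //; lia.
Qed.
Lemma size_word w : size_wt (word_wt (n := n) w) = r.
Proof.
rewrite /size_wt /word_wt exchange_big /= -[RHS]card_ord -sum1_card.
apply: eq_bigr => k _; have [i Hi] := resid_ex (w k).
rewrite (bigD1 i) //= Hi big1 // => j ne; by rewrite (residP j Hi) (negPf ne).
Qed.

Lemma word_in_ex w : exists l, forall m, word_in m w = (m == l).
Proof.
have [l e] := lam_ex (size_word w); exists l => m; apply/word_inP/eqP => [e'|-> //].
by apply: lam_at_inj; rewrite e.
Qed.

Lemma sum_proj (c : Lam n r -> Qv) f w l : (forall m, word_in m w = (m == l)) ->
  \sum_m c m * weight_proj m f w = c l * f w.
Proof.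
move=> H; rewrite (bigD1 l) //= {1}/weight_proj H eqxx big1 ?addr0 // => m ne.
by rewrite /weight_proj H (negPf ne) mulr0.
Qed.

Lemma op_relations : relations (op_ops r) (@weight_proj n r) (@E_op n r) (@F_op n r).
Proof.
split; [|split; [|split; [|split; [|split; [|split]]]]] => /=.
- move=> l m; case: (eqVneq l m) => [<-|ne]; apply: op_ext => f w;
    rewrite /op_mul /op_zero /weight_proj; first by case: (word_in l w).
  case: word_inP => // Hl; case: word_inP => // Hm; case/eqP: ne.
  by apply: lam_at_inj; rewrite -Hl.
- apply: op_ext => f w; rewrite op_sumE; have [l Hl] := word_in_ex w.
  have := sum_proj (fun=> 1) f Hl; rewrite mul1r /op_one => <-.
  by apply: eq_bigr => m _; rewrite mul1r.
- move=> i l; split=> [H m Hm|H]; apply: op_ext => f w; last first.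
    rewrite /op_mul /E_op /op_zero big1 // => k _; case: ifP => // Hk.
    rewrite /weight_proj; case: word_inP => [e|_]; last by rewrite mulr0.
    have : resid (bumpw w k 1 k) (ordS i) by rewrite bump_k residS.
    by move=> /word_wt_pos; rewrite e H ltnn.
  have em : lam_at m = eup i (lam_at l).
    apply/funext => j; have := Hm j; rewrite /alpha /eup.
    have ne := ordS_neq i n1; case: (eqVneq j i) => [->|_].
      by rewrite eq_sym (negPf ne); lia.
    by case: (eqVneq j (ordS i)) => [->|_]; lia.
  rewrite /op_mul [RHS]/weight_proj /E_op.
  case: word_inP => ew; last first.
    apply: big1 => k _; case: ifP => // Hk; rewrite /weight_proj.
    case: word_inP => [e|_]; last by rewrite mulr0.
    case: ew; rewrite em -e (word_wt_bump n2 Hk) eup_fdn //; exact: word_wt_pos Hk.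
  apply: eq_bigr => k _; case: ifP => // Hk; rewrite /weight_proj.
  case: word_inP => // ne; case: ne.
  by rewrite (word_wt_bump n2 Hk) ew em fdn_eup.
- move=> i l; split=> [H m Hm|H]; apply: op_ext => f w; last first.
    rewrite /op_mul /F_op /op_zero big1 // => k _; case: ifP => // Hk.
    rewrite /weight_proj; case: word_inP => [e|_]; last by rewrite mulr0.
    have : resid (bumpw w k (-1) k) i by rewrite bump_k.
    by move=> /word_wt_pos; rewrite e H ltnn.
  have em : lam_at m = fdn i (lam_at l).
    apply/funext => j; have := Hm j; rewrite /alpha /fdn.
    have ne := ordS_neq i n1; case: (eqVneq j i) => [->|_].
      by rewrite eq_sym (negPf ne); lia.
    by case: (eqVneq j (ordS i)) => [->|_]; lia.
  rewrite /op_mul [RHS]/weight_proj /F_op.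
  case: word_inP => ew; last first.
    apply: big1 => k _; case: ifP => // Hk; rewrite /weight_proj.
    case: word_inP => [e|_]; last by rewrite mulr0.
    case: ew; rewrite em -e (word_wt_bump' n2 Hk) fdn_eup //.
    by apply: (@word_wt_pos _ _ _ k); rewrite -(subrK 1 (w k)) residS.
  apply: eq_bigr => k _; case: ifP => // Hk; rewrite /weight_proj.
  case: word_inP => // ne; case: ne.
  by rewrite (word_wt_bump' n2 Hk) ew em eup_fdn.
- move=> i j; apply: op_ext => f w; rewrite /op_add /op_mul /op_scale.
  case: eqP => [<-|/eqP ne].
    rewrite op_sumE; have [l Hl] := word_in_ex w.
    have -> : E_op i (F_op i f) w = F_op i (E_op i f) w +
        qnum v ((word_wt w i)%:Z - (word_wt w (ordS i))%:Z) * f w.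
      exact: Eo_Fo_same.
    rewrite (sum_proj (fun l => qint ((lam_at l i)%:Z - (lam_at l (ordS i))%:Z)) f Hl).
    have -> : word_wt w = lam_at l by apply/word_inP; rewrite Hl.
    by rewrite mulN1r addrC addKr.
  have -> : E_op i (F_op j f) = F_op j (E_op i f) by apply: Eo_Fo.
  by rewrite mulN1r subrr.
- move=> i j na; split; apply/funext => f; first exact: (Eo_Eo n2 f na).
  exact: (Fo_Fo n2 f na).
move=> i j a; split; apply: op_ext => f w.
  exact: (congr1 (fun g : VecM r => g w) (Eo_serre n2 f a)).
have a' : adjacent j i by rewrite /adjacent orbC.
exact: (congr1 (fun g : VecM r => g w) (Fo_serre n2 f a')).
Qed.
End OperatorAlgebra.

(** * Diagonal operators in a generated algebra *)

Section Diagonal.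
Variables (r : nat) (G : Op r -> Prop).
Definition diagonal (g : Wd r -> Qv) : Op r := fun f w => g w * f w.
Local Notation D g := (gen_alg G (diagonal g)).

Lemma gen_alg_sub (H : Op r -> Prop) x : (forall y, G y -> gen_alg H y) -> gen_alg G x -> gen_alg H x.
Proof.
move=> GH; elim=> [y /GH //||y z _ ? _ ?|y z _ ? _ ?|a y _ ?].
- exact: ga_one.
- exact: ga_add.
- exact: ga_mul.
exact: ga_scale.
Qed.

Lemma gen_alg_zero : gen_alg G (@op_zero r).
Proof.
suff <- : op_scale 0 (@op_one r) = @op_zero r by apply: ga_scale; apply: ga_one.
by apply: op_ext => f w; rewrite /op_scale mul0r.
Qed.
Lemma gen_alg_sum (I : finType) (x : I -> Op r) : (forall k, gen_alg G (x k)) ->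
  gen_alg G (\big[@op_add r/@op_zero r]_k x k).
Proof.
by move=> H; apply: big_ind => [|y z|k _]; [apply: gen_alg_zero|apply: ga_add|apply: H].
Qed.

Lemma diag_const a : D (fun=> a).
Proof. exact: (ga_scale a (ga_one G)). Qed.
Lemma diag_add g h : D g -> D h -> D (fun w => g w + h w).
Proof.
move=> Hg Hh; have -> : diagonal (fun w => g w + h w) = op_add (diagonal g) (diagonal h).
  by apply: op_ext => f w; rewrite /diagonal mulrDl.
exact: ga_add.
Qed.
Lemma diag_mul g h : D g -> D h -> D (fun w => g w * h w).
Proof.
move=> Hg Hh; have -> : diagonal (fun w => g w * h w) = op_mul (diagonal g) (diagonal h).
  by apply: op_ext => f w; rewrite /diagonal -mulrA.
exact: ga_mul.
Qed.
Lemma diag_prod (I : finType) (P : pred I) (g : I -> Wd r -> Qv) :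
  (forall k, D (g k)) -> D (fun w => \prod_(k | P k) g k w).
Proof.
move=> H; have -> : (fun w => \prod_(k | P k) g k w) =
    \big[(fun g h w => g w * h w)/(fun=> 1)]_(k | P k) g k.
  by apply/funext => w; rewrite (big_morph (fun g => g w) (id1 := 1) (op1 := *%R)).
by apply: (big_ind (fun g => D g)) => [|g1 g2|k _]; [apply: diag_const|apply: diag_mul|apply: H].
Qed.
End Diagonal.

Section Generators.
Variables (n r : nat).
Hypothesis n2 : (2 < n)%N.
Implicit Types (l m : Lam n r) (i j : 'I_n) (w : Wd r).

Lemma card_resid i w : #|[pred k | resid (w k) i]| = word_wt w i.
Proof. by rewrite /word_wt -sum1_card big_mkcond /=; apply: eq_bigr => k _; rewrite inE; case: (resid _ _). Qed.

Definition idempotent_gens (y : Op r) : Prop :=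
  (exists l, y = @weight_proj n r l) \/ (exists i, y = @E_op n r i \/ y = @F_op n r i).

(** Only finitely many weights occur, so a function of the weight is a combination of projections;
    this yields [K_op] and [Kinv_op]. *)
Lemma diagonal_weight (G : Op r -> Prop) (c : ('I_n -> nat) -> Qv) :
  (forall l, gen_alg G (@weight_proj n r l)) -> gen_alg G (diagonal (fun w => c (word_wt w))).
Proof.
move=> H; suff -> : diagonal (fun w => c (word_wt w)) =
    \big[@op_add r/@op_zero r]_l op_scale (c (lam_at l)) (@weight_proj n r l).
  by apply: gen_alg_sum => l; apply: ga_scale.
apply: op_ext => f w; rewrite op_sumE; have [l Hl] := word_in_ex n2 w.
rewrite /op_scale (sum_proj n2 (fun l => c (lam_at l)) f Hl) /diagonal.
by have -> : word_wt w = lam_at l by apply/word_inP; rewrite Hl.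
Qed.

(** Lagrange interpolation at the values [v ^+ b] of [K_i]. *)
Lemma weight_proj_AffSchur l : @AffSchur n r (@weight_proj n r l).
Proof.
have vinj (a b : nat) : a != b -> v ^+ a - v ^+ b != 0.
  wlog ab : a b / (a < b)%N => [H ne|_].
    case: (ltngtP a b) => [h|h|e]; [exact: H| |by rewrite e eqxx in ne].
    by rewrite -oppr_eq0 opprB; apply: H => //; rewrite eq_sym.
  rewrite -(subnKC (ltnW ab)) exprD -{1}[v ^+ a]mulr1 -mulrBr mulf_neq0 //.
    by rewrite expf_neq0 // v_neq0.
  by rewrite subr_eq0 eq_sym v_exp_inj // subn_gt0.
pose g i (a : 'I_r.+1) w := \prod_(b < r.+1 | b != a) ((v ^+ a - v ^+ b)^-1 * (v ^+ word_wt w i - v ^+ b)).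
have gE i a w : g i a w = (word_wt w i == a)%:R.
  have wr : (word_wt w i < r.+1)%N.
    by rewrite ltnS -[X in (_ <= X)%N](size_word n2 w) /size_wt (bigD1 i) //= leq_addr.
  case: (eqVneq (word_wt w i) a) => [e|ne].
    by apply: big1 => b ba; rewrite e mulVf // vinj // eq_sym.
  by rewrite /g (bigD1 (Ordinal wr)) //= subrr mulr0 mul0r.
have -> : weight_proj l = diagonal (fun w => \prod_i g i (sval l i) w).
  apply: op_ext => f w; rewrite /weight_proj /diagonal.
  rewrite (eq_bigr _ (fun i _ => gE i _ _)); case: ifP => [/forallP H|/negbT].
    by rewrite big1 ?mul1r // => i _; rewrite H.
  by rewrite negb_forall => /existsP[i ne]; rewrite (bigD1 i) //= (negPf ne) !mul0r.
apply: diag_prod => i; apply: diag_prod => b; apply: diag_mul; first exact: diag_const.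
apply: diag_add; last exact: diag_const.
apply: ga_gen; exists i; right; right; left.
by apply: op_ext => f w; rewrite /K_op card_resid.
Qed.

Lemma AffSchur_gens x : @AffSchur n r x <-> gen_alg idempotent_gens x.
Proof.
have H l : gen_alg idempotent_gens (@weight_proj n r l) by apply: ga_gen; left; exists l.
split; apply: gen_alg_sub => y.
  move=> [i [->|[->|[->|->]]]].
  - by apply: ga_gen; right; exists i; left.
  - by apply: ga_gen; right; exists i; right.
  - have -> : @K_op n r i = diagonal (fun w => v ^+ word_wt w i).
      by apply: op_ext => f w; rewrite /K_op card_resid.
    exact: (diagonal_weight (fun lam => v ^+ lam i) H).
  have -> : @Kinv_op n r i = diagonal (fun w => v ^- word_wt w i).
    by apply: op_ext => f w; rewrite /Kinv_op card_resid.
  exact: (diagonal_weight (fun lam => v ^- lam i) H).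
case=> [[l ->]|[i [->|->]]]; first exact: weight_proj_AffSchur.
  by apply: ga_gen; exists i; left.
by apply: ga_gen; exists i; right; left.
Qed.
End Generators.

(** * The homomorphism out of the affine Schur algebra *)

Section UniversalProperty.
Variables (n r : nat) (B : algType Qv) (bi : Lam n r -> B) (bE bF : 'I_n -> B).
Hypotheses (n2 : (2 < n)%N) (rn : (r < n)%N).
Hypothesis R : relations (alg_ops B) bi bE bF.
Local Notation pair_gen := (pair_gen bi bE bF).

Lemma pair_gen_zero x b : pair_gen x b -> x = @op_zero r -> b = 0.
Proof.
case: (posnP r) => [r0|r0]; last exact: (pair_gen_kernel n2 rn r0 R).
by move: bi R x; rewrite r0 => bi0 R0 x; apply: (pair_gen_kernel0 n2 R0).
Qed.

Lemma pair_gen_fun x b c : pair_gen x b -> pair_gen x c -> b = c.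
Proof.
move=> Hb Hc; apply/eqP; rewrite -subr_eq0 -scaleN1r; apply/eqP.
apply: (pair_gen_zero (pair_add Hb (pair_scale (-1) Hc))).
by apply: op_ext => f w; rewrite /op_add /op_scale mulN1r subrr.
Qed.

Lemma pair_gen_ex x : @AffSchur n r x -> exists b, pair_gen x b.
Proof.
move=> /(AffSchur_gens n2); elim=> [y||y z _ [b Hb] _ [c Hc]|y z _ [b Hb] _ [c Hc]|a y _ [b Hb]].
- case=> [[l ->]|[i [->|->]]]; first by exists (bi l); apply: pair_I.
    by exists (bE i); apply: pair_E.
  by exists (bF i); apply: pair_F.
- by exists 1; apply: pair_one.
- by exists (b + c); apply: pair_add.
- by exists (b * c); apply: pair_mul.
by exists (a *: b); apply: pair_scale.
Qed.

(** The value 0 is a default for operators that occur in no pair; by [pair_gen_ex] there are none in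
    the affine Schur algebra. *)
Definition lift_map x : B :=
  if pselect (exists b, pair_gen x b) is left e then sval (cid e) else 0.
Lemma lift_mapE x b : pair_gen x b -> lift_map x = b.
Proof.
move=> Hb; rewrite /lift_map; case: pselect => [e|[]]; last by exists b.
exact: pair_gen_fun (svalP (cid e)) Hb.
Qed.
End UniversalProperty.

Theorem theorem2p6p1 (n r : nat) (Hn : (3 <= n)%N) (Hnr : (r < n)%N) :
  exists (ii : Lam n r -> Op r) (E F : 'I_n -> Op r),
    @presents n r (@AffSchur n r) ii E F.
Proof.
exists (@weight_proj n r), (@E_op n r), (@F_op n r); split.
- exact: (AffSchur_gens Hn).
- exact: op_relations.
move=> B bi bE bF R; exists (lift_map bi bE bF).
have L x b := lift_mapE Hn Hnr R (x := x) (b := b).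
split=> [x y Hx Hy|a x Hx||l|i].
- have [b Hb] := pair_gen_ex Hn Hnr R Hx.
  have [c Hc] := pair_gen_ex Hn Hnr R Hy.
  by rewrite (L _ _ Hb) (L _ _ Hc) (L _ _ (pair_add Hb Hc)) (L _ _ (pair_mul Hb Hc)).
- have [b Hb] := pair_gen_ex Hn Hnr R Hx.
  by rewrite (L _ _ Hb) (L _ _ (pair_scale a Hb)).
- exact: (L _ _ (pair_one _ _ _)).
- exact: (L _ _ (pair_I _ _ _ l)).
by split; [exact: (L _ _ (pair_E _ _ _ i))|exact: (L _ _ (pair_F _ _ _ i))].
Qed.
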